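(* Let $U,V,W\subset\mathbb{C}$ be nonempty compact sets, let $A_+=(a_{ij})_{i,j\in\mathbb{N}}\in\Psi E_+(U,V,W)$, let $(r_n)$ be a sequence in $\mathbb{N}$ with $r_n\to+\infty$, and let $A_n=(a_{ij})_{i,j=1}^{r_n}$ be the corresponding finite sections of $A_+$. If $p,q\in[1,\infty]$ with $p^{-1}+q^{-1}=1$ are both favourable, in particular if $p=q=2$ or $0\in U\cup W$ or $U=W$, then, for all $\varepsilon>0$, $$\operatorname{spec}_\varepsilon^pA_n\ \nearrow\ \operatorname{spec}_\varepsilon^pA_+\ =\ \Sigma_{+,\varepsilon}^p\qquad\text{as } n\to\infty,$$ so that also $\operatorname{spec}_\varepsilon^pA_n\to\overline{\operatorname{spec}_\varepsilon^pA_+}=\operatorname{Spec}_\varepsilon^pA_+$ and $\operatorname{spec}_\varepsilon^pA_n\xrightarrow{H}\operatorname{spec}_\varepsilon^pA_+$.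
   Context: $\mathbb{N}=\{1,2,\dots\}$, $\infty^{-1}:=0$. $M(U,V,W)$ is the set of bi-infinite tridiagonal matrices $A=(a_{ij})_{i,j\in\mathbb{Z}}$ with $a_{i,i-1}\in U$, $a_{i,i}\in V$, $a_{i,i+1}\in W$ for all $i$, all other entries zero. $M_+(U,V,W)$ is the set of semi-infinite tridiagonal matrices $(a_{ij})_{i,j\in\mathbb{N}}$ with subdiagonal entries in $U$, diagonal entries in $V$, superdiagonal entries in $W$, all other entries zero. $M_n(U,V,W)$ is the set of $n\times n$ matrices of the same kind. They act as bounded operators on $\ell^p(\mathbb{Z})$, $\ell^p(\mathbb{N})$, $\mathbb{C}^n$ with the $p$-norm; $\|\cdot\|_p$ is the induced norm. Invertibility, spectra, Fredholmness and Fredholm index of the infinite ones do not depend on $p$. $A_+\in M_+(U,V,W)$ is pseudoergodic, $A_+\in \Psi E_+(U,V,W)$, if for every $n\in\mathbb N$, every $B\in M_n(U,V,W)$ and every $\varepsilon>0$ there is a submatrix $C$ of $A_+$ composed of rows and columns $k+1,\dots,k+n$ of $A_+$, for some integer $k\ge0$, with $\|B-C\|<\varepsilon$. $\operatorname{spec}_\varepsilon^pB:=\{\lambda\in\mathbb{C}:\|(B-\lambda I)^{-1}\|_p>\varepsilon^{-1}\}$ and $\operatorname{Spec}_\varepsilon^pB:=\{\lambda\in\mathbb{C}:\|(B-\lambda I)^{-1}\|_p\ge\varepsilon^{-1}\}$, with $\|C^{-1}\|_p:=\infty$ if $C$ is not invertible. $\Sigma_{+,\varepsilon}^p:=\bigcup_{C_+\in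 M_+(U,V,W)}\operatorname{spec}_\varepsilon^pC_+$. The triple $(U,V,W)$ is compatible if all operators in $M(U,V,W)$ are invertible (equivalently, all operators in $M_+(U,V,W)$ are Fredholm); then all $B_+\in M_+(U,V,W)$ are Fredholm with the same index $\kappa(U,V,W)\in\{-1,0,1\}$. Favourability is defined as follows: suppose that $(U,V,W)$ is compatible with $\kappa(U,V,W)=0$, equivalently that all operators in $M_+(U,V,W)$ are invertible; then $p\in[1,\infty]$ is called favourable (for the triple $(U,V,W)$) if, for all $A_+\in\Psi E_+(U,V,W)$, $\|A_+^{-1}\|_p=\max_{C_+\in M_+(U,V,W)}\|C_+^{-1}\|_p=\max_{B\in M(U,V,W)}\|B^{-1}\|_p$. Set convergence, for $S_n,S\subset\mathbb{C}$: $S_n\nearrow S$ means $S_n\subset S$ for each $n$ and every $z\in S$ is in $S_n$ for all sufficiently large $n$. $S_n\to S$ means $\liminf S_n=\limsup S_n=S$, where $\liminf S_n$ is the set of limits of sequences $(z_n)$ with $z_n\in S_n$ for each $n$, and $\limsup S_n$ is the set of partial limits of such sequences. For nonempty bounded sets, $S_n\xrightarrow{H}S$ means $d_H(S_n,S)\to0$ with $d_H(A,B)=\max(\sup_{a\in A}\operatorname{dist}(a,B),\sup_{b\in B}\operatorname{dist}(b,A))$, where $\operatorname{dist}(a,B)=\inf_{b\in B}|a-b|$. *)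

(* Defs.v *)
From HB Require Import structures.
From mathcomp Require Import all_boot all_order all_algebra complex.
From mathcomp Require Import all_classical all_reals all_analysis.

Set Implicit Arguments.
Unset Strict Implicit.
Unset Printing Implicit Defensive.

Import Order.TTheory GRing.Theory Num.Theory numFieldNormedType.Exports.
Import ComplexField.

Local Open Scope classical_set_scope.
Local Open Scope ring_scope.
Local Open Scope complex_scope.

(* Ascribing [numClosedFieldType] gives [R[i]] the norm topology that
   MathComp-Analysis puts on every numerical field. *)
Definition Cplx (R : realType) : numClosedFieldType := R[i].

(* [`|z|] lives in [R[i]]; this is the modulus as a real number. *)
Definition modulus (R : realType) (z : Cplx R) : R := Normc.normc (z : R[i]).

Section SequenceSpaces.
Context {R : realType} {I : choiceType}.
Local Notation C := (Cplx R).

(* The index type is [int] for l^p(Z), [nat] for l^p(N), ['I_n] for C^n. *)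
Definition lpnorm (p : \bar R) (x : I -> C) : \bar R :=
  match p with
  | s%:E => ((\esum_(i in [set: I]) ((modulus (x i)) `^ s)%:E) `^ s^-1)%E
  | +oo%E => ereal_sup [set (modulus (x i))%:E | i in [set: I]]
  | -oo%E => 0%E
  end.

Definition lp (p : \bar R) : set (I -> C) := [set x | (lpnorm p x < +oo)%E].

(* The sum runs over the (finite) support of [j |-> a i j * x j]: every row of
   a tridiagonal matrix has at most three nonzero entries. *)
Definition mxop (a : I -> I -> C) (x : I -> C) : I -> C :=
  fun i => \sum_(j \in [set: I]) (a i j * x j).

Definition opnorm (p : \bar R) (T : (I -> C) -> (I -> C)) : \bar R :=
  ereal_sup [set lpnorm p (T x) | x in [set x | (lpnorm p x <= 1)%E]].

(* The values of [S] outside l^p are irrelevant. *)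
Definition is_lp_inverse (p : \bar R) (T S : (I -> C) -> (I -> C)) : Prop :=
  [/\ forall y, lp p y -> lp p (S y) /\ T (S y) = y,
      forall x, lp p x -> S (T x) = x
    & (opnorm p S < +oo)%E].

Definition lp_invertible (p : \bar R) (T : (I -> C) -> (I -> C)) : Prop :=
  exists S, is_lp_inverse p T S.

(* Norm of the inverse, with value +oo for a non-invertible operator. *)
Definition inv_norm (p : \bar R) (T : (I -> C) -> (I -> C)) : \bar R :=
  match pselect (lp_invertible p T) with
  | left h => opnorm p (projT1 (cid h))
  | right _ => +oo%E
  end.

Definition mx_shift (a : I -> I -> C) (z : C) : I -> I -> C :=
  fun i j => a i j - z *+ (i == j).

Definition spec_lt (p : \bar R) (eps : R) (a : I -> I -> C) : set C :=
  [set z | ((eps^-1)%:E < inv_norm p (mxop (mx_shift a z)))%E].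

Definition spec_le (p : \bar R) (eps : R) (a : I -> I -> C) : set C :=
  [set z | ((eps^-1)%:E <= inv_norm p (mxop (mx_shift a z)))%E].

Definition kernel_dim (p : \bar R) (T : (I -> C) -> (I -> C)) (n : nat) : Prop :=
  exists b : 'I_n -> I -> C,
    (forall k, lp p (b k) /\ T (b k) = (fun=> 0)) /\
    (forall x, lp p x -> T x = (fun=> 0) ->
       exists! c : {ffun 'I_n -> C}, x = (fun i => \sum_k c k * b k i)).

(* The classes of the [b k] form a basis of l^p / T(l^p). *)
Definition cokernel_dim (p : \bar R) (T : (I -> C) -> (I -> C)) (m : nat) : Prop :=
  exists b : 'I_m -> I -> C,
    (forall k, lp p (b k)) /\
    (forall y, lp p y ->
       exists! c : {ffun 'I_m -> C}, exists2 x, lp p x &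
         (fun i => y i - \sum_k c k * b k i) = T x).

(* A finite-codimensional range of a bounded operator is automatically closed. *)
Definition fredholm_of_index (p : \bar R) (T : (I -> C) -> (I -> C)) (k : int) :=
  exists n m : nat, [/\ kernel_dim p T n, cokernel_dim p T m & k = n%:Z - m%:Z].

End SequenceSpaces.

Section Tridiagonal.
Context {R : realType}.
Local Notation C := (Cplx R).
Implicit Types U V W : set C.

(* [pos] is the integer position of an index. *)
Definition tridiag (I : Type) (pos : I -> int) U V W (a : I -> I -> C) : Prop :=
  forall i j : I,
    [/\ pos i = pos j + 1 -> U (a i j),
        pos i = pos j -> V (a i j),
        pos j = pos i + 1 -> W (a i j)
      & (1 < `|pos i - pos j|)%R -> a i j = 0].

Definition M U V W : set (int -> int -> C) :=
  [set a | tridiag (fun i : int => i) U V W a].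

(* Row and column 1 of the semi-infinite matrix have index 0 here. *)
Definition Mplus U V W : set (nat -> nat -> C) :=
  [set a | tridiag (fun i : nat => i%:Z) U V W a].

Definition Mfin (n : nat) U V W : set 'M[C]_n :=
  [set B : 'M[C]_n | tridiag (fun i : 'I_n => (val i)%:Z) U V W B].

Definition section_mx (a : nat -> nat -> C) (k n : nat) : 'M[C]_n :=
  \matrix_(i < n, j < n) a (k + i)%N (k + j)%N.

(* All norms on n x n matrices being equivalent, the induced 2-norm is used. *)
Definition pseudoergodic_plus U V W (a : nat -> nat -> C) : Prop :=
  Mplus U V W a /\
  forall n : nat, (0 < n)%N -> forall B : 'M[C]_n, Mfin U V W B ->
    forall eps : R, 0 < eps ->
      exists k : nat, (opnorm 2%:E (mxop (B - section_mx a k n)%R) < eps%:E)%E.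

Definition Sigma_plus (p : \bar R) (eps : R) U V W : set C :=
  \bigcup_(c in Mplus U V W) spec_lt p eps c.

Definition compatible (p : \bar R) U V W : Prop :=
  forall b, M U V W b -> lp_invertible p (mxop b).

Definition kappa_eq (p : \bar R) U V W (k : int) : Prop :=
  forall b, Mplus U V W b -> fredholm_of_index p (mxop b) k.

Definition is_max (S : set (\bar R)) (m : \bar R) : Prop := S m /\ ubound S m.

(* Only meaningful for a compatible triple with kappa = 0. *)
Definition favourable (p : \bar R) U V W : Prop :=
  forall a, pseudoergodic_plus U V W a ->
    is_max [set inv_norm p (mxop c) | c in Mplus U V W] (inv_norm p (mxop a)) /\
    is_max [set inv_norm p (mxop b) | b in M U V W] (inv_norm p (mxop a)).

(* If A is in M(U,V,W), then A - z I is in M(U,V-z,W).  Pseudospectra involve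
   the inverses of all these shifts, so favourability is needed for every
   shifted triple to which the notion applies. *)
Definition favourable_shifts (p : \bar R) U V W : Prop :=
  forall z : C, let Vz := [set v - z | v in V] in
    compatible p U Vz W -> kappa_eq p U Vz W 0 -> favourable p U Vz W.

End Tridiagonal.

Section SetConvergence.
Context {R : realType}.
Local Notation C := (Cplx R).
Implicit Types (S : nat -> set C) (T : set C).

Definition increases_to S T : Prop :=
  (forall n, S n `<=` T) /\ (forall z, T z -> \forall n \near \oo, S n z).

Definition set_liminf S : set C :=
  [set z | exists2 u : nat -> C, forall n, S n (u n) & u @ \oo --> z].

Definition set_limsup S : set C :=
  [set z | exists2 u : nat -> C, forall n, S n (u n) &
     exists2 phi : nat -> nat, {homo phi : m n / (m < n)%N} &
       u (phi n) @[n --> \oo] --> z].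

Definition set_cvg S T : Prop := set_liminf S = T /\ set_limsup S = T.

Definition set_dist (a : C) T : \bar R :=
  ereal_inf [set (modulus (a - b))%:E | b in T].

Definition hausdorff_dist (A B : set C) : \bar R :=
  maxe (ereal_sup [set set_dist a B | a in A])
       (ereal_sup [set set_dist b A | b in B]).

Definition nonempty_bounded T : Prop :=
  T !=set0 /\ exists m : R, forall z, T z -> modulus z <= m.

Definition hausdorff_cvg S T : Prop :=
  [/\ forall n, nonempty_bounded (S n), nonempty_bounded T
    & hausdorff_dist (S n) T @[n --> \oo] --> 0%E].

End SetConvergence.

(* Main.v *)
Require Import Defs.
From mathcomp Require Import all_boot all_order all_algebra complex.
From mathcomp Require Import all_classical all_reals all_analysis.
From mathcomp Require Import cyclic separable cyclotomic.
From mathcomp Require Import ring lra zify finmap.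
Import Order.TTheory GRing.Theory Num.Theory numFieldNormedType.Exports.

Set Implicit Arguments.
Unset Strict Implicit.
Unset Printing Implicit Defensive.

Local Open Scope classical_set_scope.
Local Open Scope ring_scope.

(** Every operator is read off a bi-infinite triple [t] of coefficient
    sequences: compressed to the nonnegative integers it is a semi-infinite
    matrix, on all of the integers a bi-infinite one, on [0, n) a finite
    section.  The statement [linv p D t K], used throughout, says that the
    compression to [D] is invertible on l^p with inverse of norm at most [K];
    thus a point is outside the eps-pseudospectrum exactly when [linv] holds
    with [K = eps^-1] for the shifted triple [ts z t].

    The heart of the matter is [pe_propagate]: a bound [K] on the inverse of
    the pseudoergodic operator [A - z] is inherited by all operators of the
    class and by all their finite sections.  Translated windows of [A] approximate
    every bi-infinite operator [B], and a limit of operators whose inverses are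
    bounded by [K] again has an inverse bounded by [K] ([limit_inv]), so [K]
    works on the integers.  Gluing kernel vectors of two half-line operators
    into one of a bi-infinite operator shows that all half-line operators are
    invertible as soon as one is ([coburn], [half_line_all]), and
    favourability of [p] transfers the bound to them.  Transposition followed by
    reflection preserves M(U,V,W) and exchanges [p] and [q], so favourability of
    [q] gives the same bound for the half-line operators of the transposed
    class.  A finite section then inherits it ([section_LB]): a vector [x] on
    [0, n) with too small an image is repeated as [x, 0, rho x, 0, rho^2 x, ...]
    with [rho] cancelling the coupling across the gaps; [rho] has
    modulus at most 1 when read in one of the two directions, and after a slight
    damping the result is a vector on the half line with too small an image.
    In the other direction [limit_inv] passes from infinitely many sections back
    to [A] ([sections_limit]).  This gives the monotone convergence, the
    equality with [Sigma_plus] and the openness of the set where the norm of the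
    resolvent is below a constant.

    The closure of the pseudospectrum is the closed one because the norm of the
    resolvent cannot be constantly at most [M] near a point where it equals [M]
    ([no_plateau]).  If it were, averaging truncated resolvent series over
    roots of unity with a Fejer weight produces [x] and [y] such that [x + om y]
    is, for every unimodular [om], hardly longer than [x], although [y] is not small
    ([plateau_vec]); for [p >= 2] and for [p = 1] this contradicts
    convexity inequalities for complex numbers, and duality covers the other [p].

    The cases in which favourability is automatic rest on extending a vector
    from the half line to the integers without enlarging its image: by zero if
    [0 \in W], by a solution of a decoupled equation if [0 \in U], and by a
    second almost minimizing vector if [U = W] or [p = 2] ([glue_LB]).  Finally,
    the convergence of sets is a general fact about increasing sequences of
    nonempty subsets of a bounded subset of the plane. *)
(** Facts about real numbers never help an integer goal here, and they slow
    the decision procedure down. *)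
Ltac ilia := (repeat match goal with
  | R : realType, H : context [?R'] |- _ => constr_eq R R'; clear H end); lia.

(** * Modulus of a complex number *)
Section Modulus.
Context {R : realType}.
Local Notation C := (Cplx R).
Implicit Types x y z : C.

Lemma mdE z : `|z| = (modulus z)%:C%C.
Proof. by case: z. Qed.

Lemma md0 : modulus (0 : C) = 0.
Proof. exact: ComplexField.Normc.normc0. Qed.
Lemma md1 : modulus (1 : C) = 1.
Proof. exact: ComplexField.Normc.normc1. Qed.
Lemma mdM x y : modulus (x * y) = modulus x * modulus y.
Proof. exact: ComplexField.Normc.normcM. Qed.
Lemma mdV x : modulus x^-1 = (modulus x)^-1.
Proof. exact: ComplexField.Normc.normcV. Qed.
Lemma mdN x : modulus (- x) = modulus x.
Proof. exact: normcN. Qed.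
Lemma mdD x y : modulus (x + y) <= modulus x + modulus y.
Proof. exact: le_normcD. Qed.
Lemma mdB x y : modulus (x - y) <= modulus x + modulus y.
Proof. by rewrite -[modulus y]mdN; exact: mdD. Qed.
Lemma mdC x y : modulus (x - y) = modulus (y - x).
Proof. by rewrite -opprB mdN. Qed.
Lemma md_ge0 x : 0 <= modulus x.
Proof. by case: x => a b; exact: sqrtr_ge0. Qed.
Lemma md_eq0 x : (modulus x == 0) = (x == 0).
Proof.
apply/eqP/eqP => [|->]; last exact: md0.
exact: ComplexField.Normc.eq0_normc.
Qed.
Lemma md_gt0 x : (0 < modulus x) = (x != 0).
Proof. by rewrite lt_def md_ge0 md_eq0 andbT. Qed.
Lemma mdR (a : R) : modulus (a%:C%C : C) = `|a|.
Proof. by rewrite /modulus /= expr0n addr0 sqrtr_sqr. Qed.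
Lemma md_sum (J : Type) (s : seq J) (f : J -> C) :
  modulus (\sum_(i <- s) f i) <= \sum_(i <- s) modulus (f i).
Proof.
elim: s => [|a s ih]; first by rewrite !big_nil md0.
by rewrite !big_cons (le_trans (mdD _ _))// lerD2l.
Qed.
Lemma md_sub x y : modulus x - modulus y <= modulus (x - y).
Proof. by rewrite lerBlDr -{1}(subrK y x) mdD. Qed.

End Modulus.

(** * Norm bounds on sequence spaces *)
Section Norm.
Context {R : realType}.
Local Notation C := (Cplx R).

(** A bound on the norm instead of its value: the extended real [lpnorm] then
    never has to be manipulated, and no summability hypothesis is required. *)
Definition nle (I : choiceType) (p : \bar R) (x : I -> C) (c : R) : Prop :=
  (lpnorm p x <= c%:E)%E.

(** Bounding all finite partial sums turns questions about the infinite sum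
    into finite ones. *)
Lemma nle_finP (I : choiceType) (s : R) (x : I -> C) c : 1 <= s ->
  nle s%:E x c <-> 0 <= c /\
   forall J : seq I, uniq J -> \sum_(i <- J) (modulus (x i)) `^ s <= c `^ s.
Proof.
move=> s1; have s0 : 0 < s by lra.
have si0 : 0 < s^-1 by rewrite invr_gt0.
rewrite /nle /=.
set S := esum _ _.
have S0 : (0 <= S)%E by apply: esum_ge0 => i _; rewrite lee_fin powR_ge0.
have key : (0 <= c) -> (S `^ s^-1 <= c%:E)%E = (S <= (c `^ s)%:E)%E.
  move=> c0.
  case: S S0 => [r|_|//]; last by rewrite poweRyr ?gt_eqF// !leye_eq.
  rewrite lee_fin => r0; rewrite poweR_EFin !lee_fin; apply/idP/idP => h.
    have := @ge0_ler_powR _ s (ltW s0) _ _ _ _ h.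
    rewrite -powRrM mulVf ?gt_eqF// powRr1//; apply; rewrite nnegrE ?powR_ge0//.
  have := @ge0_ler_powR _ s^-1 (ltW si0) _ _ _ _ h.
  by rewrite -powRrM mulfV ?gt_eqF// powRr1//; apply; rewrite nnegrE ?powR_ge0.
split=> [h|[c0 h]].
  have c0 : 0 <= c by rewrite -lee_fin (le_trans _ h)// poweR_ge0.
  split=> // J uJ; move: h; rewrite (key c0) => h.
  rewrite -lee_fin (le_trans _ h)// -sumEFin.
  rewrite fsbig_seq//; apply: ereal_sup_ubound.
  by exists [set` J] => //; split=> //; exact: finite_seq.
rewrite (key c0); apply: ge_ereal_sup => _ [A [fA _] <-].
rewrite fsbig_finite//= sumEFin lee_fin; apply: h; exact: fset_uniq.
Qed.

Lemma nle_infP (I : choiceType) (x : I -> C) c :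
  nle +oo%E x c <-> forall i, modulus (x i) <= c.
Proof.
rewrite /nle /=; split=> [h i|h].
  by rewrite -lee_fin (le_trans _ h)//; apply: ereal_sup_ubound; exists i.
by apply: ge_ereal_sup => _ [i _ <-]; rewrite lee_fin.
Qed.

Lemma powR_le (s a b : R) : 0 <= s -> 0 <= a -> a <= b -> a `^ s <= b `^ s.
Proof.
by move=> s0 a0 ab; rewrite ge0_ler_powR// nnegrE// (le_trans a0).
Qed.

Lemma powRVK (s a : R) : 1 <= s -> 0 <= a -> (a `^ s^-1) `^ s = a.
Proof.
move=> s1 a0; rewrite -powRrM mulVf ?powRr1// gt_eqF//; lra.
Qed.

Lemma sum_powR_div (J : Type) (r : seq J) (f : J -> C) (s c : R) : 0 < c ->
  \sum_(i <- r) modulus (f i) `^ s <= c `^ s ->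
  \sum_(i <- r) (modulus (f i) / c) `^ s <= 1.
Proof.
move=> c0 h; have c1 : 0 <= c^-1 by rewrite invr_ge0 ltW.
have cs : 0 < c `^ s by exact: powR_gt0.
under eq_bigr => i _ do rewrite (powRM _ (md_ge0 _) c1).
rewrite -mulr_suml -powR_inv1 -?powRrM ?mulN1r ?powRN; last exact: ltW.
by rewrite ler_pdivrMr// mul1r.
Qed.

Lemma powR_combine (s e a b c : R) : 1 <= s -> 0 <= e -> 0 <= a -> 0 <= b ->
  0 <= c -> a + b <= c `^ s ->
  (e * a `^ s^-1) `^ s + (e * b `^ s^-1) `^ s <= (e * c) `^ s.
Proof.
move=> s1 e0 a0 b0 c0 h.
rewrite (powRM s e0 (powR_ge0 a s^-1)) (powRM s e0 (powR_ge0 b s^-1)).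
by rewrite (powRM s e0 c0) !powRVK// -mulrDr ler_wpM2l// powR_ge0.
Qed.

Lemma exp_ind (P : \bar R -> Prop) : P +oo%E -> (forall s : R, 1 <= s -> P s%:E) ->
  forall p : \bar R, (1 <= p)%E -> P p.
Proof. by move=> Py Ps [r|//|//]; rewrite lee_fin => r1; apply: Ps. Qed.

Variable (p : \bar R) (p1 : (1 <= p)%E).

Implicit Types x y : int -> C.

Lemma nle_trans x a b : nle p x a -> a <= b -> nle p x b.
Proof. by rewrite /nle => h ab; rewrite (le_trans h)// lee_fin. Qed.

Lemma nle_pt x c i : nle p x c -> modulus (x i) <= c.
Proof.
move: p p1; apply: exp_ind; first by move/nle_infP.
move=> s s1 /(nle_finP _ _ s1)[c0 /(_ [:: i] isT)].
rewrite big_seq1 => h; have s0 : 0 < s by lra.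
rewrite leNgt; apply/negP => lt; move: h; rewrite leNgt gt0_ltr_powR//.
- by rewrite nnegrE md_ge0.
Qed.

Lemma nle_ge0 x c : nle p x c -> 0 <= c.
Proof. by move=> /(nle_pt 0) h; rewrite (le_trans _ h)// md_ge0. Qed.

Lemma nle_scale x y k c : 0 <= k ->
  (forall i, modulus (y i) <= k * modulus (x i)) -> nle p x c -> nle p y (k * c).
Proof.
move=> k0 h; move: p p1; apply: exp_ind.
  move/nle_infP => hx; apply/nle_infP => i; rewrite (le_trans (h i))//.
  by rewrite ler_wpM2l.
move=> s s1; have s0 : 0 < s by lra.
move=> /(nle_finP _ _ s1)[c0 hx]; apply/nle_finP => //; split=> [|J uJ].
  by rewrite mulr_ge0.
rewrite powRM// (le_trans _ (ler_wpM2l (powR_ge0 _ _) (hx J uJ)))//.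
rewrite mulr_sumr; apply: ler_sum => i _; rewrite -powRM ?md_ge0//.
by rewrite powR_le ?md_ge0// ltW.
Qed.

Lemma nle_solid x y c : (forall i, modulus (y i) <= modulus (x i)) ->
  nle p x c -> nle p y c.
Proof.
move=> h /(@nle_scale x y 1 c ler01); rewrite mul1r; apply => i.
by rewrite mul1r.
Qed.

Lemma nle_reidx x c (f : int -> int) : injective f -> nle p x c ->
  nle p (fun i => x (f i)) c.
Proof.
move=> fi; move: p p1; apply: exp_ind => [|s s1].
  by move/nle_infP => hx; apply/nle_infP => i.
move=> /(nle_finP _ _ s1)[c0 hx]; apply/nle_finP => //; split=> // J uJ.
rewrite -(big_map f predT (fun i => modulus (x i) `^ s)); apply: hx.
by rewrite map_inj_uniq.
Qed.

Lemma nle_0 : nle p (fun _ : int => 0) 0.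
Proof.
move: p p1; apply: exp_ind => [|s s1]; first by apply/nle_infP => i; rewrite md0.
apply/nle_finP => //; split=> // J _.
have s0 : s != 0 by rewrite gt_eqF//; lra.
by rewrite big1 ?powR0// => i _; rewrite md0 powR0.
Qed.

Lemma powR_convex2 (s a b l : R) : 1 <= s -> 0 <= a -> 0 <= b -> 0 <= l <= 1 ->
  (l * a + (1 - l) * b) `^ s <= l * a `^ s + (1 - l) * b `^ s.
Proof.
move=> s1 a0 b0 /andP[l0 l1].
have := @convex_powR R s s1 (@Itv01 R l l0 l1) a b.
rewrite !convRE; apply; apply/mem_set; rewrite /= in_itv /= ?a0 ?b0//.
Qed.

(** Used to make bounds strictly positive before dividing by them. *)
Lemma nle_eps x c : (forall e, 0 < e -> nle p x (c + e)) -> nle p x c.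
Proof. by move=> h; apply/lee_addgt0Pr => e e0; rewrite -EFinD; exact: h. Qed.

(** Minkowski inequality, from the convexity of the power function applied to
    [x / a] and [y / b] with weights [a / (a + b)] and [b / (a + b)]. *)
Lemma nle_add x y a b : nle p x a -> nle p y b ->
  nle p (fun i => x i + y i) (a + b).
Proof.
move=> hx hy; have a0 := nle_ge0 hx; have b0 := nle_ge0 hy.
apply: nle_eps => e e0.
(* Both bounds are made positive, for they become denominators. *)
have : nle p x (a + e / 2) by apply: nle_trans hx _; lra.
have : nle p y (b + e / 2) by apply: nle_trans hy _; lra.
have : 0 < a + e/2 by lra.
have : 0 < b + e/2 by lra.
have -> : a + b + e = (a + e/2) + (b + e/2) by lra.
move: {hx hy a0 b0} (a + e/2) (b + e/2) => {}a {}b b0 a0; move: p p1; apply: exp_ind.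
  move=> /nle_infP hy /nle_infP hx; apply/nle_infP => i.
  by rewrite (le_trans (mdD _ _))// lerD.
move=> s s1; have s0 : 0 < s by lra.
move=> /(nle_finP _ _ s1)[_ hy] /(nle_finP _ _ s1)[_ hx].
have ab0 : 0 < a + b by lra.
have aN0 : a != 0 by rewrite gt_eqF.
have bN0 : b != 0 by rewrite gt_eqF.
have abN0 : a + b != 0 by rewrite gt_eqF.
apply/nle_finP => //; split=> [|J uJ]; first lra.
pose l := a / (a + b).
have l01 : 0 <= l <= 1.
  by rewrite /l ltW ?divr_gt0//= ler_pdivrMr// mul1r lerDl ltW.
have l1 : 1 - l = b / (a + b) by rewrite /l; field.
apply: (@le_trans _ _ (\sum_(i <- J) (a + b) `^ s *
    (l * (modulus (x i) / a) `^ s + (1 - l) * (modulus (y i) / b) `^ s))).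
  apply: ler_sum => i _.
  have xa : 0 <= modulus (x i) / a by rewrite divr_ge0 ?md_ge0// ltW.
  have yb : 0 <= modulus (y i) / b by rewrite divr_ge0 ?md_ge0// ltW.
  rewrite (le_trans _ (ler_wpM2l (powR_ge0 _ _) (powR_convex2 s1 xa yb l01)))//.
  have lab0 : 0 <= l * (modulus (x i) / a) + (1 - l) * (modulus (y i) / b).
    by case/andP: l01 => l0 l01; rewrite addr_ge0// mulr_ge0// subr_ge0.
  rewrite -powRM//; last exact: ltW.
  apply: powR_le (ltW s0) (md_ge0 _) _.
  have -> : (a + b) * (l * (modulus (x i) / a) + (1 - l) * (modulus (y i) / b))
     = modulus (x i) + modulus (y i) by rewrite l1 /l; field; apply/and3P.
  exact: mdD.
rewrite -mulr_sumr -[leRHS]mulr1 ler_wpM2l ?powR_ge0//.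
rewrite big_split /= -!mulr_sumr.
have E (z : int -> C) c : 0 < c ->
   (forall J, uniq J -> \sum_(i <- J) (modulus (z i)) `^ s <= c `^ s) ->
   \sum_(i <- J) (modulus (z i) / c) `^ s <= 1.
  by move=> c0 hz; apply: sum_powR_div => //; exact: hz.
case/andP: l01 => l0 l01.
rewrite -[leRHS](subrKC l) lerD//.
  by rewrite -[leRHS]mulr1 ler_wpM2l// E.
by rewrite -[leRHS]mulr1 ler_wpM2l ?E// subr_ge0.
Qed.

Lemma nle_sub x y a b : nle p x a -> nle p y b ->
  nle p (fun i => x i - y i) (a + b).
Proof.
move=> hx hy; apply: (nle_add hx); apply: nle_solid hy => i.
by rewrite mdN.
Qed.

Lemma nle_sum (J : Type) (s : seq J) (x : J -> int -> C) (a : J -> R) :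
  (forall j, nle p (x j) (a j)) ->
  nle p (fun i => \sum_(j <- s) x j i) (\sum_(j <- s) a j).
Proof.
move=> h; elim: s => [|j s ih].
  by rewrite big_nil; apply: nle_solid nle_0 => i; rewrite big_nil.
rewrite big_cons; apply: nle_solid (nle_add (h j) ih) => i.
by rewrite big_cons.
Qed.

Definition delta (j : int) : int -> C := fun i => if i == j then 1 else 0.

Lemma deltaC i j : delta i j = delta j i.
Proof. by rewrite /delta eq_sym. Qed.

Lemma nle_delta j : nle p (delta j) 1.
Proof.
rewrite /delta; move: p p1; apply: exp_ind => [|s s1].
  by apply/nle_infP => i; case: eqP => _; rewrite ?md0 ?md1.
have s0 : 0 < s by lra.
apply/nle_finP => //; split=> // J uJ; rewrite powR1.
rewrite (eq_bigr (fun i => (i == j)%:R)); last first.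
  by move=> i _; case: eqP => _; rewrite ?md0 ?md1 ?powR0 ?powR1 ?gt_eqF.
rewrite -natr_sum -big_mkcond /= sum1_count.
by rewrite count_uniq_mem//; case: (_ \in _).
Qed.

Definition restr (J : seq int) x : int -> C := fun i => if i \in J then x i else 0.

Lemma sum_delta (J : seq int) (v : int -> C) i : uniq J ->
  \sum_(j <- J) v j * delta j i = restr J v i.
Proof.
move=> uJ; rewrite /restr /delta; case: ifP => iJ.
  rewrite (bigD1_seq i)//= eqxx mulr1 big1 ?addr0// => j /negPf ji.
  by rewrite eq_sym ji mulr0.
rewrite big_seq big1// => j jJ; case: eqP => [ij|_]; last by rewrite mulr0.
by rewrite ij jJ in iJ.
Qed.

Lemma nle_restr J x c : nle p x c -> nle p (restr J x) c.
Proof.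
by apply: nle_solid => i; rewrite /restr; case: ifP => // _; rewrite md0 md_ge0.
Qed.

Lemma nle_window x c : (forall J, nle p (restr J x) c) -> nle p x c.
Proof.
move: p p1; apply: exp_ind => [h|s s1 h].
  apply/nle_infP => i; have /nle_infP/(_ i) := h [:: i].
  by rewrite /restr inE eqxx.
apply/nle_finP => //; split=> [|J uJ].
  by have /(nle_finP _ _ s1)[] := h [::].
have /(nle_finP _ _ s1)[_ /(_ J uJ)] := h J.
by congr (_ <= _); apply: eq_big_seq => i iJ; rewrite /restr iJ.
Qed.

Lemma nle_fin (J : seq int) x : uniq J -> (forall i, i \notin J -> x i = 0) ->
  nle p x (\sum_(j <- J) modulus (x j)).
Proof.
move=> uJ h.
have : nle p (fun i => \sum_(j <- J) (x j * delta j i))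
    (\sum_(j <- J) modulus (x j)).
  apply: nle_sum => j; rewrite -[modulus _]mulr1; apply: nle_scale (nle_delta j).
    exact: md_ge0.
  by move=> i; rewrite mdM.
apply: nle_solid => i; rewrite sum_delta// /restr.
by case: ifP => // /negbT/h ->.
Qed.

(** A Fatou property: the norm is lower semicontinuous for the convergence of
    each coordinate. *)
Lemma nle_fatou x c :
  (forall (J : seq int) (e : R), 0 < e -> exists2 y, nle p y c &
    forall i, i \in J -> modulus (x i - y i) <= e) -> nle p x c.
Proof.
move=> h; apply: nle_window => J; apply: nle_eps => e e0.
pose n := (size (undup J))%:R : R.
have n0 : 0 <= n by rewrite ler0n.
have en0 : 0 < e / (n + 1) by rewrite divr_gt0//; lra.
have [y hy hJ] := h J _ en0.
have : nle p (restr J (fun i => x i - y i))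
    (\sum_(j <- undup J) modulus (restr J (fun i => x i - y i) j)).
  apply: nle_fin; first exact: undup_uniq.
  by move=> i; rewrite mem_undup /restr => /negPf ->.
move=> /(nle_add (nle_restr J hy)) h'; apply: (@nle_trans _ (c + \sum_(j <- undup J)
  modulus (restr J (fun i => x i - y i) j))).
  apply: nle_solid h' => i; rewrite /restr; case: ifP => _; last by rewrite addr0.
  by rewrite addrC subrK.
rewrite lerD2l; apply: (@le_trans _ _ (\sum_(j <- undup J) (e / (n + 1)))).
  rewrite big_seq [leRHS]big_seq; apply: ler_sum => i; rewrite mem_undup => iJ.
  by rewrite /restr iJ hJ.
rewrite big_const_seq count_predT iter_addr_0 -mulr_natl -/n.
rewrite mulrCA ler_piMr//; first exact: ltW.
by rewrite ler_pdivrMr; lra.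
Qed.

(** The inequality between the norms of [eta x] and [y], stated so that neither
    norm has to be finite. *)
Definition dom (eta : R) x y := forall c, nle p x c -> nle p y (eta * c).

Lemma sum_sub_supp (f : int -> R) (J J' : seq int) : (forall i, 0 <= f i) ->
  (forall i, i \notin J -> f i = 0) -> uniq J -> uniq J' ->
  \sum_(i <- J') f i <= \sum_(i <- J) f i.
Proof.
move=> f0 fJ uJ uJ'.
have -> : \sum_(i <- J') f i = \sum_(i <- J' | i \in J) f i.
  rewrite [RHS]big_mkcond /=; apply: eq_bigr => i _.
  by case: ifP => // /negbT/fJ.
rewrite -big_filter.
have pe : perm_eq [seq i <- J' | i \in J] [seq i <- J | i \in J'].
  apply: uniq_perm; rewrite ?filter_uniq// => i.
  by rewrite !mem_filter andbC.
rewrite (perm_big _ pe) /=.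
rewrite big_filter big_mkcond /=; apply: ler_sum => i _.
by case: ifP.
Qed.

(** Norms of sums of disjointly supported vectors depend only on the norms of
    the summands, monotonically. *)
Lemma dom_disj eta x1 x2 y1 y2 : 0 <= eta ->
  (forall i, x1 i = 0 \/ x2 i = 0) -> (forall i, y1 i = 0 \/ y2 i = 0) ->
  (exists J : seq int, forall i, i \notin J -> x1 i = 0 /\ x2 i = 0) ->
  dom eta x1 y1 -> dom eta x2 y2 ->
  dom eta (fun i => x1 i + x2 i) (fun i => y1 i + y2 i).
Proof.
move=> eta0 xd yd [J0 hJ0]; set J := undup J0.
have uJ : uniq J by exact: undup_uniq.
have hJ i : i \notin J -> x1 i = 0 /\ x2 i = 0 by rewrite mem_undup; exact: hJ0.
rewrite /dom; move: p p1; apply: exp_ind => [h1 h2 c|s s1 h1 h2 c].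
  move=> /nle_infP h.
  have /h1/nle_infP k1 : nle +oo%E x1 c.
    apply/nle_infP => i; case: (xd i) (h i) => ->; rewrite ?addr0// add0r.
    by rewrite md0; apply: le_trans; exact: md_ge0.
  have /h2/nle_infP k2 : nle +oo%E x2 c.
    apply/nle_infP => i; case: (xd i) (h i) => ->; rewrite ?addr0// ?add0r// md0.
    by apply: le_trans; exact: md_ge0.
  apply/nle_infP => i.
  by case: (yd i) => ->; rewrite ?addr0 ?add0r.
have s0 : 0 < s by lra.
have sN0 : s != 0 by rewrite gt_eqF.
move=> /(nle_finP _ _ s1)[c0 h].
pose S (x : int -> C) := \sum_(i <- J) modulus (x i) `^ s.
have S0 x : 0 <= S x by apply: sumr_ge0 => i _; exact: powR_ge0.
have E (x : int -> C) : (forall i, i \notin J -> x i = 0) ->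
    nle s%:E x (S x `^ s^-1).
  move=> xJ; apply/nle_finP => //; split=> [|J' uJ']; first exact: powR_ge0.
  rewrite powRVK//; apply: sum_sub_supp => // i; first exact: powR_ge0.
  by move=> /xJ ->; rewrite md0 powR0.
have /h1/(nle_finP _ _ s1)[_ k1] := E x1 (fun i iJ => (hJ i iJ).1).
have /h2/(nle_finP _ _ s1)[_ k2] := E x2 (fun i iJ => (hJ i iJ).2).
apply/nle_finP => //; split=> [|J' uJ']; first exact: mulr_ge0.
have D (z1 z2 : int -> C) i : z1 i = 0 \/ z2 i = 0 ->
    modulus (z1 i + z2 i) `^ s = modulus (z1 i) `^ s + modulus (z2 i) `^ s.
  by case=> ->; rewrite ?addr0 ?add0r md0 powR0// ?addr0 ?add0r.
under eq_bigr => i _ do rewrite D//.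
rewrite big_split /= (le_trans (lerD (k1 _ uJ') (k2 _ uJ')))//.
apply: powR_combine => //.
apply: le_trans (h J uJ); rewrite /S -big_split /=.
by apply: ler_sum => i _; rewrite D.
Qed.

End Norm.

(** * Duality between conjugate exponents *)
Section Hoelder.
Context {R : realType}.
Local Notation C := (Cplx R).
Variables (p q : \bar R) (p1 : (1 <= p)%E) (q1 : (1 <= q)%E).
Hypothesis pq : (p^-1 + q^-1 = 1)%E.

(** The conjugate pairs are (1, oo), (oo, 1) and the pairs of finite exponents
    greater than 1. *)
Lemma conj_ind (P : \bar R -> \bar R -> Prop) :
  P 1%E +oo%E -> P +oo%E 1%E ->
  (forall s t : R, 1 < s -> 1 < t -> s^-1 + t^-1 = 1 -> P s%:E t%:E) -> P p q.
Proof.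
move=> P1 P2 P3; move: p p1 q q1 pq.
have inv1 (s : R) : s^-1 = 1 -> s = 1 by move=> h; rewrite -[s]invrK h invr1.
case=> [s||//]; rewrite ?lee_fin => s1; case=> [t||//]; rewrite ?lee_fin => t1.
- have s0 : 0 < s by lra.
  have t0 : 0 < t by lra.
  rewrite !inver !gt_eqF// -EFinD => -[e].
  have si : 0 < s^-1 by rewrite invr_gt0.
  have ti : 0 < t^-1 by rewrite invr_gt0.
  apply: P3 => //.
    by rewrite -[s]invrK invf_gt1//; lra.
  by rewrite -[t]invrK invf_gt1//; lra.
- rewrite invey adde0 inver gt_eqF; last lra.
  by case=> /inv1 ->.
- rewrite invey add0e inver gt_eqF; last lra.
  by case=> /inv1 ->.
- by rewrite invey adde0 => -[/esym/eqP]; rewrite oner_eq0.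
Qed.

Implicit Types x y : int -> C.

(** Hoelder inequality on a finite set, from the Young inequality
    [conjugate_powR] after normalizing both vectors. *)
Lemma hoelder_sum x y a b (J : seq int) : uniq J -> nle p x a -> nle q y b ->
  \sum_(i <- J) modulus (x i) * modulus (y i) <= a * b.
Proof.
move=> uJ hx hy; have a0 := nle_ge0 p1 hx; have b0 := nle_ge0 q1 hy.
have [aE|aN] := eqVneq a 0.
  rewrite big1 ?aE ?mul0r// => i _.
  have := nle_pt p1 i hx; rewrite aE => h.
  have /eqP -> : modulus (x i) == 0 by rewrite eq_le h md_ge0.
  by rewrite mul0r.
have [bE|bN] := eqVneq b 0.
  rewrite big1 ?bE ?mulr0// => i _.
  have := nle_pt q1 i hy; rewrite bE => h.
  have /eqP -> : modulus (y i) == 0 by rewrite eq_le h md_ge0.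
  by rewrite mulr0.
have {aN}a0 : 0 < a by rewrite lt_def aN.
have {bN}b0 : 0 < b by rewrite lt_def bN.
have L1 (z w : int -> C) c d : 0 <= d -> nle 1%E z c -> (forall i, modulus (w i) <= d) ->
    \sum_(i <- J) modulus (z i) * modulus (w i) <= c * d.
  move=> d0 /(nle_finP _ _ (lexx 1))[c0 /(_ J uJ)].
  rewrite powRr1// => hz hw.
  apply: le_trans (ler_wpM2r d0 hz).
  rewrite mulr_suml; apply: ler_sum => i _.
  by rewrite powRr1 ?md_ge0// ler_wpM2l// md_ge0.
move: hx hy; pattern p, q; apply: conj_ind.
- by move=> hx /nle_infP hy; apply: L1 => //; exact: ltW.
- move=> /nle_infP hx hy; under eq_bigr => i _ do rewrite mulrC.
  by rewrite (mulrC a); apply: L1 => //; exact: ltW.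
move=> s t s1 t1 st /(nle_finP _ _ (ltW s1))[_ /(_ J uJ) hx].
move=> /(nle_finP _ _ (ltW t1))[_ /(_ J uJ) hy].
have s0 : 0 < s by lra.
have t0 : 0 < t by lra.
have E (z : int -> C) c (u : R) : 0 < c -> 0 < u ->
   \sum_(i <- J) (modulus (z i)) `^ u <= c `^ u ->
   \sum_(i <- J) (modulus (z i) / c) `^ u / u <= u^-1.
  move=> c0 u0 hz; rewrite -mulr_suml -[leRHS]mul1r.
  by apply: ler_wpM2r; [rewrite invr_ge0 ltW | exact: sum_powR_div].
have hx' := E _ _ _ a0 s0 hx; have hy' := E _ _ _ b0 t0 hy.
have ab : \sum_(i <- J) (modulus (x i) / a) * (modulus (y i) / b) <= 1.
  rewrite -st (le_trans _ (lerD hx' hy'))// -big_split /=; apply: ler_sum => i _.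
  by apply: conjugate_powR; rewrite ?divr_ge0 ?md_ge0// ltW.
rewrite -[leRHS]mulr1 -ler_pdivrMl ?mulr_gt0//; apply: le_trans ab.
rewrite mulr_sumr; apply: ler_sum => i _.
by rewrite le_eqVlt; apply/orP; left; apply/eqP; field; rewrite !gt_eqF.
Qed.

(** Converse of the Hoelder inequality: a finitely supported vector is tested
    against the vector that attains its norm. *)
Lemma norming x M (J : seq int) : uniq J -> (forall i, i \notin J -> x i = 0) ->
  (forall y, (forall i, i \notin J -> y i = 0) -> forall c, nle p y c ->
     modulus (\sum_(i <- J) x i * y i) <= M * c) ->
  nle q x M.
Proof.
move=> uJ xJ.
(* The norming vector: it has the phase of [1 / x i] and modulus [|x i|^(t-1)]. *)
pose w (t : R) i : C := if x i == 0 then 0 else ((modulus (x i) `^ t)%:C%C / x i)%R.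
have wJ t i : i \notin J -> w t i = 0 by move=> /xJ; rewrite /w => ->; rewrite eqxx.
have wE t i : t != 0 -> x i * w t i = (modulus (x i) `^ t)%:C%C.
  move=> t0; rewrite /w; case: eqP => [->|/eqP x0]; last first.
    by rewrite mulrC divfK.
  by rewrite mulr0 md0 powR0.
have wM t i : 0 < t -> t != 1 -> modulus (w t i) = modulus (x i) `^ (t - 1).
  move=> t0 t1; rewrite /w; case: eqP => [->|/eqP x0].
    by rewrite md0 powR0// subr_eq0.
  rewrite mdM mdV mdR ger0_norm ?powR_ge0//.
  have m0 : 0 < modulus (x i) by rewrite md_gt0.
  by rewrite powRB ?powRr1 ?md_ge0//; apply/implyP => _; rewrite gt_eqF.
have w1 i : modulus (w 1 i) <= 1.
  rewrite /w; case: eqP => [_|/eqP x0]; first by rewrite md0.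
  by rewrite mdM mdV powRr1 ?md_ge0// mdR ger0_norm ?md_ge0// mulfV// md_eq0.
have S t : t != 0 -> modulus (\sum_(i <- J) x i * w t i) =
    \sum_(i <- J) modulus (x i) `^ t.
  move=> t0; under eq_bigr => i _ do rewrite wE//.
  rewrite -(big_morph (fun a : R => a%:C%C : C) (id2 := 0) (op2 := +%R) (id1 := 0) (op1 := +%R)) //; last first.
    by move=> a b; rewrite rmorphD.
  by rewrite mdR ger0_norm// sumr_ge0// => i _; exact: powR_ge0.
move: p1; pattern p, q; apply: conj_ind.
- move=> _ h; apply/nle_infP => i.
  have [iJ|/xJ ->] := boolP (i \in J); last first.
    have := h (fun=> 0) (fun _ _ => erefl) 1.
    rewrite mulr1 md0 big1 ?md0; last by move=> j _; rewrite mulr0.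
    by apply; apply: nle_trans (nle_0 (lexx _)) ler01.
  have := h (delta i) _ 1 (nle_delta (lexx _) i).
  under eq_bigr do rewrite deltaC.
  rewrite mulr1 sum_delta// /restr iJ; apply.
  by move=> j jJ; rewrite /delta; case: eqP => // ji; rewrite ji iJ in jJ.
- move=> _ h; apply/nle_finP => //.
  have := h (w 1) (wJ _) 1; rewrite S ?oner_neq0// mulr1.
  have /[swap]/[apply] hw : nle +oo%E (w 1) 1 by apply/nle_infP.
  have M0 : 0 <= M by rewrite (le_trans _ hw)// sumr_ge0// => i _; exact: powR_ge0.
  split=> // J' uJ'; rewrite [leRHS]powRr1//; apply: le_trans hw.
  apply: sum_sub_supp => // i; first exact: powR_ge0.
  by move=> /xJ ->; rewrite md0 powR0 ?oner_neq0.
move=> s t s1 t1 st _ h; apply/nle_finP; first exact: ltW.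
have s0 : 0 < s by lra.
have t0 : 0 < t by lra.
have sN0 : s != 0 by rewrite gt_eqF.
have tN0 : t != 0 by rewrite gt_eqF.
pose Q := \sum_(i <- J) modulus (x i) `^ t.
have Q0 : 0 <= Q by rewrite sumr_ge0// => i _; exact: powR_ge0.
have tsE : (t - 1) * s = t.
  have e : t + s = s * t by rewrite -[RHS]mul1r -st; field; apply/andP.
  by rewrite mulrBl mul1r (mulrC t) -e addrK.
have nw : nle s%:E (w t) (Q `^ s^-1).
  apply/nle_finP; first exact: ltW.
  split=> [|J' uJ']; first exact: powR_ge0.
  rewrite powRVK//; last exact: ltW.
  under eq_bigr => i _ do rewrite wM ?gt_eqF// -powRrM tsE.
  apply: sum_sub_supp => // i; first exact: powR_ge0.
  by move=> /xJ ->; rewrite md0 powR0.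
have := h (w t) (wJ _) _ nw; rewrite S// -/Q => hQ.
have M0 : 0 <= M.
  have := h (fun=> 0) (fun _ _ => erefl) 1.
  rewrite mulr1 big1 ?md0; last by move=> j _; rewrite mulr0.
  by apply; apply: nle_trans (nle_0 _) ler01; exact: ltW.
suff QM : Q <= M `^ t.
  split=> // J' uJ'; apply: le_trans QM; apply: sum_sub_supp => // i.
    exact: powR_ge0.
  by move=> /xJ ->; rewrite md0 powR0.
have [->|QN0] := eqVneq Q 0; first exact: powR_ge0.
have Qp : 0 < Q by rewrite lt_def QN0.
have Qs : 0 < Q `^ s^-1 by exact: powR_gt0.
have tE : Q / Q `^ s^-1 = Q `^ t^-1.
  rewrite -{1}[Q]powRr1// -powRB; last by apply/implyP.
  by congr (_ `^ _); rewrite -st addrC addKr.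
have QtM : Q `^ t^-1 <= M by rewrite -tE ler_pdivrMr.
rewrite -(powRVK (ltW t1) Q0); apply: powR_le => //; first exact: ltW.
exact: powR_ge0.
Qed.

End Hoelder.

(** * Limits along an ultrafilter *)
Section UltraLimit.
Context {R : realType}.
Local Notation C := (Cplx R).

(** With an ultrafilter every bounded sequence converges, so no subsequences
    have to be extracted. *)
Definition ultra_oo : set_system nat :=
  projT1 (cid (@ultraFilterLemma nat \oo _)).

Lemma ultra_ooP : UltraFilter ultra_oo.
Proof. by rewrite /ultra_oo; case: cid => G []. Qed.

Local Instance ultra_oo_pf : ProperFilter ultra_oo.
Proof. exact: (@ultra_proper _ _ ultra_ooP). Qed.

Lemma ultra_ge (N : nat) : ultra_oo [set n | (N <= n)%N].
Proof.
rewrite /ultra_oo; case: cid => G [/= _ hG]; apply: hG.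
by exists N.
Qed.

Definition ucv (u : nat -> C) (z : C) :=
  forall e : R, 0 < e -> ultra_oo [set n | modulus (u n - z) <= e].

(** The limit is the supremum of the eventual lower bounds. *)
Lemma ultraR (u : nat -> R) c : (forall n, `|u n| <= c) ->
  exists l, forall e, 0 < e -> ultra_oo [set n | `|u n - l| <= e].
Proof.
move=> uc; pose S := [set a : R | ultra_oo [set n | a <= u n]].
have Sc : S (- c).
  by apply: filterS filterT => n _; have := uc n; rewrite ler_norml => /andP[].
have ubS : ubound S c.
  move=> a Sa; have [n /= an] := @filter_ex _ _ ultra_oo_pf _ Sa.
  by rewrite (le_trans an)// (le_trans (ler_norm _)).
have hS : has_sup S by split; [exists (- c) | exists c].
exists (sup S) => e e0.
have [a Sa ae] := sup_adherent e0 hS.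
have nS : ~ S (sup S + e).
  move=> h; have := sup_upper_bound hS h; lra.
have := @in_ultra_setVsetC _ _ [set n | sup S + e <= u n] ultra_ooP.
case=> // h; apply: filterS2 h Sa => n /= /negP; rewrite -ltNge => h1 h2.
rewrite ler_norml; lra.
Qed.

Lemma Re_le_md (z : C) : `|complex.Re z| <= modulus z.
Proof.
by case: z => a b /=; rewrite -sqrtr_sqr ler_wsqrtr// lerDl sqr_ge0.
Qed.

Lemma Im_le_md (z : C) : `|complex.Im z| <= modulus z.
Proof.
by case: z => a b /=; rewrite -sqrtr_sqr ler_wsqrtr// lerDr sqr_ge0.
Qed.

Lemma md_le_ReIm (z : C) : modulus z <= `|complex.Re z| + `|complex.Im z|.
Proof.
case: z => a b /=; rewrite -[leRHS]ger0_norm ?addr_ge0// -sqrtr_sqr ler_wsqrtr//.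
rewrite sqrrD !real_normK ?num_real//.
have := normr_ge0 a; have := normr_ge0 b; nra.
Qed.

Lemma ucv_ex (u : nat -> C) c : (forall n, modulus (u n) <= c) -> exists z, ucv u z.
Proof.
move=> uc.
have [n|a ha] := @ultraR (fun n => complex.Re (u n)) c.
  by rewrite (le_trans (Re_le_md _)).
have [n|b hb] := @ultraR (fun n => complex.Im (u n)) c.
  by rewrite (le_trans (Im_le_md _)).
exists (a +i* b)%C => e e0.
have e2 : 0 < e / 2 by lra.
apply: filterS2 (ha _ e2) (hb _ e2) => n h1 h2.
apply: (le_trans (md_le_ReIm _)); move: h1 h2 => /=.
by case: (u n) => x y /= h1 h2; rewrite (splitr e) lerD.
Qed.

Lemma ucv_unique u z w : ucv u z -> ucv u w -> z = w.
Proof.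
move=> hz hw; apply/eqP; rewrite -subr_eq0 -md_eq0 eq_le md_ge0 andbT.
apply/ler_addgt0Pr => e e0; rewrite add0r.
have e2 : 0 < e / 2 by lra.
have [n /= [h1 h2]] := @filter_ex _ _ ultra_oo_pf _ (filterI (hz _ e2) (hw _ e2)).
have -> : z - w = (u n - w) - (u n - z) by ring.
by rewrite (le_trans (mdB _ _))// (splitr e) lerD.
Qed.

Lemma ucv_near u z : (forall e : R, 0 < e ->
   exists N, forall n, (N <= n)%N -> modulus (u n - z) <= e) -> ucv u z.
Proof.
move=> h e e0; have [N hN] := h e e0.
by apply: filterS (ultra_ge N) => n /= /hN.
Qed.

Lemma ucv_cst z : ucv (fun=> z) z.
Proof.
by apply: ucv_near => e e0; exists 0 => n _; rewrite subrr md0 ltW.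
Qed.

Lemma ucv_ext u v z : (exists N, forall n, (N <= n)%N -> u n = v n) -> ucv u z -> ucv v z.
Proof.
move=> [N hN] h e e0; apply: filterS2 (ultra_ge N) (h e e0) => n /= Nn.
by rewrite hN.
Qed.

Lemma ucvD u v z w : ucv u z -> ucv v w -> ucv (fun n => u n + v n) (z + w).
Proof.
move=> hu hv e e0; have e2 : 0 < e / 2 by lra.
apply: filterS2 (hu _ e2) (hv _ e2) => n /= h1 h2.
have -> : u n + v n - (z + w) = (u n - z) + (v n - w) by ring.
by rewrite (le_trans (mdD _ _))// (splitr e) lerD.
Qed.

Lemma ucvM u v z w : ucv u z -> ucv v w -> ucv (fun n => u n * v n) (z * w).
Proof.
move=> hu hv e e0.
pose d := Num.min 1 (e / (1 + modulus z + modulus w)).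
have m0 : 0 < 1 + modulus z + modulus w.
  by have := md_ge0 z; have := md_ge0 w; lra.
have d0 : 0 < d by rewrite lt_min ltr01 divr_gt0.
have d1 : d <= 1 by rewrite ge_min lexx.
have de : d * (1 + modulus z + modulus w) <= e.
  by rewrite -ler_pdivlMr// ge_min lexx orbT.
apply: filterS2 (hu _ d0) (hv _ d0) => n /= h1 h2.
have -> : u n * v n - z * w = (u n - z) * (v n - w) + (u n - z) * w + z * (v n - w).
  by ring.
apply: le_trans de.
rewrite (le_trans (mdD _ _))// (le_trans (lerD (mdD _ _) (lexx _)))// !mdM.
have := md_ge0 z; have := md_ge0 w; have := md_ge0 (u n - z); have := md_ge0 (v n - w).
by nra.
Qed.

Lemma ucv_vec (u : nat -> int -> C) (b : int -> R) :
  (forall n i, modulus (u n i) <= b i) ->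
  exists x : int -> C, forall i, ucv (u ^~ i) (x i).
Proof.
move=> ub; have /choice[x hx] : forall i, exists z, ucv (u ^~ i) z.
  by move=> i; apply: (@ucv_ex _ (b i)) => n; exact: ub.
by exists x.
Qed.

Lemma nle_ucv p (u : nat -> int -> C) x c : (1 <= p)%E ->
  (forall n, nle p (u n) c) -> (forall i, ucv (u ^~ i) (x i)) -> nle p x c.
Proof.
move=> p1 hu ux; apply: nle_fatou => // J e e0.
suff : ultra_oo [set n | forall i, i \in J -> modulus (u n i - x i) <= e].
  move=> /(@filter_ex _ _ ultra_oo_pf)[n /= hn]; exists (u n) => // i iJ.
  by rewrite mdC hn.
elim: J => [|j J ih]; first by apply: filterS filterT => n _ i.
apply: filterS2 ih (ux j _ e0) => n /= h1 h2 i.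
by rewrite inE => /orP[/eqP ->//|]; exact: h1.
Qed.

End UltraLimit.

Lemma div_swap {R : realType} (a e n : R) : 0 < e -> 0 < n -> a / e <= n -> a / n <= e.
Proof. by move=> e0 n0; rewrite !ler_pdivrMr// mulrC. Qed.

(** * Compressions of tridiagonal operators *)
Section Tri.
Context {R : realType}.
Local Notation C := (Cplx R).
Implicit Types (x y : int -> C) (D : int -> bool).

(** The entries of row [i] to the left of, on and to the right of the diagonal. *)
Record coef := Coef { lo : int -> C; di : int -> C; up : int -> C }.
Implicit Type t : coef.

Definition tri t x : int -> C :=
  fun i => lo t i * x (i - 1) + di t i * x i + up t i * x (i + 1).
Definition dcut D x : int -> C := fun i => if D i then x i else 0.

(** The compression of the bi-infinite operator [t] to the indices in [D]; it is
    the genuine restriction only on vectors supported in [D]. *)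
Definition compr D t x := dcut D (tri t x).
Definition supp D x := forall i, ~~ D i -> x i = 0.
Definition bnd (c : R) t := forall i,
  [/\ modulus (lo t i) <= c, modulus (di t i) <= c & modulus (up t i) <= c].

Lemma supp_cut D x : supp D (dcut D x).
Proof. by move=> i /negPf Di; rewrite /dcut Di. Qed.

Lemma triD t x y i : tri t (fun i => x i + y i) i = tri t x i + tri t y i.
Proof. by rewrite /tri; ring. Qed.

Lemma triZ t a x i : tri t (fun i => a * x i) i = a * tri t x i.
Proof. by rewrite /tri; ring. Qed.

Lemma comprD D t x y i :
  compr D t (fun i => x i + y i) i = compr D t x i + compr D t y i.
Proof. by rewrite /compr /dcut triD; case: ifP => //; rewrite addr0. Qed.

Lemma comprZ D t a x i : compr D t (fun i => a * x i) i = a * compr D t x i.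
Proof. by rewrite /compr /dcut triZ; case: ifP => //; rewrite mulr0. Qed.

Lemma compr0 D t i : compr D t (fun=> 0) i = 0.
Proof. by rewrite /compr /dcut /tri !mulr0 !addr0 if_same. Qed.

Definition finsupp x := exists L : nat, forall i : int, (L < `|i|)%N -> x i = 0.

Definition window (L : nat) : seq int := [seq k%:Z - L%:Z | k <- iota 0 (L + L).+1].

Lemma mem_window L i : (i \in window L) = (`|i| <= L)%N.
Proof.
apply/mapP/idP => [[k]|h]; first by rewrite mem_iota => h ->; ilia.
by exists (absz (i + L%:Z)); [rewrite mem_iota|]; ilia.
Qed.

Lemma window_uniq L : uniq (window L).
Proof. by rewrite map_inj_uniq ?iota_uniq// => a b; ilia. Qed.

(** A tent of height 1 and width [2 L]: its slope is so small that
    multiplication by it nearly commutes with a tridiagonal operator. *)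
Definition cutoff (L : nat) (i : int) : R := (L.+1 - `|i|)%N%:R / L.+1%:R.

Lemma cutoff_ge0 L i : 0 <= cutoff L i.
Proof. by rewrite divr_ge0. Qed.
Lemma cutoff_le1 L i : cutoff L i <= 1.
Proof. by rewrite ler_pdivrMr// mul1r ler_nat leq_subr. Qed.

Lemma cutoff_step L i j : (`|i - j| <= 1)%N -> `|cutoff L i - cutoff L j| <= L.+1%:R^-1.
Proof.
move=> ij; rewrite /cutoff -mulrBl normrM [X in _ * X]ger0_norm//.
rewrite ler_piMl//.
have h1 : (L.+1 - `|i| <= (L.+1 - `|j|).+1)%N by ilia.
have h2 : (L.+1 - `|j| <= (L.+1 - `|i|).+1)%N by ilia.
move: (L.+1 - `|i|)%N (L.+1 - `|j|)%N h1 h2 => m n.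
by rewrite -!(ler_nat R) -!natr1 ler_norml => h1 h2; apply/andP; split; lra.
Qed.

Definition close (d : R) t t' i :=
  [/\ modulus (lo t i - lo t' i) <= d, modulus (di t i - di t' i) <= d
    & modulus (up t i - up t' i) <= d].

Lemma compr_close D D' t t' x i d b : D i = D' i -> close d t t' i ->
  (forall j, modulus (x j) <= b) ->
  modulus (compr D t x i - compr D' t' x i) <= d * (3 * b).
Proof.
move=> DD [h1 h2 h3] hx.
have d0 : 0 <= d by rewrite (le_trans (md_ge0 _) h1).
have b0 : 0 <= b by rewrite (le_trans (md_ge0 _) (hx 0)).
rewrite /compr /dcut DD; case: ifP => _; last by rewrite subrr md0; nra.
have -> : tri t x i - tri t' x i = (lo t i - lo t' i) * x (i - 1) +
   (di t i - di t' i) * x i + (up t i - up t' i) * x (i + 1) by rewrite /tri; ring.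
rewrite (le_trans (mdD _ _))// (le_trans (lerD (mdD _ _) (lexx _)))// !mdM.
have -> : d * (3 * b) = d * b + d * b + d * b by ring.
by rewrite !lerD// ler_pM ?md_ge0.
Qed.

Lemma supp_ucv D (u : nat -> int -> C) (E : nat -> int -> bool) x :
  (forall n, supp (E n) (u n)) ->
  (forall i, exists N, forall n, (N <= n)%N -> E n i = D i) ->
  (forall i, ucv (u ^~ i) (x i)) -> supp D x.
Proof.
move=> uE ED ux i Di; apply: (ucv_unique (ux i)).
apply: ucv_ext (ucv_cst 0); have [N hN] := ED i; exists N => n /hN h.
by rewrite uE// h.
Qed.

Variable p : \bar R.
Hypothesis p1 : (1 <= p)%E.

Definition lpx x := exists b, nle p x b.

Lemma nle_cut D x c : nle p x c -> nle p (dcut D x) c.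
Proof.
by apply: nle_solid => // i; rewrite /dcut; case: ifP => // _; rewrite md0 md_ge0.
Qed.

Lemma nle_tri c t x b : bnd c t -> nle p x b -> nle p (tri t x) (3 * c * b).
Proof.
move=> tc hx.
have c0 : 0 <= c by case: (tc 0) => h _ _; rewrite (le_trans (md_ge0 _) h).
have h1 : nle p (fun i => lo t i * x (i - 1)) (c * b).
  have := @nle_reidx _ _ p1 x b (fun i => i - 1) (addIr _) hx.
  apply: nle_scale => // i; rewrite mdM ler_wpM2r ?md_ge0//.
  by case: (tc i).
have h2 : nle p (fun i => di t i * x i) (c * b).
  move: hx; apply: nle_scale => // i; rewrite mdM ler_wpM2r ?md_ge0//.
  by case: (tc i).
have h3 : nle p (fun i => up t i * x (i + 1)) (c * b).
  have := @nle_reidx _ _ p1 x b (fun i => i + 1) (addIr _) hx.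
  apply: nle_scale => // i; rewrite mdM ler_wpM2r ?md_ge0//.
  by case: (tc i).
have := nle_add p1 (nle_add p1 h1 h2) h3.
by have -> : c * b + c * b + c * b = 3 * c * b by ring.
Qed.

Lemma nle_compr c t D x b : bnd c t -> nle p x b -> nle p (compr D t x) (3 * c * b).
Proof. by move=> tc hx; apply: nle_cut; exact: nle_tri. Qed.

(** The operator is bounded below by [1 / K].  Finiteness of the norm of [x] is a
    hypothesis: a bounded image does not imply it. *)
Definition LB D t (K : R) := forall x, supp D x -> lpx x ->
  forall c, nle p (compr D t x) c -> nle p x (K * c).

Definition Sur D t := forall y, supp D y -> lpx y ->
  exists x, [/\ supp D x, lpx x & forall i, compr D t x i = y i].

(** Invertibility with inverse of norm at most [K]. *)
Definition linv D t K := LB D t K /\ Sur D t.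

Lemma finsupp_lpx x : finsupp x -> lpx x.
Proof.
move=> [L hL]; eexists; apply: (nle_fin p1 (window_uniq L)) => i.
by rewrite mem_window -ltnNge => /hL.
Qed.

(** A vector is multiplied by the cutoff of width [L], which changes its image
    by a commutator of norm O(1/L), and [L] goes to infinity. *)
Lemma LB_finsupp D t K c0 : 0 <= K -> bnd c0 t ->
  (forall x, supp D x -> finsupp x ->
     forall c, nle p (compr D t x) c -> nle p x (K * c)) -> LB D t K.
Proof.
move=> K0 tc h x xD [b xb] c hc.
have b0 := nle_ge0 p1 xb.
have cc0 : 0 <= c0 by case: (tc 0) => hh _ _; rewrite (le_trans (md_ge0 _) hh).
pose X L i := (cutoff L i)%:C%C * x i.
have XD L : supp D (X L) by move=> i /xD; rewrite /X => ->; rewrite mulr0.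
have Xfs L : finsupp (X L).
  exists L => i iL; rewrite /X /cutoff.
  have -> : (L.+1 - `|i|)%N = 0%N by ilia.
  by rewrite mul0r mul0r.
have XE L : nle p (compr D t (X L)) (c + 2 * c0 / L.+1%:R * b).
  (* The commutator of the operator with the cutoff. *)
  pose E i := lo t i * ((cutoff L (i - 1) - cutoff L i)%:C%C * x (i - 1)) +
              up t i * ((cutoff L (i + 1) - cutoff L i)%:C%C * x (i + 1)).
  have hE : nle p E (c0 / L.+1%:R * b + c0 / L.+1%:R * b).
    apply: nle_add => //.
      have := @nle_reidx _ _ p1 x b (fun i => i - 1) (addIr _) xb.
      apply: nle_scale => // [|i]; first by rewrite divr_ge0.
      rewrite !mdM mdR mulrA ler_wpM2r ?md_ge0// ler_pM ?md_ge0//.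
        by case: (tc i).
      by apply: cutoff_step; ilia.
    have := @nle_reidx _ _ p1 x b (fun i => i + 1) (addIr _) xb.
    apply: nle_scale => // [|i]; first by rewrite divr_ge0.
    rewrite !mdM mdR mulrA ler_wpM2r ?md_ge0// ler_pM ?md_ge0//.
      by case: (tc i).
    by apply: cutoff_step; ilia.
  have h1 : nle p (fun i => (cutoff L i)%:C%C * compr D t x i) c.
    apply: nle_solid hc => // i; rewrite mdM mdR ger0_norm ?cutoff_ge0//.
    by rewrite ler_piMl ?md_ge0 ?cutoff_le1.
  have := nle_add p1 h1 (nle_cut D hE).
  have -> : c0 / L.+1%:R * b + c0 / L.+1%:R * b = 2 * c0 / L.+1%:R * b by ring.
  apply: nle_solid => // i.
  rewrite le_eqVlt; apply/orP; left; apply/eqP; congr modulus.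
  rewrite /compr /dcut; case: ifP => _; last by rewrite mulr0 addr0.
  by rewrite /tri /E /X !rmorphB /=; ring.
have h2 L := h _ (XD L) (Xfs L) _ (XE L).
apply: nle_eps => // e e0; apply: nle_fatou => // J d d0.
pose M := (\sum_(i <- J) `|i|)%N.
have MJ i : i \in J -> (`|i| <= M)%N.
  by move=> iJ; rewrite /M (big_rem i)//= leq_addr.
pose L := Num.trunc ((K * (2 * c0 * b)) / e + M%:R * b / d).
have hL : (K * (2 * c0 * b)) / e + M%:R * b / d < L.+1%:R.
  by rewrite -[_ < _]/(_ < _) ; apply: truncnS_gt.
have A0 : 0 <= K * (2 * c0 * b) / e by rewrite divr_ge0 ?mulr_ge0// ltW.
have B0 : 0 <= M%:R * b / d by rewrite divr_ge0 ?mulr_ge0// ltW.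
exists (X L).
  apply: nle_trans (h2 L) _; rewrite mulrDr lerD2l.
  have -> : K * (2 * c0 / L.+1%:R * b) = (K * (2 * c0 * b)) / L.+1%:R by ring.
  by apply: div_swap => //; lra.
move=> i iJ; rewrite /X -[x i - _]/(x i - _) -{1}[x i]mul1r -mulrBl mdM.
have -> : 1 - (cutoff L i)%:C%C = (1 - cutoff L i)%:C%C :> C by rewrite rmorphB rmorph1.
rewrite mdR.
rewrite ger0_norm ?subr_ge0 ?cutoff_le1//.
have iL : 1 - cutoff L i <= M%:R / L.+1%:R.
  have h0 : (0 : R) < L.+1%:R by [].
  rewrite lerBlDr /cutoff -mulrDl ler_pdivlMr// mul1r -natrD ler_nat.
  by move: (MJ _ iJ); clear; ilia.
apply: (@le_trans _ _ (M%:R / L.+1%:R * b)).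
  by rewrite ler_pM ?md_ge0 ?subr_ge0 ?cutoff_le1//; exact: (nle_pt p1 i xb).
by rewrite mulrAC; apply: div_swap => //; lra.
Qed.

(** A lower bound is tested on finitely supported vectors, which see only
    finitely many coefficients; solutions of the approximating equations are
    uniformly bounded, and any ultrafilter limit of them solves the limit equation. *)
Lemma limit_inv D t K c0 : 0 <= K -> bnd c0 t ->
  (forall m : nat, exists D' t', [/\ bnd c0 t',
     forall i, (`|i| <= m)%N -> D' i = D i,
     forall i, (`|i| <= m)%N -> close m.+1%:R^-1 t' t i
   & linv D' t' K]) -> linv D t K.
Proof.
move=> K0 tc; rewrite /linv => /choice[DD] /choice[tt] h; split.
  apply: (LB_finsupp K0 tc) => x xD [n hn] c hc.
  have [b hb] := finsupp_lpx (ex_intro _ n hn).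
  have b0 := nle_ge0 p1 hb.
  apply: nle_eps => // e e0.
  pose J := window n.+1; pose A := \sum_(j <- J) (3 * b).
  have A0 : 0 <= A by rewrite sumr_ge0// => j _; lra.
  pose m := (n.+2 + Num.trunc (K * A / e))%N.
  have [tb hD ht [lb _]] := h m.
  have m1 : (0 : R) < m.+1%:R by [].
  have xDD : supp (DD m) x.
    move=> i Di; have [ni|ni] := ltnP n `|i|; first exact: hn.
    by apply: xD; rewrite -hD//; apply: leq_trans ni _; rewrite /m; ilia.
  have mb : K * A / m.+1%:R <= e.
    apply: div_swap => //; apply: ltW.
    apply: (@lt_le_trans _ _ (Num.trunc (K * A / e)).+1%:R).
      exact: truncnS_gt.
    by rewrite ler_nat /m; ilia.
  have hd : nle p (fun i => compr (DD m) (tt m) x i - compr D t x i) (A / m.+1%:R).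
    have fz : forall i, i \notin J ->
        compr (DD m) (tt m) x i - compr D t x i = 0.
      move=> i; rewrite mem_window -ltnNge => ni.
      by rewrite /compr /dcut /tri !hn ?mulr0 ?addr0 ?if_same ?subrr//; ilia.
    apply: nle_trans (nle_fin p1 (window_uniq _) fz) _.
    rewrite /A mulr_suml big_seq [leRHS]big_seq; apply: ler_sum => i.
    rewrite mem_window => ni; rewrite mulrC; apply: compr_close.
    - by apply: hD; rewrite /m; ilia.
    - by apply: ht; rewrite /m; ilia.
    - by move=> j; apply: (nle_pt p1 j hb).
  have hx : nle p (compr (DD m) (tt m) x) (c + A / m.+1%:R).
    apply: nle_solid (nle_add p1 hc hd) => // i.
    by rewrite [_ + (_ - _)]addrC subrK.
  have := lb x xDD (ex_intro _ b hb) _ hx.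
  by move/nle_trans; apply; rewrite mulrDr lerD2l mulrA.
move=> y yD [b yb]; have b0 := nle_ge0 p1 yb.
have P m : exists x, [/\ supp (DD m) x, nle p x (K * b) &
    forall i, (`|i| <= m)%N -> compr (DD m) (tt m) x i = y i].
  have [tb hD ht [lb sur]] := h m.
  pose ym := restr (window m) y.
  have ymb : nle p ym b by exact: nle_restr.
  have ymD : supp (DD m) ym.
    move=> i Di; rewrite /ym /restr mem_window; case: ifP => // im.
    by apply: yD; rewrite -hD.
  have [x [xD xl xE]] := sur ym ymD (ex_intro _ b ymb).
  exists x; split=> // [|i im]; last by rewrite xE /ym /restr mem_window im.
  by apply: lb => //; apply: nle_solid ymb => // i; rewrite xE.
have {P}/choice[u hu] := P.
have ub n i : modulus (u n i) <= K * b.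
  by have [_ h2 _] := hu n; exact: (nle_pt p1 i h2).
have [x hx] := ucv_vec ub; exists x; split.
- apply: (@supp_ucv D u DD) => // [n|i]; first by case: (hu n).
  by exists `|i|%N => n ni; case: (h n) => _ hD _ _; apply: hD.
- by exists (K * b); apply: (nle_ucv p1 _ hx) => n; case: (hu n).
move=> i; have tcv (f : coef -> int -> C) j :
     (forall n, (`|j| <= n)%N -> modulus (f (tt n) j - f t j) <= n.+1%:R^-1) ->
     ucv (fun n => f (tt n) j) (f t j).
  move=> hf; apply: ucv_near => e e0; exists (maxn `|j| (Num.trunc e^-1)) => n.
  rewrite geq_max => /andP[jn en]; rewrite (le_trans (hf n jn))//.
  rewrite invf_ple ?posrE//; apply: ltW.
  by apply: (lt_le_trans (truncnS_gt _)); rewrite ler_nat.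
have Dcv : exists N, forall n, (N <= n)%N -> DD n i = D i.
  by exists `|i|%N => n ni; case: (h n) => _ hD _ _; apply: hD.
rewrite /compr /dcut; case: ifPn => Di; last by rewrite yD.
have : ucv (fun n => tri (tt n) (u n) i) (tri t x i).
  apply: ucvD; [apply: ucvD|]; apply: ucvM => //; apply: tcv => n ni.
  - by have [_ _ /(_ i ni)[]] := h n.
  - by have [_ _ /(_ i ni)[]] := h n.
  - by have [_ _ /(_ i ni)[]] := h n.
move/ucv_unique; apply; apply: ucv_ext (ucv_cst (y i)).
exists `|i|%N => n ni; have [_ _ /(_ i ni) <-] := hu n.
by rewrite /compr /dcut; have [_ /(_ i ni) -> _ _] := h n; rewrite Di.
Qed.

Lemma LB_inj D t K x : LB D t K -> supp D x -> lpx x ->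
  (forall i, compr D t x i = 0) -> forall i, x i = 0.
Proof.
move=> lb xD xl h i.
have : nle p (compr D t x) 0.
  by apply: nle_solid (nle_0 p1) => // j; rewrite h.
move/(lb x xD xl); rewrite mulr0 => /(nle_pt p1 i) hi.
by apply/eqP; rewrite -md_eq0 eq_le hi md_ge0.
Qed.

End Tri.

(** * Transposition and summation by parts *)
Section Transpose.
Context {R : realType}.
Local Notation C := (Cplx R).
Implicit Types (x y h : int -> C) (D : int -> bool) (t : @coef R).

Definition tr t := Coef (fun i => up t (i - 1)) (di t) (fun i => lo t (i + 1)).

Lemma trK t : tr (tr t) = t.
Proof.
case: t => l d u; rewrite /tr /=; congr Coef; apply/funext => i.
  by rewrite subrK.
by rewrite addrK.
Qed.

Lemma bnd_tr c t : bnd c t -> bnd c (tr t).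
Proof.
by move=> h i; case: (h i) (h (i + 1)) (h (i - 1)) => ? ? ? [? ? ?] [? ? ?]; split.
Qed.

Lemma sum_eq_supp (f : int -> C) (J J' : seq int) :
  (forall i, i \notin J -> f i = 0) -> (forall i, i \notin J' -> f i = 0) ->
  uniq J -> uniq J' -> \sum_(i <- J') f i = \sum_(i <- J) f i.
Proof.
move=> fJ fJ' uJ uJ'.
have -> : \sum_(i <- J') f i = \sum_(i <- J' | i \in J) f i.
  rewrite [RHS]big_mkcond /=; apply: eq_bigr => i _.
  by case: ifP => // /negbT/fJ.
have -> : \sum_(i <- J) f i = \sum_(i <- J | i \in J') f i.
  rewrite [RHS]big_mkcond /=; apply: eq_bigr => i _.
  by case: ifP => // /negbT/fJ'.
rewrite -big_filter -[RHS]big_filter; apply: perm_big.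
by apply: uniq_perm; rewrite ?filter_uniq// => i; rewrite !mem_filter andbC.
Qed.

Lemma sum_window_shift (f : int -> C) n L k : (forall i, (n < `|i|)%N -> f i = 0) ->
  (n + `|k| <= L)%N -> \sum_(i <- window L) f (i + k) = \sum_(i <- window L) f i.
Proof.
move=> fn nL; rewrite -(big_map (fun i => i + k) predT f).
apply: sum_eq_supp.
- by move=> i; rewrite mem_window => h; apply: fn; ilia.
- move=> i h; apply: fn; rewrite ltnNge; apply: contra h => h.
  by apply/mapP; exists (i - k); [rewrite mem_window; ilia | rewrite subrK].
- exact: window_uniq.
- by rewrite map_inj_uniq ?window_uniq//; exact: addIr.
Qed.

Lemma sum_parts t h x n L : (forall i, (n < `|i|)%N -> h i = 0) -> (n < L)%N ->
  \sum_(i <- window L) h i * tri t x i = \sum_(i <- window L) tri (tr t) h i * x i.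
Proof.
move=> hn nL.
rewrite [LHS](eq_bigr (fun i => h i * lo t i * x (i - 1) + h i * di t i * x i +
   h i * up t i * x (i + 1))); last by move=> i _; rewrite /tri; ring.
rewrite [RHS](eq_bigr (fun i => h (i + 1) * lo t (i + 1) * x i + h i * di t i * x i +
   h (i - 1) * up t (i - 1) * x i)); last by move=> i _; rewrite /tri /tr /=; ring.
rewrite !big_split /=; congr (_ + _ + _).
  rewrite -(@sum_window_shift (fun i => h i * lo t i * x (i - 1)) n L 1).
  - by apply: eq_bigr => i _; rewrite addrK.
  - by move=> i /hn ->; rewrite !mul0r.
  - by rewrite addn1.
rewrite -(@sum_window_shift (fun i => h i * up t i * x (i + 1)) n L (-1)).
- by apply: eq_bigr => i _; rewrite subrK.
- by move=> i /hn ->; rewrite !mul0r.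
- by rewrite addn1.
Qed.

Lemma sum_parts_comp D t h x n L : supp D h -> supp D x ->
  (forall i, (n < `|i|)%N -> h i = 0) -> (n < L)%N ->
  \sum_(i <- window L) h i * compr D t x i = \sum_(i <- window L) compr D (tr t) h i * x i.
Proof.
move=> hD xD hn nL.
rewrite [LHS](eq_bigr (fun i => h i * tri t x i)); last first.
  by move=> i _; rewrite /compr /dcut; case Di: (D i) => //; rewrite (_ : h i = 0) ?mul0r//; apply: hD; rewrite Di.
rewrite [RHS](eq_bigr (fun i => tri (tr t) h i * x i)); last first.
  by move=> i _; rewrite /compr /dcut; case Di: (D i) => //; rewrite (_ : x i = 0) ?mulr0//; apply: xD; rewrite Di.
exact: sum_parts hn nL.
Qed.

End Transpose.

(** * Inverses with exponential decay *)
Section Decay.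
Context {R : realType}.
Local Notation C := (Cplx R).
Implicit Types (x y h : int -> C) (D : int -> bool) (t : @coef R).

Definition nrm (p : \bar R) x : R := fine (lpnorm p x).

Lemma nrmP p x : (1 <= p)%E -> lpx p x ->
  nle p x (nrm p x) /\ forall c, nle p x c -> nrm p x <= c.
Proof.
move=> p1 [b hb]; have p0 : (0 <= lpnorm p x)%E.
  move: p p1 {hb}; apply: exp_ind => [|s s1]; last exact: poweR_ge0.
  apply: le_trans (ereal_sup_ubound (ex_intro2 _ _ 0 I erefl)).
  by rewrite lee_fin md_ge0.
have fN : lpnorm p x \is a fin_num.
  by rewrite ge0_fin_numE// (le_lt_trans hb)// ltry.
by rewrite /nle /nrm; split=> [|c]; [rewrite fineK | rewrite -lee_fin fineK].
Qed.

Lemma lpx_scale p a x : (1 <= p)%E -> lpx p x -> lpx p (fun k => a * x k).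
Proof.
move=> p1 [b hb]; exists (modulus a * b); apply: nle_scale hb => //.
  exact: md_ge0.
by move=> k; rewrite mdM.
Qed.

Lemma lpx_add p x y : (1 <= p)%E -> lpx p x -> lpx p y ->
  lpx p (fun k => x k + y k).
Proof. by move=> p1 [b hb] [b' hb']; exists (b + b'); exact: nle_add. Qed.

Lemma lpx_delta p j : (1 <= p)%E -> lpx p (@delta R j).
Proof. by move=> p1; exists 1; exact: nle_delta. Qed.

Lemma ler_4 (a b c d e u : R) : 0 <= a -> 0 <= b -> 0 <= u -> a <= c ->
  b <= d * e -> a * (b * u) <= c * d * (e * u).
Proof.
move=> a0 b0 u0 ac bd; have := ler_wpM2r u0 (ler_pM a0 b0 ac bd).
by rewrite !mulrA.
Qed.

(** Combes--Thomas argument: weighting a solution by [g ^ m k], with [g] slightly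
    larger than 1, changes the operator by a commutator that the lower bound
    absorbs, so the weighted solution stays bounded by [2 K]. *)
Lemma decay p D t K c : (1 <= p)%E -> 0 <= K -> 0 <= c -> bnd c t -> LB p D t K ->
  exists2 th : R, 0 < th < 1 & forall j x, supp D x -> lpx p x ->
    (forall i, compr D t x i = delta j i) ->
    forall i, modulus (x i) <= 2 * K * th ^+ `|i - j|.
Proof.
move=> p1 K0 c0 tc lb.
(* Small enough for the commutator to cost at most half of the norm. *)
pose d : R := (4 * (c * K + 1))^-1.
have cK : 0 <= c * K by rewrite mulr_ge0.
have d0 : 0 < d by rewrite invr_gt0; lra.
have dK : 2 * c * K * d <= 2^-1.
  by rewrite -ler_pdivlMr// invrK; lra.
pose g := 1 + d.
have g1 : 1 < g by rewrite /g; lra.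
have g0 : 0 < g by lra.
exists g^-1; first by rewrite invr_gt0 g0 invf_lt1.
move=> j x xD [b hb] xE i.
(* The truncation at [|i - j|] keeps the weighted vector in l^p. *)
pose m (k : int) := minn `|k - j| `|i - j|.
pose X k : C := (g ^+ m k)%:C%C * x k.
have gm k : 0 <= g ^+ m k by rewrite exprn_ge0// ltW.
have Xl : lpx p X.
  exists (g ^+ `|i - j| * b); apply: nle_scale hb => //.
    by rewrite exprn_ge0// ltW.
  move=> k; rewrite mdM mdR ger0_norm// ler_wpM2r ?md_ge0//.
  by rewrite ler_weXn2l ?ltW// geq_minr.
have [XN Xmin] := nrmP p1 Xl.
set b' := nrm p X in XN Xmin *.
have b'0 := nle_ge0 p1 XN.
pose E k := lo t k * ((g ^+ m (k - 1) - g ^+ m k)%:C%C * x (k - 1)) +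
            up t k * ((g ^+ m (k + 1) - g ^+ m k)%:C%C * x (k + 1)).
have gstep k l : (`|k - l| <= 1)%N -> `|g ^+ m k - g ^+ m l| <= d * g ^+ m k.
  move=> kl; have : m k = m l \/ m k = (m l).+1 \/ m l = (m k).+1.
    by rewrite /m; ilia.
  have := gm l; have := gm k; move: (m k) (m l) => a b0 ga gb.
  have gg u : g * u - u = d * u by rewrite /g; ring.
  case=> [->|[aE|bE]]; first by rewrite subrr normr0 mulr_ge0// ltW.
    rewrite aE exprS gg ger0_norm ?mulr_ge0 ?(ltW d0)//.
    by rewrite ler_pM2l// ler_peMl// ltW.
  by rewrite bE exprS -opprB normrN gg ger0_norm// mulr_ge0// ltW.
have hE : nle p E (c * d * b' + c * d * b').
  have cd0 : 0 <= c * d by rewrite mulr_ge0// ltW.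
  apply: nle_add => //.
    have := @nle_reidx _ _ p1 X b' (fun k => k - 1) (addIr _) XN.
    apply: nle_scale => // k; rewrite !mdM !mdR (ger0_norm (gm _)).
    by apply: ler_4 => //; rewrite ?md_ge0//; [case: (tc k) | apply: gstep; ilia].
  have := @nle_reidx _ _ p1 X b' (fun k => k + 1) (addIr _) XN.
  apply: nle_scale => // k; rewrite !mdM !mdR (ger0_norm (gm _)).
  by apply: ler_4 => //; rewrite ?md_ge0//; [case: (tc k) | apply: gstep; ilia].
have XT : nle p (compr D t X) (1 + (c * d * b' + c * d * b')).
  apply: nle_solid (nle_add p1 (nle_delta p1 j) (nle_cut p1 D hE)) => // k.
  rewrite le_eqVlt; apply/orP; left; apply/eqP; congr modulus.
  have -> : delta j k = (g ^+ m k)%:C%C * delta j k :> C.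
    rewrite /delta; case: eqP => [->|_]; last by rewrite mulr0.
    by rewrite /m subrr min0n expr0 mul1r.
  rewrite -xE /compr /dcut; case: ifP => _; last by rewrite mulr0 addr0.
  by rewrite /tri /E /X !rmorphB /=; ring.
have XD : supp D X by move=> k /xD; rewrite /X => ->; rewrite mulr0.
have := Xmin _ (lb X XD Xl _ XT) => h.
have b2 : b' <= 2 * K.
  have : K * (c * d * b' + c * d * b') <= 2^-1 * b'.
    have -> : K * (c * d * b' + c * d * b') = 2 * c * K * d * b' by ring.
    by rewrite ler_wpM2r.
  by lra.
have := le_trans (nle_pt p1 i XN) b2.
rewrite mdM mdR ger0_norm// /m minnn exprVn => h'.
by rewrite ler_pdivlMr ?exprn_gt0// mulrC.
Qed.

(** A two-sided inverse matrix whose entries decay exponentially away from the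
    diagonal.  The exponent [p] does not occur, which is why invertibility is
    independent of it; the last condition says that [s] is a left inverse. *)
Definition expinv D t := exists (s : int -> int -> C) (M th : R),
  [/\ 0 < th < 1, forall i j, modulus (s i j) <= M * th ^+ `|i - j|,
      forall i j, ~~ (D i && D j) -> s i j = 0,
      forall j, D j -> forall i, compr D t (fun i => s i j) i = delta j i
    & forall i, D i -> forall j, compr D (tr t) (s i) j = delta i j].

Lemma expinv_tr D t : expinv D t -> expinv D (tr t).
Proof.
move=> [s [M [th [th1 sM sD sT Ts]]]]; exists (fun i j => s j i), M, th; split=> //.
- by move=> i j; rewrite distnC.
- by move=> i j; rewrite andbC; exact: sD.
- by rewrite trK.
Qed.

Lemma supp_delta D j : D j -> supp D (@delta R j).
Proof. by move=> Dj i Di; rewrite /delta; case: eqP Di => // ->; rewrite Dj. Qed.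

(** The columns of [s] solve the equation with right-hand side [delta j] and
    decay by [decay].  That [s] is also a left inverse follows from injectivity:
    applying the operator to the claimed identity makes it trivial. *)
Lemma linv_expinv p D t K c : (1 <= p)%E -> 0 <= K -> 0 <= c -> bnd c t ->
  linv p D t K -> expinv D t.
Proof.
move=> p1 K0 c0 tc [lb sur].
have [th th1 dec] := decay p1 K0 c0 tc lb.
have lpd j : lpx p (@delta R j) by exists 1; exact: nle_delta.
have /choice[s hs] : forall j, exists x, [/\ supp D x, lpx p x,
    D j -> forall i, compr D t x i = delta j i & ~~ D j -> x = fun=> 0].
  move=> j; case Dj: (D j).
    by have [x [? ? ?]] := sur _ (supp_delta Dj) (lpd j); exists x; split.
  exists (fun=> 0); split=> //.
  by exists 0; exact: nle_0.
have s0 i j : ~~ (D i && D j) -> s j i = 0.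
  rewrite negb_and; case: (hs j) => hD _ _ h0 /orP[/hD//|/h0 ->//].
exists (fun i j => s j i), (2 * K), th; split=> //.
- move=> i j; case Dj: (D j); last first.
    rewrite s0 ?Dj ?andbF// md0 !mulr_ge0// exprn_ge0//.
    by case/andP: th1 => /ltW.
  by case: (hs j) => hD hl hT _; apply: dec => //; exact: hT.
- by move=> j Dj; case: (hs j) => _ _ + _; apply.
move=> i Di j; rewrite /compr /dcut; case Dj: (D j); last first.
  by rewrite /delta; case: eqP => // ji; rewrite ji Di in Dj.
(* Entry [(k, j)] of the product of [s] with the operator. *)
pose z k : C := tri (tr t) (fun l => s l k) j.
have zE k : z k = up t (j - 1) * s (j - 1) k + di t j * s j k + lo t (j + 1) * s (j + 1) k.
  by [].
suff : forall k, z k - delta j k = 0.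
  by move=> /(_ i)/eqP; rewrite subr_eq0 /z => /eqP ->; rewrite deltaC.
have Tz k : compr D t z k = up t (j - 1) * compr D t (s (j - 1)) k +
    di t j * compr D t (s j) k + lo t (j + 1) * compr D t (s (j + 1)) k.
  rewrite /compr /dcut; case: ifP => _; last by rewrite !mulr0 !addr0.
  by rewrite /tri !zE; ring.
have sl j' : lpx p (s j') by case: (hs j').
apply: (LB_inj p1 lb).
- move=> k Dk; rewrite zE !s0 ?(negPf Dk)// !mulr0 !addr0 /delta.
  by case: eqP Dk => [->|]; rewrite ?Dj// subrr.
- apply: lpx_add => //.
    rewrite (_ : z = fun k => up t (j - 1) * s (j - 1) k + di t j * s j k +
      lo t (j + 1) * s (j + 1) k)//.
    apply: lpx_add => //; last exact: lpx_scale.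
    by apply: lpx_add => //; exact: lpx_scale.
  have [b hb] := lpd j; exists b; apply: nle_solid hb => // k.
  by rewrite mdN.
move=> k; have -> : compr D t (fun k => z k - delta j k) k =
    compr D t z k - compr D t (delta j) k.
  by rewrite /compr /dcut; case: ifP => _; rewrite ?subrr// /tri; ring.
rewrite Tz; case Dk: (D k); last first.
  by rewrite /compr /dcut Dk !mulr0 !addr0 subrr.
have sE l : compr D t (s l) k = if D l then delta l k else 0.
  case: (hs l) => _ _ hT h0; case: ifPn => [Dl|Dl]; first exact: hT.
  by rewrite h0// compr0.
rewrite !sE Dj /compr /dcut Dk /tri.
have -> : up t (j - 1) * (if D (j - 1) then delta (j - 1) k else 0) =
    up t k * delta j (k + 1).
  rewrite /delta; case: (eqVneq k (j - 1)) => [kE|kj].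
    by rewrite -kE Dk (_ : k + 1 == j)//; ilia.
  by rewrite if_same (_ : (k + 1 == j) = false) ?mulr0//; ilia.
have -> : lo t (j + 1) * (if D (j + 1) then delta (j + 1) k else 0) =
    lo t k * delta j (k - 1).
  rewrite /delta; case: (eqVneq k (j + 1)) => [kE|kj].
    by rewrite -kE Dk (_ : k - 1 == j)//; ilia.
  by rewrite if_same (_ : (k - 1 == j) = false) ?mulr0//; ilia.
have -> : di t j * delta j k = di t k * delta j k.
  by rewrite /delta; case: eqP => [->|_]; rewrite ?mulr0.
by ring.
Qed.

Lemma sum_geom (th : R) L : 0 < th < 1 ->
  \sum_(k <- window L) th ^+ `|k| <= 2 / (1 - th).
Proof.
move=> /andP[th0 th1].
have g n : \sum_(i < n) th ^+ i <= (1 - th)^-1.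
  have h : (1 - th) * \sum_(i < n) th ^+ i = 1 - th ^+ n.
    by rewrite -opprB mulNr -subrX1 opprB.
  rewrite -[leRHS]mulr1 ler_pdivlMl ?subr_gt0// h gerBl exprn_ge0// ltW//.
rewrite /window big_map -[(L + L).+1]subn0 -/(index_iota 0 (L + L).+1).
rewrite (big_cat_nat (n := L)) //=; last by ilia.
have -> : 2 / (1 - th) = (1 - th)^-1 + (1 - th)^-1 by ring.
apply: lerD.
  rewrite big_nat_rev /= big_mkord; apply: le_trans (g L); apply: ler_sum => i _.
  rewrite ler_wiXn2l ?ltW//; have := ltn_ord i; ilia.
rewrite -[X in index_iota X]add0n big_addn big_mkord; apply: le_trans (g _).
apply: ler_sum => i _.
rewrite ler_wiXn2l ?ltW//; ilia.
Qed.

(** The matrix [s] is a sum of weighted shifts, one for each of its diagonals,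
    whose norms form a convergent geometric series. *)
Lemma expinv_linv p D t c : (1 <= p)%E -> 0 <= c -> bnd c t -> expinv D t ->
  exists2 K, 0 <= K & linv p D t K.
Proof.
move=> p1 c0 tc [s [M [th [th1 sM sD sT Ts]]]].
have M0 : 0 <= M by have := sM 0 0; rewrite subrr expr0 mulr1; apply: le_trans (md_ge0 _).
have [th0 thl] := andP th1.
pose K := M * (2 / (1 - th)).
have K0 : 0 <= K by rewrite mulr_ge0// divr_ge0// subr_ge0 ltW.
pose S m y i : C := \sum_(j <- window m) s i j * y j.
have SK m y b : nle p y b -> nle p (S m y) (K * b).
  move=> yb; have b0 := nle_ge0 p1 yb.
  have P n : nle p (restr (window n) (S m y)) (K * b).
    pose ym := restr (window m) y.
    have ymb : nle p ym b by exact: nle_restr.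
    (* The contribution of the diagonal at distance [k]. *)
    have h k : nle p (fun i => s i (i + k) * ym (i + k)) (M * th ^+ `|k| * b).
      have := @nle_reidx _ _ p1 ym b (fun i => i + k) (addIr _) ymb.
      apply: nle_scale => // [|i]; first by rewrite mulr_ge0 ?exprn_ge0// ltW.
      rewrite mdM ler_wpM2r ?md_ge0// (le_trans (sM _ _))// distnC.
      by rewrite addrAC subrr add0r.
    have := nle_restr p1 (window n) (nle_sum p1 (window (n + m)%N) h).
    have le : \sum_(k <- window (n + m)) M * th ^+ `|k| * b <= K * b.
      by rewrite -mulr_suml -mulr_sumr ler_wpM2r// ler_wpM2l// sum_geom.
    move/nle_trans => /(_ _ le); apply: nle_solid => // i.
    rewrite /restr mem_window; case: ifP => // ni.
    rewrite le_eqVlt; apply/orP; left; apply/eqP; congr modulus.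
    rewrite -(big_map (fun k => i + k) predT (fun j => s i j * ym j)).
    rewrite /S (eq_big_seq (fun j => s i j * ym j)); last first.
      by move=> j jm; rewrite /ym /restr jm.
    apply: sum_eq_supp; last 2 first.
    - by rewrite map_inj_uniq ?window_uniq//; exact: addrI.
    - exact: window_uniq.
    - move=> j jn; rewrite /ym /restr; case: ifP => jm; last by rewrite mulr0.
      case/mapP: jn; exists (j - i); last by rewrite addrC subrK.
      by move: jm; rewrite !mem_window; ilia.
    by move=> j /negPf jm; rewrite /ym /restr jm mulr0.
  apply: nle_fatou => // J e e0.
  pose n := (\sum_(i <- J) `|i|)%N.
  exists (restr (window n) (S m y)) => // i iJ.
  rewrite /restr mem_window (_ : (`|i| <= n)%N) ?subrr ?md0 ?ltW//.
  by rewrite /n (big_rem i)//= leq_addr.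
exists K => //; split.
  apply: (LB_finsupp p1 K0 tc) => x xD [n xn] b hb.
  apply: nle_solid (SK n.+2 _ _ hb) => // i.
  rewrite le_eqVlt; apply/orP; left; apply/eqP; congr modulus.
  case Di: (D i); last first.
    rewrite xD ?Di// /S big1// => j _.
    by rewrite sD ?mul0r// Di.
  have -> : S n.+2 (compr D t x) i = \sum_(j <- window n.+2) s i j * tri t x j.
    apply: eq_bigr => j _; rewrite /compr /dcut; case Dj: (D j) => //.
    by rewrite sD ?mul0r// Dj andbF.
  (* Summation by parts moves the operator from [x] to row [i] of [s]. *)
  have := @sum_parts _ (tr t) x (s i) n n.+2 xn (ltnW (ltnSn _)).
  rewrite trK => e; under eq_bigr do rewrite mulrC; rewrite -e.
  rewrite (eq_bigr (fun j => x j * delta j i)).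
    rewrite sum_delta ?window_uniq// /restr mem_window; case: ifP => // /negbT.
    by rewrite -ltnNge => ni; rewrite xn//; ilia.
  move=> j _; have := Ts i Di j; rewrite deltaC /compr /dcut.
  case: ifPn => [_ -> //|Dj _]; by rewrite xD// !mul0r.
move=> y yD [b yb]; have b0 := nle_ge0 p1 yb.
have ub m i : modulus (S m y i) <= K * b by exact: (nle_pt p1 i (SK m _ _ yb)).
have [x hx] := ucv_vec ub; exists x; split.
- apply: (supp_ucv (E := fun=> D)) hx => [n i Di|i]; last by exists 0%N.
  by rewrite /S big1// => j _; rewrite sD ?mul0r// negb_and Di.
- by exists (K * b); apply: (nle_ucv p1 _ hx) => m; exact: SK.
move=> i; rewrite /compr /dcut; case: ifPn => Di; last by rewrite yD.
have : ucv (fun n => tri t (S n y) i) (tri t x i).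
  by apply: ucvD; [apply: ucvD|]; apply: ucvM => //; exact: ucv_cst.
move/ucv_unique; apply; apply: ucv_ext (ucv_cst (y i)).
exists `|i|%N => n ni.
have -> : tri t (S n y) i = \sum_(j <- window n) y j * tri t (fun k => s k j) i.
  rewrite /tri /S !mulr_sumr -!big_split /=; apply: eq_bigr => j _; ring.
rewrite (eq_bigr (fun j => y j * delta j i)).
  by rewrite sum_delta ?window_uniq// /restr mem_window ni.
move=> j _; case Dj: (D j); last by rewrite yD ?Dj// !mul0r.
by have := sT j Dj i; rewrite /compr /dcut Di => ->.
Qed.

(** For [y] in l^p there is [x] with image [y] and norm at most [K |y|];
    pairing [h] with [y] equals pairing the image of [h] under the transpose with
    [x]. *)
Lemma dual_LB p q D t K c : (1 <= p)%E -> (1 <= q)%E -> (p^-1 + q^-1 = 1)%E ->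
  0 <= K -> bnd c t -> linv p D t K -> LB q D (tr t) K.
Proof.
move=> p1 q1 pq K0 tc [lb sur]; apply: (LB_finsupp q1 K0 (bnd_tr tc)) => h hD [n hn] b hb.
apply: (norming p1 q1 pq (window_uniq n)) => [i|y yn a ya].
  by rewrite mem_window -ltnNge => /hn.
have ya' := nle_cut p1 D ya.
have [x [xD xl xE]] := sur _ (@supp_cut _ D y) (ex_intro _ a ya').
have xa : nle p x (K * a).
  by apply: lb => //; apply: nle_solid ya' => // i; rewrite xE.
have -> : \sum_(i <- window n) h i * y i = \sum_(i <- window n.+1) h i * compr D t x i.
  rewrite (eq_bigr (fun i => h i * compr D t x i)); last first.
    move=> i _; rewrite xE /dcut; case Di: (D i) => //.
    by rewrite hD ?Di// !mul0r.
  apply: sum_eq_supp; try exact: window_uniq.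
    by move=> i; rewrite mem_window -ltnNge => ni; rewrite hn ?mul0r//; ilia.
  by move=> i; rewrite mem_window -ltnNge => ni; rewrite hn ?mul0r.
rewrite (sum_parts_comp _ hD xD hn (ltnSn n)).
rewrite (le_trans (md_sum _ _))//.
under eq_bigr do rewrite mdM mulrC.
have -> : K * b * a = K * a * b by ring.
exact: (hoelder_sum p1 q1 pq (window_uniq _) xa hb).
Qed.

(** Solvability for the transpose comes from the matrix inverse, for the dual of
    l^oo is larger than l^1. *)
Lemma dual_linv p q D t K c : (1 <= p)%E -> (1 <= q)%E -> (p^-1 + q^-1 = 1)%E ->
  0 <= K -> 0 <= c -> bnd c t -> linv p D t K -> linv q D (tr t) K.
Proof.
move=> p1 q1 pq K0 c0 tc h; split; first exact: dual_LB h.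
have := expinv_tr (linv_expinv p1 K0 c0 tc h).
by case/(expinv_linv q1 c0 (bnd_tr tc)) => K' _ [].
Qed.

End Decay.

(** * Shifts and reflections *)
Section Symmetry.
Context {R : realType}.
Local Notation C := (Cplx R).
Implicit Types (x y h : int -> C) (D : int -> bool) (t : @coef R).

Lemma linv_reidx p D t D' t' K (g g' : int -> int) : (1 <= p)%E ->
  cancel g g' -> cancel g' g -> (forall i, D' i = D (g i)) ->
  (forall x i, tri t' (fun j => x (g j)) i = tri t x (g i)) ->
  linv p D t K -> linv p D' t' K.
Proof.
move=> p1 gK g'K DE tE [lb sur].
have tE' x i : compr D' t' (fun j => x (g j)) i = compr D t x (g i).
  by rewrite /compr /dcut DE tE.
have gE x : (fun j => x (g' (g j))) = x by apply/funext => j; rewrite gK.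
split=> [x xD [b xb] c xc|y yD [b yb]].
  pose X j := x (g' j).
  have xX : x = fun j => X (g j) by rewrite /X gE.
  rewrite xX; apply: nle_reidx => //; first exact: can_inj gK.
  apply: lb.
  - by move=> i Di; apply: xD; rewrite DE g'K.
  - by exists b; apply: nle_reidx => //; exact: can_inj g'K.
  have := @nle_reidx _ _ p1 _ _ g' (can_inj g'K) xc.
  apply: nle_solid => // i; rewrite [in X in _ <= X]xX tE' g'K//.
pose Y j := y (g' j).
have [||x [xD [b' xb] xE]] := sur Y.
- by move=> i Di; apply: yD; rewrite DE g'K.
- by exists b; apply: nle_reidx => //; exact: can_inj g'K.
exists (fun j => x (g j)); split.
- by move=> i; rewrite DE => /xD.
- by exists b'; apply: nle_reidx => //; exact: can_inj gK.
by move=> i; rewrite tE' xE /Y gK.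
Qed.

Definition sh (k : int) t := Coef (fun i => lo t (i + k)) (fun i => di t (i + k))
  (fun i => up t (i + k)).
Definition rf t := Coef (fun i => up t (- i)) (fun i => di t (- i)) (fun i => lo t (- i)).

Lemma linv_sh p D t K k : (1 <= p)%E -> linv p D t K ->
  linv p (fun i => D (i + k)) (sh k t) K.
Proof.
move=> p1; apply: (@linv_reidx _ _ _ _ _ _ (fun i => i + k) (fun i => i - k)) => //.
- by move=> i; rewrite addrK.
- by move=> i; rewrite subrK.
move=> x i; rewrite /tri /=; have -> : i - 1 + k = i + k - 1 by ring.
by have -> : i + 1 + k = i + k + 1 by ring.
Qed.

Lemma linv_rf p D t K : (1 <= p)%E -> linv p D t K ->
  linv p (fun i => D (- i)) (rf t) K.
Proof.
move=> p1; apply: (@linv_reidx _ _ _ _ _ _ -%R -%R) => //; try exact: opprK.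
by move=> x i; rewrite /tri /= opprB (addrC 1) opprD; ring.
Qed.

Lemma rfK t : rf (rf t) = t.
Proof.
by case: t => l d u; rewrite /rf /=; congr Coef; apply/funext => i; rewrite opprK.
Qed.

End Symmetry.

(** * Half-line operators and gluing *)
Section Coburn.
Context {R : realType}.
Local Notation C := (Cplx R).
Implicit Types (x y g h : int -> C) (D : int -> bool) (t : @coef R) (U V W : set C).

(** The class M(U,V,W); all coefficients are constrained, including those that a
    compression to [D] does not see. *)
Definition Mt U V W t := forall i, [/\ U (lo t i), V (di t i) & W (up t i)].
Definition DN (i : int) : bool := 0 <= i.
Definition DZ (i : int) : bool := true.
Definition Df (n : nat) (i : int) : bool := (0 <= i) && (i < n%:Z).

Definition pinj p D t := forall x, supp D x -> lpx p x ->
  (forall i, compr D t x i = 0) -> forall i, x i = 0.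

Lemma Mt_tr U V W t : Mt U V W t -> Mt W V U (tr t).
Proof. by move=> h i; case: (h i) (h (i + 1)) (h (i - 1)) => ? ? ? [? ? ?] [? ? ?]. Qed.
Lemma Mt_rf U V W t : Mt U V W t -> Mt W V U (rf t).
Proof. by move=> h i; case: (h (- i)). Qed.
Lemma Mt_sh U V W t k : Mt U V W t -> Mt U V W (sh k t).
Proof. by move=> h i; case: (h (i + k)). Qed.

Definition bddset (c : R) U := forall z : C, U z -> modulus z <= c.

Lemma Mt_bnd c U V W t : bddset c U -> bddset c V -> bddset c W ->
  Mt U V W t -> bnd c t.
Proof. by move=> hU hV hW h i; case: (h i) => ? ? ?; split; [exact: hU|exact: hV|exact: hW]. Qed.

Lemma comprDZ t x : compr DZ t x = tri t x.
Proof. by []. Qed.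
Lemma suppZ x : supp DZ x.
Proof. by []. Qed.

(** The operator [b] to the right of 0 and the reflection of [a] to the left of
    0, with one additional row at 0 that couples the two halves through the
    values [lo b (-1)] and [up b (-1)], which the half-line operator [b] does not
    use. *)
Definition zglue (a b : coef) : @coef R :=
  Coef (fun i => if 0 <= i then lo b (i - 1) else up a (- i - 1))
       (fun i => if 0 <= i then di b (i - 1) else di a (- i - 1))
       (fun i => if 0 <= i then up b (i - 1) else lo a (- i - 1)).
Definition gluer g (i : int) : C := if 0 < i then g (i - 1) else 0.
Definition gluel h (i : int) : C := if i < 0 then h (- i - 1) else 0.

Lemma Mt_zglue U V W a b : Mt W V U a -> Mt U V W b -> Mt U V W (zglue a b).
Proof.
move=> ha hb i; rewrite /zglue /=; case: ifP => _; first exact: hb.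
by case: (ha (- i - 1)).
Qed.

(** Because [gluer g] vanishes at 0, it feels the glued operator only on the right
    and in row 0. *)
Lemma tri_gluer a b g i : supp DN g -> tri (zglue a b) (gluer g) i =
  if i == 0 then up b (-1) * g 0 else gluer (tri b g) i.
Proof.
move=> gN; rewrite /tri /zglue /gluer /=.
have [i0|i0|->] := ltrgtP i 0.
- by rewrite !ifF ?mulr0 ?addr0//; ilia.
- have -> : 0 < i + 1 by ilia.
  have -> : i + 1 - 1 = i - 1 + 1 by ring.
  have [i1|i1] := ltP 0 (i - 1); first by [].
  by rewrite (gN (i - 1 - 1)) ?mulr0//; rewrite /DN; ilia.
have -> : (0 : int) - 1 = -1 by [].
have -> : (0 : int) + 1 = 1 by [].
by rewrite (_ : (0 < -1 :> int) = false)// (_ : (0 < 1 :> int))// subrr !mulr0 !add0r.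
Qed.

Lemma tri_gluel a b h i : supp DN h -> tri (zglue a b) (gluel h) i =
  if i == 0 then lo b (-1) * h 0 else gluel (tri a h) i.
Proof.
move=> hN; rewrite /tri /zglue /gluel /=.
have [i0|i0|->] := ltrgtP i 0.
- have -> : i - 1 < 0 by ilia.
  have -> : - (i - 1) - 1 = - i - 1 + 1 by ring.
  have -> : - (i + 1) - 1 = - i - 1 - 1 by ring.
  have [i1|i1] := ltP (i + 1) 0; first by ring.
  have -> : h (- i - 1 - 1) = 0 by apply: hN; rewrite /DN; ilia.
  by ring.
- by rewrite !ifF ?mulr0 ?addr0//; ilia.
have -> : (0 : int) - 1 = -1 by [].
have -> : (0 : int) + 1 = 1 by [].
by rewrite (_ : (1 < 0 :> int) = false)// (_ : (-1 < 0 :> int))// opprK subrr !mulr0 !addr0.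
Qed.

Lemma nle_gluer p g b : (1 <= p)%E -> nle p g b -> nle p (gluer g) b.
Proof.
move=> p1 hg; have := @nle_reidx _ _ p1 g b (fun i => i - 1) (addIr _) hg.
by apply: nle_solid => // i; rewrite /gluer; case: ifP => // _; rewrite md0 md_ge0.
Qed.

Lemma nle_gluel p h b : (1 <= p)%E -> nle p h b -> nle p (gluel h) b.
Proof.
move=> p1 hg; have := @nle_reidx _ _ p1 h b (fun i => - i - 1) _ hg.
move=> /(_ (fun i j => _)) H.
apply: nle_solid (H _) => // i; last ilia.
by rewrite /gluel; case: ifP => // _; rewrite md0 md_ge0.
Qed.

Section Fix.
Variables (p : \bar R) (p1 : (1 <= p)%E).

(** The reflection of [h] and [g], separated by a zero, are put together on the
    integers; of the two coefficients one is free to satisfy row 0, which makes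
    the combination a kernel vector of the glued operator. *)
Lemma coburn U V W a b g h : (forall t, Mt U V W t -> pinj p DZ t) ->
  Mt W V U a -> Mt U V W b ->
  supp DN g -> lpx p g -> (forall i, compr DN b g i = 0) ->
  supp DN h -> lpx p h -> (forall i, compr DN a h i = 0) ->
  (exists i, g i != 0) -> (exists i, h i != 0) -> False.
Proof.
move=> Zinj ha hb gN [B gB] g0 hN [B' hB] h0 [i gi] [j hj].
have trib k : 0 <= k -> tri b g k = 0.
  by move=> k0; have := g0 k; rewrite /compr /dcut /DN k0.
have tria k : 0 <= k -> tri a h k = 0.
  by move=> k0; have := h0 k; rewrite /compr /dcut /DN k0.
(* Cancellation in row 0 makes a kernel vector, so both coefficients vanish. *)
have K al be : al * (lo b (-1) * h 0) + be * (up b (-1) * g 0) = 0 ->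
    al = 0 /\ be = 0.
  move=> e; pose x k := al * gluel h k + be * gluer g k.
  have x0 k : x k = 0.
    apply: (Zinj _ (Mt_zglue ha hb)) => //.
      by apply: lpx_add => //; apply: lpx_scale => //;
        [exists B'; exact: nle_gluel | exists B; exact: nle_gluer].
    move=> l; rewrite comprDZ /x triD !triZ tri_gluel// tri_gluer//.
    case: ifP => // l0; rewrite /gluel /gluer.
    have [l1|l1] := ltP l 0.
      have l2 : (0 < l) = false by ilia.
      have l3 : 0 <= - l - 1 by ilia.
      by rewrite (tria _ l3) l2 !mulr0 addr0.
    have l2 : 0 < l by ilia.
    have l3 : 0 <= l - 1 by ilia.
    by rewrite (trib _ l3) l2 !mulr0 addr0.
  have gN0 k : g k != 0 -> 0 <= k by apply: contraNT => /gN ->.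
  have hN0 k : h k != 0 -> 0 <= k by apply: contraNT => /hN ->.
  split.
    have := x0 (- j - 1); rewrite /x /gluel /gluer.
    have hj0 := hN0 _ hj.
    have l1 : - j - 1 < 0 by ilia.
    have l2 : (0 < - j - 1) = false by ilia.
    rewrite l1 l2 mulr0 addr0 (_ : - (- j - 1) - 1 = j); last by ring.
    by move/eqP; rewrite mulf_eq0 (negPf hj) orbF => /eqP.
  have := x0 (i + 1); rewrite /x /gluel /gluer.
  have gi0 := gN0 _ gi.
  have l1 : 0 < i + 1 by ilia.
  have l2 : (i + 1 < 0) = false by ilia.
  rewrite l1 l2 mulr0 add0r addrK.
  by move/eqP; rewrite mulf_eq0 (negPf gi) orbF => /eqP.
have [e|e] := eqVneq (up b (-1) * g 0) 0.
  by case: (K 0 1); rewrite ?e ?mulr0 ?mul0r ?addr0// => _ /eqP; rewrite oner_eq0.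
have [] := K (up b (-1) * g 0) (- (lo b (-1) * h 0)); first by ring.
by move/eqP; rewrite (negPf e).
Qed.

Lemma lpx_exp (x : int -> C) M th k : 0 < th < 1 ->
  (forall i, modulus (x i) <= M * th ^+ `|i - k|) -> lpx p x.
Proof.
move=> th1 xM; have [th0 th2] := andP th1.
have M0 : 0 <= M by have := xM k; rewrite subrr expr0 mulr1; apply: le_trans (md_ge0 _).
pose z i := x (i + k).
suff [b hb] : lpx p z.
  exists b; have := @nle_reidx _ _ p1 z b (fun i => i - k) (addIr _) hb.
  by apply: nle_solid => // i; rewrite /z subrK.
exists (M * (2 / (1 - th))); apply: nle_fatou => // J e e0.
pose n := (\sum_(i <- J) `|i|)%N.
exists (restr (window n) z); last first.
  move=> i iJ; rewrite /restr mem_window (_ : (`|i| <= n)%N) ?subrr ?md0 ?ltW//.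
  by rewrite /n (big_rem i)//= leq_addr.
have h : forall i, i \notin window n -> restr (window n) z i = 0.
  by move=> i; rewrite /restr => /negPf ->.
apply: nle_trans (nle_fin p1 (window_uniq n) h) _.
apply: le_trans (ler_wpM2l M0 (sum_geom n th1)); rewrite mulr_sumr.
rewrite big_seq [leRHS]big_seq; apply: ler_sum => i iw.
by rewrite /restr iw /z (le_trans (xM _))// addrK.
Qed.

Lemma compr_cutN t x i : compr DN t (dcut DN x) i =
  dcut DN (tri t x) i - lo t 0 * x (-1) * delta 0 i.
Proof.
rewrite /compr /dcut /delta /tri /DN; case: ifPn => i0; last first.
  by rewrite (_ : (i == 0) = false) ?mulr0 ?subr0//; ilia.
rewrite i0 (_ : 0 <= i + 1); last ilia.
have [->|iN] := eqVneq i 0; first by rewrite /= mulr1 sub0r; ring.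
by rewrite (_ : 0 <= i - 1) ?mulr0 ?subr0//; ilia.
Qed.

Lemma lpx_cut D x : lpx p x -> lpx p (dcut D x).
Proof. by move=> [b hb]; exists b; exact: nle_cut. Qed.

(** The kernel vector is row -1 of the inverse on the integers, restricted to the
    half line.  It is one because the entry [s (-1) (-1)] vanishes, which is what
    the failure of surjectivity is used for; it does not vanish at 0 because
    [lo t 0 * s (-1) 0 = 1]. *)
Lemma not_Sur_kernel t c : 0 <= c -> bnd c t -> expinv DZ t -> ~ Sur p DN t ->
  exists h, [/\ supp DN h, lpx p h, forall i, compr DN (tr t) h i = 0 & h 0 != 0].
Proof.
move=> c0 tc dt nS; have [K K0 [_ sZ]] := expinv_linv p1 c0 tc dt.
have [s [M [th [th1 sM _ sT Ts]]]] := dt.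
(* If [delta 0] were in the range, the solution on the integers could be cut at
   0 and corrected, which would give surjectivity. *)
have nP (f : int -> C) (a : C) : supp DN f -> lpx p f ->
    (forall i, compr DN t f i = a * delta 0 i) -> a = 0.
  move=> fN fl fE; apply/eqP; apply: contra_notT nS => a0 y yN yl.
  have [X [_ Xl XE]] := sZ y (@suppZ y) yl.
  exists (fun i => dcut DN X i + (lo t 0 * X (-1) / a) * f i); split.
  - by move=> i Di; rewrite fN// supp_cut// mulr0 addr0.
  - by apply: lpx_add => //; [exact: lpx_cut|exact: lpx_scale].
  move=> i; rewrite comprD comprZ compr_cutN fE mulrA divfK//.
  rewrite subrK /dcut; case: ifPn => // Di; first by have := XE i; rewrite comprDZ.
  by rewrite yN.
have sl j : lpx p (fun i => s i j) by apply: (lpx_exp (k := j) th1) => i; exact: sM.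
have sE j i : tri t (fun k => s k j) i = delta j i by exact: (sT j isT i).
have h1 : 1 - lo t 0 * s (-1) 0 = 0.
  apply: (nP (dcut DN (fun i => s i 0))); first exact: supp_cut.
    exact: lpx_cut.
  move=> i; rewrite compr_cutN mulrBl mul1r; congr (_ - _).
  rewrite /dcut sE; case: ifPn => //; rewrite /DN /delta; case: eqP => // ->.
  by [].
have h2 : - (lo t 0 * s (-1) (-1)) = 0.
  apply: (nP (dcut DN (fun i => s i (-1)))); first exact: supp_cut.
    exact: lpx_cut.
  move=> i; rewrite compr_cutN mulNr -[RHS]add0r; congr (_ - _).
  rewrite /dcut sE; case: ifPn => //; rewrite /DN /delta; case: eqP => // ->.
  by [].
have l0 : lo t 0 != 0.
  by apply/eqP => e; move: h1; rewrite e mul0r subr0 => /eqP; rewrite oner_eq0.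
have s11 : s (-1) (-1) = 0.
  by move/eqP: h2; rewrite oppr_eq0 mulf_eq0 (negPf l0) => /eqP.
exists (dcut DN (s (-1))); split.
- exact: supp_cut.
- by apply: lpx_cut; apply: (lpx_exp (k := -1) th1) => i; rewrite -distnC.
- move=> i; rewrite compr_cutN s11 mulr0 mul0r subr0 /dcut.
  have := Ts (-1) isT i; rewrite comprDZ => ->.
  by case: ifPn => //; rewrite /DN /delta; case: eqP => // ->.
rewrite /dcut /=; apply/eqP => e; move: h1; rewrite e mulr0 subr0 => /eqP.
by rewrite oner_eq0.
Qed.

(** Extension by zero changes the image only at -1, by a multiple of [x 0].
    Vectors with [x 0 = 1] and images tending to 0 would have an ultrafilter
    limit in the kernel, so [x 0] is controlled by the image. *)
Lemma inj_LB t c K : 0 <= c -> bnd c t -> 0 <= K -> LB p DZ t K -> pinj p DN t ->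
  exists2 K', 0 <= K' & LB p DN t K'.
Proof.
move=> c0 tc K0 lb ti.
have E x i : supp DN x -> tri t x i = compr DN t x i + up t (-1) * x 0 * delta (-1) i.
  move=> xN; rewrite /compr /dcut /delta /DN; case: ifPn => i0.
    by rewrite (_ : (i == -1) = false) ?mulr0 ?addr0//; ilia.
  have [->|iN] := eqVneq i (-1).
    by rewrite /tri (xN (-1))// (xN (-1 - 1))// !mulr0 !add0r mulr1.
  have z1 : x (i - 1) = 0 by apply: xN; rewrite /DN; ilia.
  have z2 : x i = 0 by exact: xN.
  have z3 : x (i + 1) = 0 by apply: xN; rewrite /DN; ilia.
  by rewrite /tri z1 z2 z3 !mulr0 !addr0.
have lbx x b : supp DN x -> lpx p x -> nle p (compr DN t x) b ->
    nle p x (K * (b + c * modulus (x 0))).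
  move=> xN xl xb; apply: (lb x (@suppZ x) xl); rewrite comprDZ.
  have hd : nle p (fun i => up t (-1) * x 0 * delta (-1) i) (c * modulus (x 0) * 1).
    apply: nle_scale (nle_delta p1 (-1)) => // [|i]; first by rewrite mulr_ge0 ?md_ge0.
    by rewrite !mdM ler_wpM2r ?md_ge0// ler_wpM2r ?md_ge0//; case: (tc (-1)).
  have := nle_add p1 xb hd; rewrite mulr1; apply: nle_solid => // i.
  by rewrite E.
suff [n hn] : exists n : nat, forall x, supp DN x -> lpx p x -> forall b,
    nle p (compr DN t x) b -> modulus (x 0) <= n.+1%:R * b.
  exists (K * (1 + c * n.+1%:R)); first by rewrite mulr_ge0// addr_ge0// mulr_ge0.
  move=> x xN xl b xb; apply: nle_trans (lbx x b xN xl xb) _.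
  rewrite -mulrA ler_wpM2l// mulrDl mul1r lerD2l -mulrA ler_wpM2l//.
  exact: hn.
apply: contrapT => nn.
have P n : exists z, [/\ supp DN z, z 0 = 1, nle p z (K * (1 + c)) &
    nle p (compr DN t z) n.+1%:R^-1].
  have : ~ forall x, supp DN x -> lpx p x -> forall b,
    nle p (compr DN t x) b -> modulus (x 0) <= n.+1%:R * b by move=> h; apply: nn; exists n.
  move=> /existsNP[x] /not_implyP[xN] /not_implyP[xl] /existsNP[b] /not_implyP[xb].
  move=> /negP; rewrite -ltNge => bx.
  have b0 := nle_ge0 p1 xb.
  have x0 : 0 < modulus (x 0) by apply: le_lt_trans bx; rewrite mulr_ge0.
  have x0N : x 0 != 0 by rewrite -md_gt0.
  pose z i := (x 0)^-1 * x i.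
  have zb : nle p (compr DN t z) n.+1%:R^-1.
    have : nle p (compr DN t z) ((modulus (x 0))^-1 * b).
      apply: nle_scale xb => // [|i]; first by rewrite invr_ge0 ltW.
      by rewrite comprZ mdM mdV.
    move/nle_trans; apply; rewrite mulrC ler_pdivrMr// mulrC ler_pdivlMr//.
    by rewrite mulrC ltW.
  have zN : supp DN z by move=> i /xN; rewrite /z => ->; rewrite mulr0.
  have z0 : z 0 = 1 by rewrite /z mulVf.
  exists z; split=> //.
  have := lbx z _ zN (lpx_scale _ p1 xl) zb; rewrite z0 md1 mulr1 => /nle_trans.
  by apply; rewrite ler_wpM2l// lerD2r invf_le1// ler1n.
have {P}/choice[z hz] := P.
have zb n i : modulus (z n i) <= K * (1 + c).
  by case: (hz n) => _ _ h _; exact: (nle_pt p1 i h).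
have [x hx] := ucv_vec zb.
have xN : supp DN x.
  apply: (supp_ucv (E := fun=> DN)) hx => [n|i]; first by case: (hz n).
  by exists 0%N.
have xl : lpx p x by exists (K * (1 + c)); apply: (nle_ucv p1 _ hx) => n; case: (hz n).
have x1 : x 0 = 1.
  apply: (ucv_unique (hx 0)); apply: ucv_ext (ucv_cst 1).
  by exists 0%N => n _; case: (hz n).
suff x0 : forall i, compr DN t x i = 0.
  by have := ti x xN xl x0 0; rewrite x1 => /eqP; rewrite oner_eq0.
move=> i; rewrite /compr /dcut; case: ifPn => // i0.
have : ucv (fun n => tri t (z n) i) (tri t x i).
  by apply: ucvD; [apply: ucvD|]; apply: ucvM => //; exact: ucv_cst.
move/ucv_unique; apply; apply: ucv_near => e e0; exists (Num.trunc e^-1) => n en.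
rewrite subr0; case: (hz n) => _ _ _ /(nle_pt p1 i).
rewrite /compr /dcut i0 => hh; apply: le_trans hh _.
rewrite invf_ple ?posrE//; apply: ltW.
by apply: (lt_le_trans (truncnS_gt _)); rewrite ler_nat.
Qed.

End Fix.
End Coburn.

(** * Invertibility of all half-line operators; pseudoergodicity *)
Section Whole.
Context {R : realType}.
Local Notation C := (Cplx R).
Implicit Types (x y g h : int -> C) (D : int -> bool) (t : @coef R) (U V W : set C).
Variables (p : \bar R) (p1 : (1 <= p)%E).

Definition bdd3 (c : R) U V W := [/\ 0 <= c, bddset c U, bddset c V & bddset c W].

Lemma bdd3_tr c U V W : bdd3 c U V W -> bdd3 c W V U.
Proof. by case. Qed.

Lemma bdd3_bnd c U V W t : bdd3 c U V W -> Mt U V W t -> bnd c t.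
Proof. by case=> _; exact: Mt_bnd. Qed.

Lemma bdd3_ge0 c U V W : bdd3 c U V W -> 0 <= c.
Proof. by case. Qed.

Lemma expinvZ_pinj c U V W : bdd3 c U V W ->
  (forall t, Mt U V W t -> expinv DZ t) -> forall t, Mt U V W t -> pinj p DZ t.
Proof.
move=> bd Zd t tM; have tb := bdd3_bnd bd tM.
have [K _ [lb _]] := expinv_linv p1 (bdd3_ge0 bd) tb (Zd t tM).
by move=> x xD xl h; exact: (LB_inj p1 lb).
Qed.

Lemma expinvZ_tr U V W : (forall t, Mt U V W t -> expinv DZ t) ->
  forall t, Mt W V U t -> expinv DZ t.
Proof. by move=> h t /Mt_tr/h/expinv_tr; rewrite trK. Qed.

(** Otherwise [t] and its transpose would both have kernel vectors on the half
    line, against [coburn]. *)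
Lemma not_pinj_Sur c U V W t : bdd3 c U V W ->
  (forall t, Mt U V W t -> expinv DZ t) -> Mt U V W t ->
  ~ pinj p DN t -> Sur p DN t.
Proof.
move=> bd Zd tM /existsNP[g] /not_implyP[gN] /not_implyP[gl] /not_implyP[g0] /existsNP[i gi].
apply: contrapT => nS.
have [h [hN hl h0 h00]] := not_Sur_kernel p1 (bdd3_ge0 bd) (bdd3_bnd bd tM) (Zd t tM) nS.
apply: (coburn p1 (expinvZ_pinj bd Zd) (Mt_tr tM) tM gN gl g0 hN hl h0).
  by exists i; apply/eqP.
by exists 0.
Qed.

(** If [t] had a kernel vector [g], it would be onto as well; then a vector
    with value 1 at 0 can be completed on both sides to a kernel vector of the glued
    operator, with a multiple of [g] serving to satisfy row 0. *)
Lemma Sur_tr_pinj c U V W A t : bdd3 c U V W ->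
  (forall t, Mt U V W t -> expinv DZ t) -> Mt W V U A -> Sur p DN A ->
  Mt U V W t -> pinj p DN t.
Proof.
move=> bd Zd AM AS tM; apply: contrapT => ni.
have tS := not_pinj_Sur bd Zd tM ni.
move: ni => /existsNP[g] /not_implyP[gN] /not_implyP[gl] /not_implyP[g0] /existsNP[i gi].
have Zi := expinvZ_pinj bd Zd.
pose Z := zglue A t; have ZM : Mt U V W Z by exact: Mt_zglue.
have i0 : 0 <= i by apply: contra_notT gi; exact: gN.
have tg j : 0 <= j -> tri t g j = 0.
  by move=> j0; have := g0 j; rewrite /compr /dcut /DN j0.
have ug : up t (-1) * g 0 != 0.
  apply/eqP => e; apply: gi.
  have := Zi Z ZM (gluer g) (@suppZ _ _); rewrite /lpx.
  have gg : exists b, nle p (gluer g) b.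
    by case: gl => b hb; exists b; exact: nle_gluer.
  move=> /(_ gg) h; have := h _ (i + 1); rewrite /gluer (_ : 0 < i + 1); last by ilia.
  rewrite addrK; apply => j; rewrite comprDZ tri_gluer// e; case: ifP => // _.
  rewrite /gluer; case: ifP => // j0; apply: tg; ilia.
have dl (a : C) : supp DN (fun j => a * delta 0 j) /\ lpx p (fun j => a * delta 0 j).
  split; last by apply: lpx_scale => //; exact: lpx_delta.
  by move=> j; rewrite /DN /delta; case: eqP => [->//|_]; rewrite mulr0.
have [h [hN hl hE]] := AS _ (dl (lo A 0)).1 (dl (lo A 0)).2.
have [b [bN bl bE]] := tS _ (dl (lo t 0)).1 (dl (lo t 0)).2.
have Ah j : 0 <= j -> tri A h j = lo A 0 * delta 0 j.
  by move=> j0; have := hE j; rewrite /compr /dcut /DN j0.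
have tb j : 0 <= j -> tri t b j = lo t 0 * delta 0 j.
  by move=> j0; have := bE j; rewrite /compr /dcut /DN j0.
(* The multiple of [g] that makes row 0 vanish. *)
pose tau := (di t (-1) - lo t (-1) * h 0 - up t (-1) * b 0) / (up t (-1) * g 0).
pose b' j := b j + tau * g j.
have b'N : supp DN b' by move=> j Dj; rewrite /b' bN// gN// mulr0 addr0.
have b'l : lpx p b' by apply: lpx_add => //; exact: lpx_scale.
pose x j := delta 0 j + (-1) * (gluel h j + gluer b' j).
have xl : lpx p x.
  apply: lpx_add => //; first exact: lpx_delta.
  apply: lpx_scale => //; apply: lpx_add => //.
    by case: hl => B hB; exists B; exact: nle_gluel.
  by case: b'l => B hB; exists B; exact: nle_gluer.
have := Zi Z ZM x (@suppZ _ _) xl; move=> /(_ _ 0).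
rewrite /x /gluel /gluer /delta /= !addr0 mulr0 addr0 => H.
suff : (1 : C) = 0 by move/eqP; rewrite oner_eq0.
apply: H => j; rewrite comprDZ triD triZ triD tri_gluel// tri_gluer//.
have [->|jN] := eqVneq j 0.
  rewrite /tri /Z /zglue /delta /= /tau.
  have -> : (0 : int) - 1 = -1 by [].
  have tE : tau * (up t (-1) * g 0) = di t (-1) - lo t (-1) * h 0 - up t (-1) * b 0.
    by rewrite /tau divfK.
  have -> : up t (-1) * b' 0 = up t (-1) * b 0 +
      (di t (-1) - lo t (-1) * h 0 - up t (-1) * b 0).
    by rewrite /b' mulrDr (mulrCA (up t (-1))) tE.
  by ring.
have tb' k : tri t b' k = tri t b k + tau * tri t g k by rewrite triD triZ.
have [j0|j0] := ltP j 0.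
  rewrite /gluel /gluer j0 (_ : (0 < j) = false); last by ilia.
  rewrite Ah; last by ilia.
  rewrite /tri /Z /zglue /= (_ : (0 <= j) = false); last by ilia.
  rewrite /delta (negPf jN) (_ : (j - 1 == 0) = false); last by ilia.
  rewrite (_ : (- j - 1 == 0) = (j + 1 == 0)); last by ilia.
  case: eqP => [j1|_]; last by ring.
  by rewrite (_ : - j - 1 = 0); [ring|ilia].
rewrite /gluel /gluer (_ : (j < 0) = false); last by ilia.
rewrite (_ : 0 < j); last by ilia.
rewrite tb' tb ?tg; [|ilia|ilia].
rewrite /tri /Z /zglue /= j0.
rewrite /delta (negPf jN) (_ : (j + 1 == 0) = false); last by ilia.
case: eqP => [j1|_]; last by ring.
by rewrite j1; ring.
Qed.

Lemma pinj_Sur_linv c U V W t : bdd3 c U V W ->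
  (forall t, Mt U V W t -> expinv DZ t) -> Mt U V W t ->
  pinj p DN t -> Sur p DN t -> exists2 K, 0 <= K & linv p DN t K.
Proof.
move=> bd Zd tM ti tS; have tb := bdd3_bnd bd tM; have c0 := bdd3_ge0 bd.
have [K K0 [lb _]] := expinv_linv p1 c0 tb (Zd t tM).
by have [K' K'0 lb'] := inj_LB p1 c0 tb K0 lb ti; exists K'.
Qed.

(** [Sur_tr_pinj] is applied to [t], and to its transpose, whose injectivity
    gives surjectivity of [t] by [not_Sur_kernel]. *)
Lemma half_line_all c U V W A K : bdd3 c U V W ->
  (forall t, Mt U V W t -> expinv DZ t) -> Mt U V W A -> 0 <= K -> linv p DN A K ->
  forall t, Mt U V W t -> expinv DN t.
Proof.
move=> bd Zd AM K0 AI t tM; have c0 := bdd3_ge0 bd.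
have Ab := bdd3_bnd bd AM.
have dA := linv_expinv p1 K0 c0 Ab AI.
have [K' K'0 [_ tAS]] := expinv_linv p1 c0 (bnd_tr Ab) (expinv_tr dA).
have ti : pinj p DN t by apply: (Sur_tr_pinj bd Zd (Mt_tr AM)).
have tS : Sur p DN t.
  apply: contrapT => nS.
  have [h [hN hl h0 h00]] := not_Sur_kernel p1 c0 (bdd3_bnd bd tM) (Zd t tM) nS.
  have : pinj p DN (tr t).
    by apply: (Sur_tr_pinj (bdd3_tr bd) (expinvZ_tr Zd) AM AI.2); exact: Mt_tr.
  by move=> /(_ h hN hl h0 0)/eqP; rewrite (negPf h00).
have [K2 K20 h] := pinj_Sur_linv bd Zd tM ti tS.
exact: linv_expinv p1 K20 c0 (bdd3_bnd bd tM) h.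
Qed.

(** By [not_pinj_Sur] a noninjective operator would be onto, and index 0 would
    make it injective. *)
Lemma half_line_index c U V W : bdd3 c U V W ->
  (forall t, Mt U V W t -> expinv DZ t) ->
  (forall t, Mt U V W t -> (pinj p DN t <-> Sur p DN t)) ->
  forall t, Mt U V W t -> expinv DN t.
Proof.
move=> bd Zd iS t tM; have c0 := bdd3_ge0 bd.
have ti : pinj p DN t.
  by apply: contrapT => ni; apply: (ni); apply/iS => //; exact: (not_pinj_Sur bd Zd tM ni).
have [K2 K20 h] := pinj_Sur_linv bd Zd tM ti ((iS t tM).1 ti).
exact: linv_expinv p1 K20 c0 (bdd3_bnd bd tM) h.
Qed.

(** Pseudoergodicity in terms of coefficients.  A submatrix of size [n] does not contain
    the left neighbour of its first diagonal entry nor the right neighbour of its last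
    one. *)
Definition pe U V W t := Mt U V W t /\
  forall (n : nat) t' (e : R), Mt U V W t' -> 0 < e -> exists k : nat,
    forall i : nat, (i < n)%N ->
    [/\ modulus (di t (k + i)%:Z - di t' i) <= e,
        (0 < i)%N -> modulus (lo t (k + i)%:Z - lo t' i) <= e
      & (i.+1 < n)%N -> modulus (up t (k + i)%:Z - up t' i) <= e].

(** The half line containing a long window of [t], recentred, looks like the
    integers, so [limit_inv] applies. *)
Lemma pe_limit c U V W t D K t' : bdd3 c U V W -> pe U V W t ->
  (forall i, 0 <= i -> D i) -> 0 <= K -> linv p D t K -> Mt U V W t' ->
  linv p DZ t' K.
Proof.
move=> bd [tM tpe] DP K0 tI t'M.
apply: (limit_inv p1 K0 (bdd3_bnd bd t'M)) => m.
have e0 : 0 < m.+1%:R^-1 :> R by rewrite invr_gt0.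
(* One extra row on each side of [-m, m], for the entries missing at the border. *)
have [k hk] := tpe (m + m).+3 (sh (- m.+1%:Z) t') _ (Mt_sh _ t'M) e0.
exists (fun i => D (i + (k + m.+1)%:Z)), (sh (k + m.+1)%:Z t); split.
- exact: (bdd3_bnd bd (Mt_sh _ tM)).
- by move=> i im; rewrite /DZ DP//; ilia.
- move=> i im; pose j := absz (i + m.+1%:Z).
  have jE : j%:Z = i + m.+1%:Z by rewrite /j; ilia.
  have jm : (j < (m + m).+3)%N by rewrite /j; ilia.
  have [h1 h2 h3] := hk j jm.
  have e1 : (k + j)%:Z = i + (k + m.+1)%:Z by ilia.
  have e2 : j%:Z - m.+1%:Z = i by ilia.
  move: h1 h2 h3; rewrite /= e1 e2 => h1 h2 h3; split=> //.
    by apply: h2; rewrite /j; ilia.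
  by apply: h3; rewrite /j; ilia.
exact: linv_sh.
Qed.

Lemma dom_scale_sh eta u v (a : C) k : 0 <= eta -> dom p eta u v ->
  dom p eta (fun i => a * u (i + k)) (fun i => a * v (i + k)).
Proof.
move=> eta0 h c hc; have c0 := nle_ge0 p1 hc.
have [a0|a0] := eqVneq a 0.
  apply: nle_trans (mulr_ge0 eta0 c0); apply: nle_solid (nle_0 p1) => // i.
  by rewrite a0 mul0r.
have ma : 0 < modulus a by rewrite md_gt0.
have h1 : nle p u ((modulus a)^-1 * c).
  have := @nle_reidx _ _ p1 _ _ (fun i => i - k) (addIr _) hc.
  apply: nle_scale => // [|i]; first by rewrite invr_ge0 ltW.
  by rewrite subrK mdM mulKf// gt_eqF.
have := @nle_reidx _ _ p1 _ _ (fun i => i + k) (addIr _) (h _ h1).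
have -> : eta * c = modulus a * (eta * ((modulus a)^-1 * c)).
  by field; rewrite gt_eqF.
apply: nle_scale => // [|i]; first exact: ltW.
by rewrite mdM.
Qed.

(** The sum of [la ^ k] times the translate of [x] by [k P], for [k < m]. *)
Definition shiftsum (x : int -> C) (la : C) (P : nat) :=
  fix F (m : nat) : int -> C :=
    if m is m'.+1 then (fun i => x i + la * F m' (i + - P%:Z)) else (fun=> 0).

Lemma geom_small (th a b : R) : 0 < th < 1 -> 0 < a -> 0 <= b ->
  exists m : nat, b * th ^+ m < a.
Proof.
move=> th1 a0 b0; have [th0 th2] := andP th1.
have h : (fun n => th ^+ n) @ \oo --> (0 : R) by apply: cvg_expr; rewrite ger0_norm// ltW.
have e0 : 0 < a / (b + 1) by rewrite divr_gt0//; lra.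
move/cvgrPdist_lt : h => /(_ _ e0)[N _ /(_ N (leqnn _))].
rewrite sub0r normrN ger0_norm ?exprn_ge0 ?ltW// => h.
exists N; rewrite ltr_pdivlMr in h; last by lra.
by have := exprn_gt0 N th0; nra.
Qed.

(** If [x] violated the bound, a geometrically weighted sum of copies of [x],
    with period [n + 1], would violate it on the half line for the coefficients
    [t] continued periodically: row [n], between two copies, is where the couplings
    of neighbouring copies have to cancel. *)
Lemma section_LB_oriented c U V W t n K x b : bdd3 c U V W -> 0 <= K ->
  (forall t', Mt U V W t' -> LB p DN t' K) -> Mt U V W t -> (0 < n)%N ->
  supp (Df n) x -> lpx p x ->
  modulus (lo t n * x (n%:Z - 1)) <= modulus (up t n * x 0) ->
  nle p (compr (Df n) t x) b -> nle p x (K * b).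
Proof.
move=> bd K0 lbN tM n0 xD xl hr xb; have c0 := bdd3_ge0 bd.
have b0 := nle_ge0 p1 xb.
have [xN xmin] := nrmP p1 xl; set N := nrm p x in xN xmin.
have N0 := nle_ge0 p1 xN.
apply: nle_trans xN _; rewrite leNgt; apply/negP => KbN.
have Np : 0 < N by apply: le_lt_trans KbN; exact: mulr_ge0.
pose eta := b / N; have eta0 : 0 <= eta by rewrite divr_ge0.
have Ke : K * eta < 1 by rewrite /eta mulrA ltr_pdivrMr// mul1r.
(* The damping: small enough for the error that it causes in the gap rows to use
   only half of the available slack [1 - K eta]. *)
pose del := (1 - K * eta) / (2 * (K * c + 1)).
have Kc : 0 <= K * c by rewrite mulr_ge0.
have Ke0 : 0 <= K * eta by rewrite mulr_ge0.
have del0 : 0 < del by rewrite divr_gt0//; lra.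
have del1 : del < 1.
  by rewrite ltr_pdivrMr; lra.
have Kcd : K * c * del <= (1 - K * eta) / 2.
  rewrite /del; have -> : K * c * ((1 - K * eta) / (2 * (K * c + 1))) =
    ((1 - K * eta) / 2) * (K * c / (K * c + 1)) by field; lra.
  rewrite ler_piMr//; first lra.
  by rewrite ler_pdivrMr; lra.
pose th := 1 - del.
have th1 : 0 < th < 1 by rewrite /th; lra.
pose a := lo t n * x (n%:Z - 1); pose w0 := up t n * x 0.
(* Makes the right coupling of a copy cancel the left one of the next copy. *)
pose rho := - a / w0.
have rw : rho * w0 = - a.
  rewrite /rho; have [w00|w00] := eqVneq w0 0; last by rewrite divfK.
  move: hr; rewrite -/a -/w0 w00 md0 => a0.
  suff -> : a = 0 by rewrite oppr0 mul0r mulr0.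
  by apply/eqP; rewrite -md_eq0 eq_le a0 md_ge0.
have rho1 : modulus rho <= 1.
  rewrite /rho mdM mdV mdN; have [w00|w00] := eqVneq (modulus w0) 0.
    by rewrite w00 invr0 mulr0.
  by rewrite ler_pdivrMr ?mul1r// lt_def w00 md_ge0.
pose la := rho * th%:C%C.
have lath : modulus la <= th.
  rewrite mdM mdR ger0_norm; last by lra.
  by rewrite ler_piMl//; lra.
pose P := n.+1.
pose t' := Coef (fun i => lo t (i %% P%:Z)%Z) (fun i => di t (i %% P%:Z)%Z)
                (fun i => up t (i %% P%:Z)%Z).
have t'M : Mt U V W t' by move=> i; exact: tM.
pose y := compr (Df n) t x.
pose X := shiftsum x la P; pose Y := shiftsum y la P.
pose E := shiftsum (fun i => (1 - th)%:C%C * a * delta n i) la P.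
have x_out i : (i < 0) || (n%:Z <= i) -> x i = 0.
  by move=> h; apply: xD; rewrite /Df; ilia.
(* Outside [0, n) the image of [x] consists of the two couplings. *)
have tx i : tri t' x i = y i + a * delta n i + w0 * delta (-1) i.
  rewrite /y /compr /dcut /delta /Df.
  have [/andP[i0 iN]|h] := boolP (_ && _).
    have -> : (i == n%:Z) = false by ilia.
    have -> : (i == -1) = false by ilia.
    rewrite !mulr0 !addr0 /tri /= modz_small//; ilia.
  have [->|iN] := eqVneq i n%:Z.
    have -> : (n%:Z == -1) = false by ilia.
    rewrite /tri /= modz_small; last by ilia.
    rewrite (x_out n) ?(x_out (n%:Z + 1)); [|ilia|ilia].
    by rewrite /a; ring.
  have [->|i1] := eqVneq i (-1).
    have e : (-1 %% P%:Z)%Z = n%:Z.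
      rewrite (_ : -1 = (-1) * P%:Z + n%:Z); last by rewrite /P; ilia.
      by rewrite modzMDl modz_small//; rewrite /P; ilia.
    rewrite /tri /= e.
    rewrite (x_out (-1 - 1)) ?(x_out (-1)); [|ilia|ilia].
    by rewrite addNr /w0; ring.
  by rewrite /tri !x_out ?mulr0 ?addr0//; ilia.
have tper (z : int -> C) i : tri t' (fun j => z (j + - P%:Z)) i = tri t' z (i + - P%:Z).
  rewrite /tri /= (_ : ((i + - P%:Z) %% P%:Z)%Z = (i %% P%:Z)%Z); last first.
    by rewrite (_ : i + - P%:Z = (-1) * P%:Z + i) ?modzMDl//; ring.
  have -> : i - 1 + - P%:Z = i + - P%:Z - 1 by ring.
  by have -> : i + 1 + - P%:Z = i + - P%:Z + 1 by ring.
(* The couplings leave the damping error [E], the first left coupling, which the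
   half line cuts off, and a term at the end that decays with [m]. *)
have TX m i : tri t' (X m) i = Y m i + E m i + w0 * delta (-1) i -
    w0 * la ^+ m * delta ((m * P)%N%:Z - 1) i.
  elim: m i => [|m ih] i; first by rewrite /tri /= !mulr0 mul0n sub0r; ring.
  have -> : tri t' (X m.+1) i = tri t' x i + la * tri t' (X m) (i + - P%:Z).
    by rewrite -tper -triZ -triD.
  rewrite tx ih /=.
  have -> : delta (-1) (i + - P%:Z) = delta n i :> C.
    by rewrite /delta; congr (if _ then _ else _); rewrite /P; ilia.
  have -> : delta ((m * P)%N%:Z - 1) (i + - P%:Z) = delta ((m.+1 * P)%N%:Z - 1) i :> C.
    by rewrite /delta; congr (if _ then _ else _); rewrite mulSn; ilia.
  have -> : a = - (rho * w0) by rewrite rw opprK.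
  have thE (u : R) : (1 - u)%:C%C = 1 - u%:C%C :> C by rewrite rmorphB rmorph1.
  by rewrite thE exprS /la; ring.
have Xneg m i : i < 0 -> X m i = 0.
  elim: m i => // m ih i i0 /=; rewrite x_out ?i0// ih ?mulr0 ?addr0//; ilia.
have Yneg m i : i < 0 -> Y m i = 0.
  elim: m i => // m ih i i0 /=; rewrite ih ?mulr0 ?addr0; last by ilia.
  by rewrite /y /compr supp_cut// /Df; ilia.
have Eneg m i : i < n%:Z -> E m i = 0.
  elim: m i => // m ih i i0 /=; rewrite ih ?mulr0 ?addr0; last by ilia.
  by rewrite /delta (_ : (i == n%:Z) = false) ?mulr0//; ilia.
have Xbig m i : (m * P)%N%:Z <= i -> X m i = 0.
  elim: m i => // m ih i i0 /=; rewrite x_out ?ih ?mulr0 ?addr0//; last first.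
    by move: i0; rewrite mulSn; ilia.
  by move: i0; rewrite mulSn; ilia.
have domXY m : dom p eta (X m) (Y m).
  elim: m => [|m ih] /=.
    move=> e he; apply: nle_trans (nle_0 p1) _.
    by rewrite mulr_ge0// (nle_ge0 p1 he).
  apply: dom_disj => //.
  - move=> i; have [i0|i0] := ltP i n%:Z; last by left; apply: x_out; rewrite i0 orbT.
    by right; rewrite Xneg ?mulr0//; ilia.
  - move=> i; have [i0|i0] := ltP i n%:Z.
      by right; rewrite Yneg ?mulr0//; ilia.
    by left; rewrite /y /compr supp_cut// /Df; ilia.
  - exists (window (m.+1 * P)) => i; rewrite mem_window mulSn => h; split.
      by apply: x_out; ilia.
    have [i0|i0] := ltP i 0; first by rewrite Xneg ?mulr0//; ilia.
    by rewrite Xbig ?mulr0//; ilia.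
  - move=> e he; apply: nle_trans xb _; rewrite /eta mulrAC ler_pdivlMr//.
    by rewrite ler_wpM2l// xmin.
  exact: dom_scale_sh.
have EX m i : modulus (E m i) <= del * c * modulus (X m (i - 1)).
  elim: m i => [|m ih] i.
    have -> : E 0%N i = 0 by [].
    have -> : X 0%N (i - 1) = 0 by [].
    by rewrite md0 mulr0.
  have dc0 : 0 <= del * c by rewrite mulr_ge0// ltW.
  have [->|iN] := eqVneq i n%:Z.
    rewrite /= Eneg; last by ilia.
    rewrite Xneg; last by ilia.
    rewrite !mulr0 !addr0 /delta eqxx mulr1 mdM mdR /th opprB addrC subrK.
    rewrite ger0_norm ?(ltW del0)// -mulrA ler_pM2l// /a mdM ler_wpM2r ?md_ge0//.
    by case: (bdd3_bnd bd tM n%:Z).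
  rewrite /= {1}/delta (negPf iN) mulr0 add0r.
  have [i0|i0] := ltP i n%:Z.
    have -> : E m (i + - P%:Z) = 0 by apply: Eneg; ilia.
    by rewrite mulr0 md0; apply: mulr_ge0 => //; exact: md_ge0.
  rewrite x_out; last by ilia.
  rewrite add0r (mdM la) (mdM la) mulrCA; apply: ler_wpM2l; first exact: md_ge0.
  by have -> : i - 1 + - P%:Z = i + - P%:Z - 1 by ring.
have [m hm] : exists m : nat, (K * modulus w0) * th ^+ m < (1 - K * eta) / 2 * N.
  by apply: geom_small => //; [rewrite mulr_gt0//; lra | rewrite mulr_ge0 ?md_ge0].
have Xfs : finsupp (X m.+1).
  exists (m.+1 * P)%N => i ni; have [i0|i0] := ltP i 0; first exact: Xneg.
  by apply: Xbig; ilia.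
have Xl := finsupp_lpx p1 Xfs.
have [XN Xmin] := nrmP p1 Xl; set L := nrm p (X m.+1) in XN Xmin.
have NL : N <= L.
  apply: xmin; apply: nle_solid XN => // i.
  have [i0|i0] := ltP i n%:Z; last by rewrite x_out ?md0 ?md_ge0 ?i0 ?orbT.
  by rewrite /= Xneg ?mulr0 ?addr0//; ilia.
have hT : nle p (compr DN t' (X m.+1)) (eta * L + del * c * L + modulus w0 * th ^+ m).
  have h1 := domXY m.+1 _ XN.
  have h2 : nle p (E m.+1) (del * c * L).
    have := @nle_reidx _ _ p1 _ _ (fun i => i - 1) (addIr _) XN.
    by apply: nle_scale => //; rewrite mulr_ge0// ltW.
  have h3 : nle p (fun i => - w0 * la ^+ m.+1 * delta ((m.+1 * P)%N%:Z - 1) i)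
     (modulus w0 * th ^+ m * 1).
    apply: nle_scale (nle_delta p1 ((m.+1 * P)%N%:Z - 1)) => // [|i].
      by rewrite mulr_ge0 ?md_ge0// exprn_ge0//; lra.
    rewrite mdM; apply: ler_wpM2r; first exact: md_ge0.
    rewrite (mdM (- w0)) mdN; apply: ler_wpM2l; first exact: md_ge0.
    have mX k : modulus (la ^+ k) <= th ^+ k.
      elim: k => [|k ih]; first by rewrite !expr0 md1.
      by rewrite !exprS mdM ler_pM ?md_ge0.
    apply: le_trans (mX _) _; rewrite exprS ler_piMl ?exprn_ge0//; lra.
  have := nle_cut p1 DN (nle_add p1 (nle_add p1 h1 h2) h3); rewrite mulr1.
  apply: nle_solid => // i; rewrite /compr /dcut; case: ifP => // i0.
  have dm : delta (-1) i = 0 :> C.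
    by rewrite /delta (_ : (i == -1) = false)//; move: i0; rewrite /DN; ilia.
  by rewrite TX dm mulr0 addr0 !mulNr.
have XND : supp DN (X m.+1) by move=> i; rewrite /DN -ltNge => /Xneg.
have := Xmin _ (lbN _ t'M _ XND Xl _ hT).
rewrite !mulrDr => hL.
have e1 : K * (eta * L) = K * eta * L by rewrite mulrA.
have e2 : K * (del * c * L) <= (1 - K * eta) / 2 * L.
  have -> : K * (del * c * L) = K * c * del * L by ring.
  by rewrite ler_wpM2r// (le_trans N0).
have e3 : (1 - K * eta) / 2 * N <= (1 - K * eta) / 2 * L.
  by rewrite ler_wpM2l//; lra.
rewrite e1 mulrA in hL.
have : L <= K * eta * L + (1 - K * eta) / 2 * L + K * modulus w0 * th ^+ m by lra.
nra.
Qed.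

End Whole.

(** * Finite sections *)
Section Finite.
Context {R : realType}.
Local Notation C := (Cplx R).
Implicit Types (x y g h : int -> C) (D : int -> bool) (t : @coef R) (U V W : set C).
Variables (p : \bar R) (p1 : (1 <= p)%E).

(** The coupling to the left of [x] or the one to its right is the larger one;
    in the second case everything is reflected. *)
Lemma section_LB c U V W t n K : bdd3 c U V W -> 0 <= K ->
  (forall t', Mt U V W t' -> LB p DN t' K) ->
  (forall t', Mt W V U t' -> LB p DN t' K) ->
  Mt U V W t -> (0 < n)%N -> LB p (Df n) t K.
Proof.
move=> bd K0 lb1 lb2 tM n0 x xD xl b xb.
have [h|h] := leP (modulus (lo t n * x (n%:Z - 1))) (modulus (up t n * x 0)).
  exact: (section_LB_oriented p1 bd K0 lb1 tM n0 xD xl h xb).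
(* Row -1 becomes row [n] of the reflected operator, the gap row that decides
   about the direction, and does not meet the section. *)
pose t2 := Coef (fun i => if i == -1 then lo t n else lo t i) (di t)
                (fun i => if i == -1 then up t n else up t i).
have t2M : Mt U V W t2.
  move=> i; case: (tM i) (tM n) => ? ? ? [? ? ?].
  by rewrite /t2 /=; case: eqP.
pose t3 := rf (sh (n%:Z - 1) t2).
have t3M : Mt W V U t3 by apply/Mt_rf/Mt_sh.
pose f (i : int) : int := n%:Z - 1 - i.
have fK : cancel f f by move=> i; rewrite /f; ring.
have lf y a : lpx p y -> nle p y a -> nle p (fun i => y (f i)) a.
  by move=> _; apply: nle_reidx => //; exact: can_inj fK.
pose z i := x (f i).
have zD : supp (Df n) z.
  by move=> i Di; apply: xD; move: Di; rewrite /Df /f; ilia.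
have zl : lpx p z by case: (xl) => a ha; exists a; exact: lf.
have zE i : compr (Df n) t3 z i = compr (Df n) t x (f i).
  rewrite /compr /dcut (_ : Df n (f i) = Df n i); last by rewrite /Df /f; ilia.
  case: ifPn => // /andP[i0 iN].
  rewrite /tri /z /t3 /rf /sh /t2 /=.
  have -> : - i + (n%:Z - 1) = f i by rewrite /f; ring.
  have -> : f (i - 1) = f i + 1 by rewrite /f; ring.
  have -> : f (i + 1) = f i - 1 by rewrite /f; ring.
  have fi : (f i == -1) = false by rewrite /f; ilia.
  by rewrite fi; ring.
have zb : nle p (compr (Df n) t3 z) b.
  have := @nle_reidx _ _ p1 _ _ f (can_inj fK) xb.
  by apply: nle_solid => // i; rewrite zE.
have hz : modulus (lo t3 n * z (n%:Z - 1)) <= modulus (up t3 n * z 0).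
  rewrite /t3 /z /rf /sh /t2 /=.
  have -> : - n%:Z + (n%:Z - 1) = -1 by ring.
  rewrite eqxx /f subrr subr0; exact: ltW.
have := section_LB_oriented p1 (bdd3_tr bd) K0 lb2 t3M n0 zD zl hz zb.
move=> /(@nle_reidx _ _ p1 _ _ f (can_inj fK)).
by apply: nle_solid => // i; rewrite /z fK.
Qed.

Lemma compr_sum D t (J : Type) (r : seq J) (a : J -> C) (v : J -> int -> C) i :
  compr D t (fun k => \sum_(j <- r) a j * v j k) i =
  \sum_(j <- r) a j * compr D t (v j) i.
Proof.
elim: r => [|j r ih].
  rewrite big_nil; under [in LHS]eq_fun do rewrite big_nil; exact: compr0.
rewrite big_cons -ih -comprZ -comprD.
by congr (compr _ _ _ _); apply/funext => k; rewrite big_cons.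
Qed.

(** The transpose of the section, acting on row vectors. *)
Definition section_matrix n t : 'M[C]_n := \matrix_(i < n, j < n) compr (Df n) t (delta i) j.
Definition vec n (v : 'rV[C]_n) : int -> C :=
  fun k => \sum_(j < n) v 0 j * delta j k.

Lemma vec_ord n (v : 'rV[C]_n) (i : 'I_n) : vec v i = v 0 i.
Proof.
rewrite /vec (bigD1 i)//= /delta eqxx mulr1 big1 ?addr0// => j ji.
rewrite (_ : (i%:Z == j%:Z) = false) ?mulr0//.
by apply/negbTE; apply: contra ji => /eqP[/ord_inj->].
Qed.

Lemma vec_supp n (v : 'rV[C]_n) : supp (Df n) (vec v).
Proof.
move=> k Dk; rewrite /vec big1// => j _; rewrite /delta.
case: eqP => [kj|_]; last by rewrite mulr0.
by move: Dk; rewrite kj /Df; have := ltn_ord j; ilia.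
Qed.

Lemma vec_ex n x : supp (Df n) x -> exists v : 'rV[C]_n, x = vec v.
Proof.
move=> xD; exists (\row_j x j%:Z); apply/funext => k.
have [/andP[k0 kn]|Dk] := boolP (Df n k); last by rewrite vec_supp// xD.
have kn' : (absz k < n)%N by ilia.
have kE : k = Ordinal kn' by rewrite /=; ilia.
by rewrite [in RHS]kE vec_ord mxE -kE.
Qed.

Lemma compr_vec n t (v : 'rV[C]_n) : compr (Df n) t (vec v) = vec (v *m section_matrix n t).
Proof.
apply/funext => k; rewrite /vec.
have [/andP[k0 kn]|Dk] := boolP (Df n k); last first.
  by rewrite /compr supp_cut// -[RHS]/(vec _ k) vec_supp.
have kn' : (absz k < n)%N by ilia.
have kE : k = Ordinal kn' by rewrite /=; ilia.
rewrite -[RHS]/(vec _ k) kE vec_ord mxE compr_sum.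
by apply: eq_bigr => j _; rewrite mxE.
Qed.

Lemma vec_lpx n (v : 'rV[C]_n) : lpx p (vec v).
Proof.
apply: finsupp_lpx => //; exists n => i ni; apply: vec_supp; rewrite /Df; ilia.
Qed.

(** In finite dimension injectivity is enough. *)
Lemma finite_sur n t K : LB p (Df n) t K -> Sur p (Df n) t.
Proof.
move=> lb y yD _; have [w ->] := vec_ex yD.
have uA : section_matrix n t \in unitmx.
  rewrite -row_free_unit -kermx_eq0; apply/eqP/row_matrixP => i; rewrite row0.
  set v := row i _.
  have vA : v *m section_matrix n t = 0 by apply/sub_kermxP; exact: row_sub.
  have v0 : forall k, vec v k = 0.
    apply: (LB_inj p1 lb); [exact: vec_supp|exact: vec_lpx|move=> k].
    by rewrite compr_vec vA /vec big1// => j _; rewrite mxE mul0r.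
  apply/rowP => j; have e : v 0 j = 0 by rewrite -vec_ord v0.
  by rewrite e [RHS]mxE.
exists (vec (w *m invmx (section_matrix n t))); split.
- exact: vec_supp.
- exact: vec_lpx.
by move=> i; rewrite compr_vec mulmxKV.
Qed.

(** The operator minus [z] times the identity. *)
Definition ts (z : C) t := Coef (lo t) (fun i => di t i - z) (up t).

Lemma ts0 t : ts 0 t = t.
Proof. by case: t => l d u; rewrite /ts /=; congr Coef; apply/funext => i; rewrite subr0. Qed.

Lemma tri_ts z t x i : tri (ts z t) x i = tri t x i - z * x i.
Proof. by rewrite /tri /=; ring. Qed.

Lemma compr_ts D z t x i : supp D x ->
  compr D (ts z t) x i = compr D t x i - z * x i.
Proof.
by move=> xD; rewrite /compr /dcut tri_ts; case: ifPn => // Di; rewrite xD// mulr0 subr0.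
Qed.

Lemma section_eigenvector n t : (0 < n)%N -> exists z : C, exists x, [/\ supp (Df n) x, lpx p x,
  forall i, compr (Df n) (ts z t) x i = 0 & exists i, x i != 0].
Proof.
move=> n0; have : size (char_poly (section_matrix n t)) != 1%N.
  by rewrite size_char_poly; ilia.
move/closed_rootP => [z]; rewrite -eigenvalue_root_char => /eigenvalueP[v vz v0].
exists z, (vec v); split; [exact: vec_supp|exact: vec_lpx| |].
  move=> i; rewrite compr_ts; last exact: vec_supp.
  rewrite compr_vec vz /vec mulr_sumr -sumrB big1// => j _.
  by rewrite mxE; ring.
have /rV0Pn[j vj] := v0; exists j; rewrite vec_ord//.
Qed.

End Finite.

(** * Cases in which the half line is no worse than the integers *)
Section Favourable.
Context {R : realType}.
Local Notation C := (Cplx R).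
Implicit Types (x y g h : int -> C) (D : int -> bool) (t : @coef R) (U V W : set C).

(** Favourability in terms of bounds: those valid on the integers are valid on the
    half line. *)
Definition fav p U V W := forall K : R, 0 <= K ->
  (forall t, Mt U V W t -> linv p DZ t K) -> forall t, Mt U V W t -> linv p DN t K.

Lemma fav_LB p U V W : (1 <= p)%E ->
  (exists c, bdd3 c U V W) ->
  (forall t, Mt U V W t -> expinv DN t) ->
  (forall K : R, 0 <= K -> (forall t, Mt U V W t -> linv p DZ t K) ->
     forall t, Mt U V W t -> LB p DN t K) -> fav p U V W.
Proof.
move=> p1 [c bd] Nd h K K0 ZI t tM; split; first exact: h.
by case: (expinv_linv p1 (bdd3_ge0 bd) (bdd3_bnd bd tM) (Nd t tM)) => K' _ [].
Qed.

(** Putting 0 in place of the entry that couples row -1 to the half line lets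
    extension by zero preserve the image. *)
Lemma fav_W0 p U V W : (1 <= p)%E -> (exists c, bdd3 c U V W) ->
  (forall t, Mt U V W t -> expinv DN t) -> W 0 -> fav p U V W.
Proof.
move=> p1 bd Nd W0; apply: fav_LB => // K K0 ZI t tM x xN xl b xb.
pose t' := Coef (lo t) (di t) (fun i => if i == -1 then 0 else up t i).
have t'M : Mt U V W t' by move=> i; case: (tM i) => ? ? ?; rewrite /t' /=; case: eqP.
have [lb _] := ZI _ t'M; apply: (lb x (@suppZ _ x) xl).
apply: nle_solid xb => // i; rewrite comprDZ /compr /dcut /tri /=.
have [->|i1] := eqVneq i (-1).
  by rewrite !(xN (-1)) ?(xN (-1 - 1)) ?mul0r ?mulr0 ?addr0//.
case: ifPn => // i0.
have z1 : x (i - 1) = 0 by apply: xN; rewrite /DN; move: i0; rewrite /DN; ilia.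
have z2 : x i = 0 by exact: xN.
have z3 : x (i + 1) = 0 by apply: xN; move: i0; rewrite /DN; ilia.
by rewrite z1 z2 z3 !mulr0 !addr0.
Qed.

(** Now the coupling into row 0 is put to 0; on the left a solution [h] of the
    transposed, reflected equation is attached that cancels the coupling of
    row -1 to [x 0].  The extended vector is at least as long as [x] and its image
    is no longer. *)
Lemma fav_U0 p U V W : (1 <= p)%E -> (exists c, bdd3 c U V W) ->
  (forall t, Mt U V W t -> expinv DN t) -> U 0 -> fav p U V W.
Proof.
move=> p1 [c bd] Nd U0; apply: fav_LB => //; first by exists c.
move=> K K0 ZI t tM x xN xl b xb.
pose t2 := tr t; have t2M : Mt W V U t2 by exact: Mt_tr.
have [K' _ [_ t2S]] := expinv_linv p1 (bdd3_ge0 bd) (bnd_tr (bdd3_bnd bd tM)) (expinv_tr (Nd t tM)).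
have dl (a : C) : supp DN (fun j => a * delta 0 j) /\ lpx p (fun j => a * delta 0 j).
  split; last by apply: lpx_scale => //; exact: lpx_delta.
  by move=> j; rewrite /DN /delta; case: eqP => [->//|_]; rewrite mulr0.
have [h [hN hl hE]] := t2S _ (dl (- (lo t2 0 * x 0))).1 (dl _).2.
pose t' := Coef (fun i => if i == 0 then 0 else if 0 <= i then lo t i else up t2 (- i - 1))
  (fun i => if 0 <= i then di t i else di t2 (- i - 1))
  (fun i => if 0 <= i then up t i else lo t2 (- i - 1)).
have t'M : Mt U V W t'.
  move=> i; case: (tM i) (t2M (- i - 1)) => ? ? ? [? ? ?]; rewrite /t' /=.
  by case: eqP => _; case: ifP.
pose x' i := if 0 <= i then x i else gluel h i.
have x'l : lpx p x'.
  case: xl => a ha; case: hl => a' ha'.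
  exists (a + a'); apply: nle_solid (nle_add p1 ha (nle_gluel p1 ha')) => // i.
  rewrite /x'; case: ifPn => i0; last by rewrite xN ?add0r.
  by rewrite /gluel (_ : (i < 0) = false) ?addr0//; ilia.
have [lb _] := ZI _ t'M.
have /lb-/(_ (@suppZ _ x') x'l) : nle p (compr DZ t' x') b.
  apply: nle_solid xb => // i; rewrite comprDZ.
  suff -> : tri t' x' i = compr DN t x i by [].
  rewrite /compr /dcut /DN; case: ifPn => i0.
    rewrite /tri /t' /x' /= i0 (_ : 0 <= i + 1); last by ilia.
    have [->|iN] := eqVneq i 0.
      have -> : x (0 - 1) = 0 by apply: xN.
      by rewrite mul0r mulr0.
    by rewrite (_ : 0 <= i - 1)//; ilia.
  have iN : (i == 0) = false by ilia.
  have h0 := hE (- i - 1); rewrite /compr /dcut /DN (_ : 0 <= - i - 1) in h0; last by ilia.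
  rewrite /tri /t' /x' /= iN (negPf i0) (_ : (0 <= i - 1) = false); last by ilia.
  rewrite /gluel (_ : i - 1 < 0); last by ilia.
  rewrite (_ : i < 0); last by ilia.
  have -> : - (i - 1) - 1 = - i - 1 + 1 by ring.
  move: h0; rewrite /tri /delta; case: eqP => i1 h0.
    have -> : 0 <= i + 1 by ilia.
    have -> : i + 1 = 0 by ilia.
    rewrite i1 in h0 *; rewrite (hN (0 - 1))// mulr0 add0r mulr1 in h0.
    have h1 : di t2 0 * h 0 + up t2 0 * h (0 + 1) = - (lo t2 0 * x 0) by exact: h0.
    have -> : up t2 0 * h (0 + 1) + di t2 0 * h 0 + lo t2 0 * x 0 =
      (di t2 0 * h 0 + up t2 0 * h (0 + 1)) + lo t2 0 * x 0 by ring.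
    by rewrite h1 addNr.
  have -> : (0 <= i + 1) = false by ilia.
  rewrite (_ : i + 1 < 0); last by ilia.
  have -> : - (i + 1) - 1 = - i - 1 - 1 by ring.
  have h1 : lo t2 (- i - 1) * h (- i - 1 - 1) + di t2 (- i - 1) * h (- i - 1) +
    up t2 (- i - 1) * h (- i - 1 + 1) = 0 by move: h0; rewrite mulr0.
  by rewrite -h1 /t2 /tr /=; ring.
apply: nle_solid => // i; rewrite /x'; case: ifPn => // i0.
by rewrite xN// md0 md_ge0.
Qed.

(** Almost minimizing vectors [x] for [t] and [y] for [a] are glued with a zero
    between them.  The image of the glued vector has the two images as disjoint
    parts, once the coefficients are chosen so that row 0 vanishes. *)
Lemma glue_LB p U V W K t a : (1 <= p)%E -> 0 <= K -> (exists c, bdd3 c U V W) ->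
  (forall t, Mt U V W t -> linv p DZ t K) ->
  Mt U V W t -> Mt W V U a -> LB p DN t K \/ LB p DN a K.
Proof.
move=> p1 K0 [c bd] ZI tM aM.
have [h|nl] := pselect (LB p DN t K); [by left | right].
apply: (LB_finsupp p1 K0 (bdd3_bnd (bdd3_tr bd) aM)) => y yN yfs b' yb.
have b'0 := nle_ge0 p1 yb.
have yl := finsupp_lpx p1 yfs; have [yN' ymin] := nrmP p1 yl.
apply: nle_trans yN' _; rewrite leNgt; apply/negP => hy.
apply: nl; apply: (LB_finsupp p1 K0 (bdd3_bnd bd tM)) => x xN xfs b xb.
have b0 := nle_ge0 p1 xb.
have xl := finsupp_lpx p1 xfs; have [xN' xmin] := nrmP p1 xl.
apply: nle_trans xN' _; rewrite leNgt; apply/negP => hx.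
set Nx := nrm p x in xmin hx; set Ny := nrm p y in ymin hy.
have Nx0 : 0 < Nx by apply: le_lt_trans hx; exact: mulr_ge0.
have Ny0 : 0 < Ny by apply: le_lt_trans hy; exact: mulr_ge0.
(* The worse of the two ratios between image and vector, still below [1 / K]. *)
pose eta := Num.max (b / Nx) (b' / Ny).
have eta0 : 0 <= eta by rewrite le_max divr_ge0// ltW.
have Ke : K * eta < 1.
  rewrite /eta; case: (leP (b / Nx) (b' / Ny)) => _.
    by rewrite mulrA ltr_pdivrMr ?mul1r.
  by rewrite mulrA ltr_pdivrMr ?mul1r.
have dx : dom p eta x (compr DN t x).
  move=> e he; apply: nle_trans xb _.
  apply: (@le_trans _ _ (b / Nx * e)).
    by rewrite mulrAC ler_pdivlMr// ler_wpM2l// xmin.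
  by rewrite ler_wpM2r ?(nle_ge0 p1 he)// le_max lexx.
have dy : dom p eta y (compr DN a y).
  move=> e he; apply: nle_trans yb _.
  apply: (@le_trans _ _ (b' / Ny * e)).
    by rewrite mulrAC ler_pdivlMr// ler_wpM2l// ymin.
  by rewrite ler_wpM2r ?(nle_ge0 p1 he)// le_max lexx orbT.
have key al be : al * (lo t (-1) * y 0) + be * (up t (-1) * x 0) = 0 ->
    forall i, al * gluel y i + be * gluer x i = 0.
  move=> e; pose X i := al * gluel y i + be * gluer x i.
  pose T i := al * gluel (compr DN a y) i + be * gluer (compr DN t x) i.
  have TE i : tri (zglue a t) X i = T i.
    rewrite triD !triZ tri_gluel// tri_gluer// /T /gluel /gluer /compr /dcut /DN.
    have [->|iN] := eqVneq i 0; first by rewrite /= !mulr0 addr0.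
    have [i0|i0] := ltP i 0.
      have e1 : (0 < i) = false by ilia.
      have e2 : 0 <= - i - 1 by ilia.
      by rewrite e1 e2.
    have e1 : 0 < i by ilia.
    have e2 : 0 <= i - 1 by ilia.
    by rewrite e1 e2.
  have dG (u v : int -> C) : dom p eta u v -> supp DN u -> dom p eta (gluer u) (gluer v).
    move=> d uN e' he.
    have hu : nle p u e'.
      have := @nle_reidx _ _ p1 _ _ (fun i => i + 1) (addIr _) he.
      apply: nle_solid => // i; rewrite /gluer addrK; case: ifPn => // i0.
      by rewrite uN//; rewrite /DN; ilia.
    exact: nle_gluer (d _ hu).
  have dGl (u v : int -> C) : dom p eta u v -> supp DN u -> dom p eta (gluel u) (gluel v).
    move=> d uN e' he.
    have hu : nle p u e'.
      have fi : injective (fun i : int => - i - 1) by move=> i j; ilia.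
      have := @nle_reidx _ _ p1 _ _ _ fi he.
      apply: nle_solid => // i; rewrite /gluel.
      have -> : - (- i - 1) - 1 = i by ring.
      case: ifPn => // i0.
      by rewrite uN//; rewrite /DN; ilia.
    exact: nle_gluel (d _ hu).
  have d0 (u v : int -> C) (k : C) : dom p eta u v ->
      dom p eta (fun i => k * u i) (fun i => k * v i).
    move=> /(dom_scale_sh p1 (a := k) (k := 0) eta0) d e' he.
    have : nle p (fun i => k * u (i + 0)) e'.
      by apply: nle_solid he => // i; rewrite addr0.
    by move/d; apply: nle_solid => // i; rewrite addr0.
  have dXT : dom p eta X T.
    apply: dom_disj => //.
    - move=> i; rewrite /gluel /gluer; case: ltP => i0; last by left; rewrite mulr0.
      by right; rewrite (_ : (0 < i) = false) ?mulr0//; ilia.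
    - move=> i; rewrite /gluel /gluer; case: ltP => i0; last by left; rewrite mulr0.
      by right; rewrite (_ : (0 < i) = false) ?mulr0//; ilia.
    - case: xfs => L1 h1; case: yfs => L2 h2; exists (window (L1 + L2).+1) => i.
      rewrite mem_window /gluel /gluer => hi; split.
        case: ifP => _; last by rewrite mulr0.
        by rewrite h2 ?mulr0//; ilia.
      case: ifP => _; last by rewrite mulr0.
      by rewrite h1 ?mulr0//; ilia.
    - by apply: d0; exact: dGl.
    by apply: d0; exact: dG.
  have Xl : lpx p X.
    apply: lpx_add => //; apply: lpx_scale => //.
      by case: yl => B hB; exists B; exact: nle_gluel.
    by case: xl => B hB; exists B; exact: nle_gluer.
  have [XN Xmin] := nrmP p1 Xl.
  have [lb _] := ZI _ (Mt_zglue aM tM).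
  have hT : nle p (compr DZ (zglue a t) X) (eta * nrm p X).
    by apply: nle_solid (dXT _ XN) => // i; rewrite comprDZ TE.
  have := Xmin _ (lb X (@suppZ _ X) Xl _ hT); rewrite mulrA => hX.
  have N0 := nle_ge0 p1 XN.
  have NE : nrm p X = 0 by nra.
  move=> i; apply/eqP; rewrite -md_eq0 eq_le md_ge0 andbT.
  by have := nle_pt p1 i XN; rewrite NE.
have nz (u : int -> C) : lpx p u -> 0 < nrm p u -> supp DN u -> exists2 i, 0 <= i & u i != 0.
  move=> ul u0 uN; apply: contrapT => h.
  have uz i : u i = 0.
    have [i0|i0] := boolP (DN i); last exact: uN.
    by apply: contrapT => ui; apply: h; exists i => //; apply/eqP.
  have [_ umin] := nrmP p1 ul; move: u0; rewrite ltNge => /negP; apply.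
  by apply: umin; apply: nle_solid (nle_0 p1) => // i; rewrite uz.
have [i i0 xi] := nz x xl Nx0 xN.
have [j j0 yj] := nz y yl Ny0 yN.
have be0 al be : al * (lo t (-1) * y 0) + be * (up t (-1) * x 0) = 0 -> be = 0.
  move=> /key/(_ (i + 1)); rewrite /gluel /gluer.
  rewrite (_ : 0 < i + 1); last by ilia.
  rewrite (_ : (i + 1 < 0) = false); last by ilia.
  by rewrite mulr0 add0r addrK => /eqP; rewrite mulf_eq0 (negPf xi) orbF => /eqP.
have al0 al be : al * (lo t (-1) * y 0) + be * (up t (-1) * x 0) = 0 -> al = 0.
  move=> /key/(_ (- j - 1)); rewrite /gluel /gluer.
  rewrite (_ : (0 < - j - 1) = false); last by ilia.
  rewrite (_ : - j - 1 < 0); last by ilia.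
  rewrite mulr0 addr0 (_ : - (- j - 1) - 1 = j); last by ring.
  by move=> /eqP; rewrite mulf_eq0 (negPf yj) orbF => /eqP.
have [e|e] := eqVneq (up t (-1) * x 0) 0.
  have := be0 0 1; rewrite e mulr0 mul0r addr0 => /(_ erefl)/eqP.
  by rewrite oner_eq0.
have := al0 (up t (-1) * x 0) (- (lo t (-1) * y 0)).
have -> : up t (-1) * x 0 * (lo t (-1) * y 0) +
  - (lo t (-1) * y 0) * (up t (-1) * x 0) = 0 by ring.
by move=> /(_ erefl)/eqP; rewrite (negPf e).
Qed.

Lemma fav_sym p U V : (1 <= p)%E -> (exists c, bdd3 c U V U) ->
  (forall t, Mt U V U t -> expinv DN t) -> fav p U V U.
Proof.
move=> p1 bd Nd; apply: fav_LB => // K K0 ZI t tM.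
by case: (glue_LB p1 K0 bd ZI tM tM).
Qed.

(** On l^2 the inverses of an operator and of its transpose have the same norm, so
    [a] can be the transpose of [t]. *)
Lemma fav_2 U V W : (exists c, bdd3 c U V W) ->
  (forall t, Mt U V W t -> expinv DN t) -> fav (2%:E : \bar R) U V W.
Proof.
have p1 : (1 <= 2%:E :> \bar R)%E by rewrite lee_fin ler1n.
move=> [c bd] Nd; apply: fav_LB => //; first by exists c.
move=> K K0 ZI t tM; have c0 := bdd3_ge0 bd; have tb := bdd3_bnd bd tM.
case: (glue_LB p1 K0 (ex_intro _ c bd) ZI tM (Mt_tr tM)) => [lb|lb]; first exact: lb.
have [K' _ [_ S]] := expinv_linv p1 c0 (bnd_tr tb) (expinv_tr (Nd t tM)).
rewrite -(trK t); apply: (dual_LB p1 p1 _ K0 (bnd_tr tb)); last by split.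
by rewrite inver pnatr_eq0 /= -EFinD -[2^-1]div1r -splitr.
Qed.

End Favourable.

(** * Averaging over roots of unity *)
Section Fejer.
Context {R : realType}.
Local Notation C := (Cplx R).

Lemma prim_root_ex n : (n > 0)%N -> exists z : C, n.-primitive_root z.
Proof.
pose q : {poly C} := 'X^n - 1; have [r Dp] := closed_field_poly_normal q.
move=> n_gt0; rewrite (monicP _) ?monicXnsubC // scale1r in Dp.
have rn1 : all n.-unity_root r by apply/allP => z; rewrite -root_prod_XsubC -Dp.
have sz_r : (n < (size r).+1)%N.
  by rewrite -(size_prod_XsubC r id) -Dp size_XnsubC.
have [|z _ hz] := hasP (has_prim_root n_gt0 rn1 _ sz_r); last by exists z.
by rewrite -separable_prod_XsubC -Dp separable_Xn_sub_1 // pnatr_eq0 -lt0n.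
Qed.

Lemma sum_root n (xi : C) k : n.-primitive_root xi ->
  \sum_(j < n) xi ^+ (j * k) = if (n %| k)%N then n%:R else 0.
Proof.
move=> hxi; case: ifPn => nk.
  rewrite (eq_bigr (fun=> 1)) ?sumr_const ?card_ord// => j _.
  by apply/eqP; rewrite -(prim_order_dvd hxi) dvdn_mull.
have x1 : xi ^+ k - 1 != 0 by rewrite subr_eq0 -(prim_order_dvd hxi).
apply: (mulfI x1); rewrite mulr0.
rewrite (eq_bigr (fun j : 'I_n => (xi ^+ k) ^+ j)); last first.
  by move=> j _; rewrite mulnC exprM.
by rewrite -subrX1 -exprM mulnC exprM (prim_expr_order hxi) expr1n subrr.
Qed.

Lemma md_root n (xi : C) : n.-primitive_root xi -> modulus xi = 1.
Proof.
move=> hxi; have n0 := prim_order_gt0 hxi.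
have : modulus xi ^+ n = 1.
  rewrite -[RHS](@md1 R) -(prim_expr_order hxi).
  by elim: n {hxi n0} => [|n ih]; rewrite ?expr0 ?md1// !exprS mdM ih.
by move/eqP; rewrite pexpr_eq1 ?md_ge0// => /eqP.
Qed.

Lemma mdX (z : C) n : modulus (z ^+ n) = modulus z ^+ n.
Proof. by elim: n => [|n ih]; rewrite ?expr0 ?md1// !exprS mdM ih. Qed.

Lemma unimod_inv (u : C) : modulus u = 1 -> u + u^-1 = (2 * complex.Re u)%:C%C.
Proof.
case: u => a b /= h.
have ab : a ^+ 2 + b ^+ 2 = 1.
  by rewrite -[LHS]sqr_sqrtr ?addr_ge0 ?sqr_ge0// h expr1n.
have u0 : (a +i* b)%C != 0 :> C.
  by rewrite -md_eq0 /= h oner_eq0.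
apply: (mulfI u0); rewrite mulrDr mulfV//.
apply/eqP; rewrite eq_complex /=; apply/andP; split; apply/eqP.
  have -> : a * (2 * a) - b * 0 = a * a - b * b + (a ^+ 2 + b ^+ 2) by ring.
  by rewrite ab.
by ring.
Qed.

(** The Fejer weight [1 + (u + u^-1) / 2] filters out of a polynomial in [xi ^ j] the
    coefficients with index congruent to -1, 0 or 1 modulo [n]. *)
Lemma fejer n (xi : C) (v : nat -> C) (rho om : C) : (2 < n)%N ->
  n.-primitive_root xi -> om != 0 ->
  \sum_(j < n) (1 + (om * xi ^+ (j * n.-1) + om^-1 * xi ^+ j) / 2) *
     (\sum_(k < n) (rho * xi ^+ j) ^+ k * v k) =
  n%:R * (v 0%N + om / 2 * rho * v 1%N + om^-1 / 2 * rho ^+ n.-1 * v n.-1).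
Proof.
move=> n2 hxi om0.
have n0 : (0 < n)%N by ilia.
rewrite (eq_bigr (fun j : 'I_n => \sum_(k < n) rho ^+ k * v k *
   (xi ^+ (j * k) + om / 2 * xi ^+ (j * (k + n.-1)) + om^-1 / 2 * xi ^+ (j * k.+1)))); last first.
  move=> j _; rewrite mulr_sumr; apply: eq_bigr => k _.
  rewrite exprMn -exprM mulnDr exprD mulnS exprD; ring.
rewrite exchange_big /=.
have E (k : 'I_n) : \sum_(j < n) rho ^+ k * v k *
   (xi ^+ (j * k) + om / 2 * xi ^+ (j * (k + n.-1)) + om^-1 / 2 * xi ^+ (j * k.+1)) =
   (if k == 0%N :> nat then n%:R * v 0%N else 0) +
   (if k == 1%N :> nat then n%:R * (om / 2 * rho * v 1%N) else 0) +
   (if k == n.-1 :> nat then n%:R * (om^-1 / 2 * rho ^+ n.-1 * v n.-1) else 0).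
  rewrite -mulr_sumr !big_split /= -!mulr_sumr !(sum_root _ hxi).
  have kn := ltn_ord k.
  have -> : (n %| k)%N = (k == 0%N :> nat).
    by case: eqP => [->|/eqP k0]; rewrite ?dvdn0// gtnNdvd ?lt0n.
  have -> : (n %| k + n.-1)%N = (k == 1%N :> nat).
    case: eqP => [->|/eqP k0]; first by rewrite add1n prednK ?dvdnn.
    apply/negbTE; have [k00|k1] := posnP k; first by rewrite k00 add0n gtnNdvd//; ilia.
    have -> : (k + n.-1 = k.-1 + n)%N by ilia.
    by rewrite dvdn_addl// gtnNdvd//; ilia.
  have -> : (n %| k.+1)%N = (k == n.-1 :> nat).
    case: eqP => [->|/eqP k0]; first by rewrite prednK ?dvdnn.
    by apply/negbTE; rewrite gtnNdvd//; ilia.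
  case: eqP => [k0|_]; case: eqP => [k1|_]; case: eqP => [kl|_]; try ilia;
    rewrite ?k0 ?k1 -?kl ?expr0 ?expr1; try by ring.
rewrite (eq_bigr _ (fun k _ => E k)) !big_split /= -!big_mkcond /=.
have P (m : nat) (a : C) : (m < n)%N -> \sum_(k < n | k == m :> nat) a = a.
  by move=> mn; rewrite (big_pred1 (Ordinal mn))// => k; rewrite /= -val_eqE.
by rewrite !P; [ring|ilia|ilia|ilia].
Qed.

End Fejer.

(** * Vectors produced by a plateau of the norm of the resolvent *)
Section Plateau.
Context {R : realType}.
Local Notation C := (Cplx R).
Implicit Types (x y g h : int -> C) (D : int -> bool) (t : @coef R) (U V W : set C).
Variables (p : \bar R) (p1 : (1 <= p)%E).

(** The weights are nonnegative with mean 1, so the average is no longer than the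
    longest of the averaged vectors. *)
Lemma fejer_norm n (v : nat -> int -> C) (rho om : C) A : (2 < n)%N -> modulus om = 1 ->
  (forall z : C, modulus z = 1 ->
     nle p (fun i => \sum_(k < n) (rho * z) ^+ k * v k i) A) ->
  nle p (fun i => v 0%N i + om / 2 * rho * v 1%N i +
            om^-1 / 2 * rho ^+ n.-1 * v n.-1 i) A.
Proof.
move=> n2 om1 hA; have n0 : (0 < n)%N by ilia.
have [xi hxi] := @prim_root_ex R n n0.
have xi1 := md_root hxi.
have om0 : om != 0 by rewrite -md_gt0 om1.
have xi0 : xi != 0 by rewrite -md_gt0 xi1.
pose u (j : 'I_n) := om * xi ^+ (j * n.-1).
have u1 j : modulus (u j) = 1 by rewrite /u mdM mdX om1 xi1 expr1n mulr1.
have uV j : (u j)^-1 = om^-1 * xi ^+ j.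
  rewrite /u invfM; congr (_ * _).
  apply: (mulfI (expf_neq0 (j * n.-1) xi0)); rewrite mulfV ?expf_neq0//.
  rewrite -exprD -mulnSr prednK// mulnC exprM (prim_expr_order hxi) expr1n //.
pose w j : R := 1 + complex.Re (u j).
have w0 j : 0 <= w j.
  have := Re_le_md (u j); rewrite u1 ler_norml /w => /andP[h _]; lra.
have wE j : (w j)%:C%C = 1 + (om * xi ^+ (j * n.-1) + om^-1 * xi ^+ j) / 2 :> C.
  rewrite -/(u j) -uV unimod_inv ?u1// /w rmorphD rmorph1; congr (_ + _).
  by rewrite [in RHS]rmorphM rmorph_nat mulrC mulKf// pnatr_eq0.
have ws : \sum_(j < n) w j = n%:R.
  have [] : (\sum_(j < n) w j)%:C%C = (n%:R)%:C%C :> C; last by [].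
  rewrite rmorph_sum rmorph_nat /=.
  rewrite (eq_bigr _ (fun j _ => wE j)).
  rewrite !big_split /= sumr_const card_ord -mulr_suml big_split /= -!mulr_sumr.
  rewrite (sum_root _ hxi) (eq_bigr (fun j : 'I_n => xi ^+ (j * 1))); last first.
    by move=> j _; rewrite muln1.
  rewrite (sum_root _ hxi) !gtnNdvd; [|ilia..].
  by rewrite !mulr0 addr0 mul0r addr0.
have nR : (0 : R) < n%:R by rewrite ltr0n.
have nC : (n%:R : C) != 0 by rewrite pnatr_eq0 -lt0n.
have hs : nle p (fun i => \sum_(j < n) (w j)%:C%C *
    (\sum_(k < n) (rho * xi ^+ j) ^+ k * v k i)) (\sum_(j < n) w j * A).
  apply: nle_sum => // j; have := hA (xi ^+ j); rewrite mdX xi1 expr1n => /(_ erefl).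
  apply: nle_scale => // i; by rewrite mdM mdR ger0_norm.
rewrite -mulr_suml ws in hs.
have h2 : nle p (fun i => (n%:R)^-1 * \sum_(j < n) (w j)%:C%C *
    (\sum_(k < n) (rho * xi ^+ j) ^+ k * v k i)) (n%:R^-1 * (n%:R * A)).
  apply: nle_scale hs => // i.
  by rewrite mdM mdV -(rmorph_nat (real_complex R)) mdR ger0_norm// ltW.
rewrite mulKf ?gt_eqF// in h2.
apply: nle_solid h2 => // i; rewrite le_eqVlt; apply/orP; left; apply/eqP; congr modulus.
under eq_bigr do rewrite wE.
by rewrite (@fejer R n xi (fun k => v k i) rho om n2 hxi om0) mulKf.
Qed.

(** With [v k] the image of [x] under the [k]-th power of the inverse, the truncated
    resolvent series [X] of [x] at [a] satisfies
    [(t - a) X = t x - a^n (v n.-1)].  If the bound [M] holds for all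
    [a] of modulus [rho], every [X] is hardly longer than [x], and the Fejer
    average of the [X] is, up to an error of order [rho ^ (n - 1)], the vector
    [x + om y] with [y = (rho / 2) (v 1)]. *)
Lemma plateau_vec D t c r0 M n : (2 < n)%N -> 0 < c -> bnd c t -> 0 < r0 -> 0 < M ->
  (forall z, modulus z <= r0 -> linv p D (ts z t) M) ->
  (forall M', 0 <= M' -> M' < M -> ~ LB p D t M') ->
  exists2 K0 : R, 0 < K0 & forall rho : R, 0 < rho -> rho <= 1 -> rho <= r0 ->
    exists x y B, [/\ 0 < B, lpx p x & lpx p y] /\
     [/\ nrm p x = B, rho * B <= 6 * c * nrm p y &
     forall om : C, modulus om = 1 ->
       nle p (fun i => x i + om * y i) (B * (1 + K0 * rho ^+ n.-1))].
Proof.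
move=> n2 c0 tc r00 M0 hI hmin.
have t0 := ts0 t.
have [lb sur] : linv p D t M by rewrite -t0; apply: hI; rewrite md0 ltW.
exists (M ^+ n + M ^+ n.-1 + 1); first by rewrite !addr_gt0 ?exprn_gt0.
move=> rho rho0 rho1 rhor.
pose e := rho ^+ n.-1; have e0 : 0 < e by rewrite exprn_gt0.
(* The slack [e] is of the order of the error that the averaging leaves. *)
have [x [xD xl [b xb hb]]] : exists x, [/\ supp D x, lpx p x &
    exists2 b, nle p (compr D t x) b & M * b < nrm p x * (1 + e)].
  have M'0 : 0 <= M / (1 + e) by rewrite divr_ge0//; lra.
  have M'M : M / (1 + e) < M by rewrite ltr_pdivrMr; nra.
  have := hmin _ M'0 M'M; move=> /existsNP[x] /not_implyP[xD] /not_implyP[xl].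
  move=> /existsNP[b] /not_implyP[xb nb]; exists x; split=> //; exists b => //.
  have [xN _] := nrmP p1 xl.
  rewrite -ltr_pdivrMr; last by lra.
  rewrite ltNge; apply/negP => hh; apply: nb; apply: nle_trans xN _.
  by rewrite mulrAC.
have [xN xmin] := nrmP p1 xl; set B := nrm p x in hb xN xmin.
have b0 := nle_ge0 p1 xb.
have B0 : 0 < B.
  rewrite lt_def (nle_ge0 p1 xN) andbT; apply/eqP => BE; move: hb; rewrite BE mul0r.
  by rewrite ltNge mulr_ge0// ltW.
have /choice[S hS] : forall y, exists z, supp D y -> lpx p y ->
    [/\ supp D z, lpx p z & forall i, compr D t z i = y i].
  move=> y; have [h|h] := pselect (supp D y /\ lpx p y).
    by case: h => h1 h2; have [z hz] := sur y h1 h2; exists z.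
  by exists y => h1 h2; exfalso; apply: h.
pose v k := iter k S x.
have vP k : [/\ supp D (v k), lpx p (v k) & nle p (v k) (M ^+ k * B)].
  elim: k => [|k [kD kl kb]]; first by rewrite expr0 mul1r.
  have [h1 h2 h3] := hS _ kD kl; split=> //; rewrite exprS -mulrA; apply: lb => //.
  by apply: nle_solid kb => // i; rewrite h3.
have vT k i : compr D t (v k.+1) i = v k i.
  by have [kD kl _] := vP k; have [_ _] := hS _ kD kl.
exists x, (fun i => (rho / 2)%:C%C * v 1%N i), B; split; first split=> //.
  by apply: lpx_scale => //; case: (vP 1%N).
have yl : lpx p (fun i => (rho / 2)%:C%C * v 1%N i).
  by apply: lpx_scale => //; case: (vP 1%N).
have rC : modulus ((rho / 2)%:C%C : C) = rho / 2.
  by rewrite mdR ger0_norm// divr_ge0// ltW.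
split=> //.
  have [yN _] := nrmP p1 yl.
  have h1 := nle_compr p1 D tc yN.
  have : nle p x (2 / rho * (3 * c * nrm p (fun i => (rho / 2)%:C%C * v 1%N i))).
    apply: nle_scale h1 => // [|i]; first by rewrite divr_ge0// ltW.
    rewrite comprZ vT mdM rC mulrA (_ : 2 / rho * (rho / 2) = 1) ?mul1r//.
    by field; rewrite gt_eqF.
  move/xmin; rewrite -ler_pdivrMl; last by rewrite divr_gt0.
  by rewrite invfM invrK => h; lra.
move=> om om1.
have hz (z : C) : modulus z = 1 ->
    nle p (fun i => \sum_(k < n) (rho%:C%C * z) ^+ k * v k i)
       (M * (b + rho ^+ n * (M ^+ n.-1 * B))).
  move=> z1; set a := rho%:C%C * z.
  have a1 : modulus a = rho by rewrite mdM z1 mulr1 mdR ger0_norm// ltW.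
  have [lbz _] : linv p D (ts a t) M by apply: hI; rewrite a1.
  pose X m i : C := \sum_(k < m) a ^+ k * v k i.
  have XD m : supp D (X m).
    by move=> i Di; rewrite /X big1// => k _; case: (vP k) => h _ _; rewrite h// mulr0.
  have Xl m : lpx p (X m).
    exists (\sum_(k < m) modulus (a ^+ k) * (M ^+ k * B)).
    apply: nle_sum => // k; case: (vP k) => _ _; apply: nle_scale => //.
      exact: md_ge0.
    by move=> i; rewrite mdM.
  have TX m i : compr D (ts a t) (X m.+1) i = compr D t x i - a ^+ m.+1 * v m i.
    elim: m i => [|m ih] i.
      rewrite compr_ts// expr1 /X; under eq_fun do rewrite big_ord_recr big_ord0 /= add0r expr0 mul1r.
      by rewrite big_ord_recr big_ord0 /= add0r expr0 mul1r.
    have -> : X m.+2 = fun i => X m.+1 i + a ^+ m.+1 * v m.+1 i.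
      by apply/funext => j; rewrite /X big_ord_recr.
    rewrite comprD comprZ ih compr_ts; last by case: (vP m.+1).
    by rewrite vT [in RHS]exprS; ring.
  have nE : n = n.-1.+1 by ilia.
  have := lbz _ (XD n) (Xl n) (b + rho ^+ n * (M ^+ n.-1 * B)); apply.
  have hv : nle p (fun i => a ^+ n * v n.-1 i) (rho ^+ n * (M ^+ n.-1 * B)).
    case: (vP n.-1) => _ _; apply: nle_scale => // [|i].
      by rewrite exprn_ge0// ltW.
    by rewrite mdM mdX a1.
  apply: nle_solid (nle_sub p1 xb hv) => // i.
  by rewrite {1}nE TX -nE.
have := fejer_norm n2 om1 hz.
have hl : nle p (fun i => om^-1 / 2 * rho%:C%C ^+ n.-1 * v n.-1 i)
    (rho ^+ n.-1 * (M ^+ n.-1 * B)).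
  case: (vP n.-1) => _ _; apply: nle_scale => // [|i].
    by rewrite exprn_ge0// ltW.
  rewrite !mdM mdX mdV om1 invr1 mul1r mdR ger0_norm ?(ltW rho0)//.
  rewrite ler_wpM2r ?md_ge0// ler_piMl ?exprn_ge0 ?(ltW rho0)//.
  by rewrite mdV -(rmorph_nat (real_complex R)) mdR ger0_norm// invf_le1// ler1n.
move=> h; have := nle_sub p1 h hl => h'.
have le : M * (b + rho ^+ n * (M ^+ n.-1 * B)) + rho ^+ n.-1 * (M ^+ n.-1 * B) <=
    B * (1 + (M ^+ n + M ^+ n.-1 + 1) * rho ^+ n.-1).
  have Mn : M ^+ n = M * M ^+ n.-1 by rewrite -exprS prednK//; exact: ltnW (ltnW n2).
  have rn : rho ^+ n = rho * rho ^+ n.-1.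
    by rewrite -exprS prednK//; exact: ltnW (ltnW n2).
  rewrite mulrDr -/e.
  have -> : M * (rho ^+ n * (M ^+ n.-1 * B)) = rho ^+ n * (M ^+ n * B).
    by rewrite Mn; ring.
  have : rho ^+ n * (M ^+ n * B) <= e * (M ^+ n * B).
    rewrite ler_wpM2r ?mulr_ge0 ?exprn_ge0 ?(ltW M0) ?(ltW B0)//.
    by rewrite rn ler_piMl// ltW.
  have -> : B * (1 + (M ^+ n + M ^+ n.-1 + 1) * e) =
    B * (1 + e) + e * (M ^+ n * B) + e * (M ^+ n.-1 * B) by ring.
  by lra.
apply: nle_trans le; apply: nle_solid h' => // i.
rewrite le_eqVlt; apply/orP; left; apply/eqP; congr modulus.
have -> : (rho / 2)%:C%C = rho%:C%C / 2 :> C.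
  by rewrite rmorphM fmorphV rmorph_nat.
by rewrite /v /=; ring.
Qed.

End Plateau.

(** * Convexity inequalities for complex numbers *)
Section ComplexConvexity.
Context {R : realType}.
Local Notation C := (Cplx R).

Lemma md_sqr (z : C) : modulus z ^+ 2 = complex.Re z ^+ 2 + complex.Im z ^+ 2.
Proof. by case: z => a b /=; rewrite sqr_sqrtr ?addr_ge0 ?sqr_ge0. Qed.

Lemma parallelogram (a b : C) :
  modulus (a + b) ^+ 2 + modulus (a - b) ^+ 2 = 2 * (modulus a ^+ 2 + modulus b ^+ 2).
Proof. by rewrite !md_sqr; case: a => a a'; case: b => b b' /=; ring. Qed.

(** One of [a^2 - b^2] and [a^2 + b^2] has modulus at least [|a|^2], and
    [(|a + w| + |a - w|)^2 = 2 (|a|^2 + |w|^2) + 2 |a^2 - w^2|]; averaging over four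
    directions is needed, since [|a + b| + |a - b|] alone need not exceed [2 |a|]. *)
Lemma four_points (a b : C) (tau : R) : 0 <= tau -> tau <= 2^-1 ->
  (4 - 4 * tau ^+ 2) * modulus a + tau * modulus b <=
  (modulus (a + b) + modulus (a - b)) +
  (modulus (a + 'i%C * b) + modulus (a - 'i%C * b)).
Proof.
move=> tau0 tau1.
have mi : modulus ('i%C : C) = 1 by rewrite /= expr0n expr1n add0r sqrtr1.
have mib : modulus ('i%C * b) = modulus b by rewrite mdM mi mul1r.
have i2 : ('i%C : C) * 'i%C = -1 by have := @sqr_i R; rewrite expr2.
have pair (w : C) : 2 * modulus a <= modulus (a + w) + modulus (a - w).
  have : modulus ((a + w) + (a - w)) <= modulus (a + w) + modulus (a - w) by exact: mdD.
  have -> : a + w + (a - w) = (2 : C) * a by ring.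
  by rewrite mdM -(rmorph_nat (real_complex R)) mdR ger0_norm.
have sq (w : C) : (modulus (a + w) + modulus (a - w)) ^+ 2 =
    2 * (modulus a ^+ 2 + modulus w ^+ 2) + 2 * modulus (a * a - w * w).
  rewrite -parallelogram (_ : a * a - w * w = (a + w) * (a - w)); last by ring.
  by rewrite mdM; ring.
have D : modulus a ^+ 2 <= modulus (a * a - b * b) \/
         modulus a ^+ 2 <= modulus (a * a - 'i%C * b * ('i%C * b)).
  have : modulus ((a * a - b * b) + (a * a - 'i%C * b * ('i%C * b))) <=
    modulus (a * a - b * b) + modulus (a * a - 'i%C * b * ('i%C * b)) by exact: mdD.
  have -> : (a * a - b * b) + (a * a - 'i%C * b * ('i%C * b)) = (2 : C) * (a * a).
    have -> : 'i%C * b * ('i%C * b) = 'i%C * 'i%C * (b * b) by ring.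
    by rewrite i2; ring.
  rewrite mdM -(rmorph_nat (real_complex R)) mdR ger0_norm// mdM -expr2 => h.
  by have [h1|h1] := leP (modulus a ^+ 2) (modulus (a * a - b * b)); [left | right; lra].
have A0 := md_ge0 a; have B0 := md_ge0 b.
have big (w : C) : modulus w = modulus b -> modulus a ^+ 2 <= modulus (a * a - w * w) ->
    (2 - 4 * tau ^+ 2) * modulus a + tau * modulus b <= modulus (a + w) + modulus (a - w).
  move=> wb hD; have S0 : 0 <= modulus (a + w) + modulus (a - w) by rewrite addr_ge0 ?md_ge0.
  rewrite -ler_sqr ?nnegrE//; last first.
    by rewrite addr_ge0 ?mulr_ge0//; nra.
  rewrite sq wb; set A := modulus a in A0 hD *; set B := modulus b in B0 *.
  have h0 : 4 * tau * (A * B) <= 4 * tau ^+ 2 * A ^+ 2 + B ^+ 2.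
    by have := sqr_ge0 (2 * tau * A - B); rewrite sqrrB; nra.
  have t2 : tau ^+ 2 <= 4^-1 by nra.
  have t20 : 0 <= tau ^+ 2 by exact: sqr_ge0.
  have A2 : 0 <= A ^+ 2 by exact: sqr_ge0.
  have B2 : 0 <= B ^+ 2 by exact: sqr_ge0.
  have AB : 0 <= A * B by exact: mulr_ge0.
  have -> : ((2 - 4 * tau ^+ 2) * A + tau * B) ^+ 2 =
    4 * A ^+ 2 - 16 * (tau ^+ 2 * A ^+ 2) + 16 * (tau ^+ 2 * (tau ^+ 2 * A ^+ 2)) +
    4 * tau * (A * B) - 8 * (tau ^+ 2 * (tau * (A * B))) + tau ^+ 2 * B ^+ 2 by ring.
  have h1 : tau ^+ 2 * (tau ^+ 2 * A ^+ 2) <= 4^-1 * (tau ^+ 2 * A ^+ 2).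
    by rewrite ler_wpM2r// mulr_ge0.
  have h2 : 0 <= tau ^+ 2 * (tau * (A * B)) by rewrite !mulr_ge0.
  have h3 : tau ^+ 2 * B ^+ 2 <= 4^-1 * B ^+ 2 by rewrite ler_wpM2r.
  have h4 : 0 <= tau ^+ 2 * A ^+ 2 by rewrite mulr_ge0.
  by lra.
case: D => hD.
  have h1 := big b erefl hD; have h2 := pair ('i%C * b); lra.
have h1 := big _ mib hD; have h2 := pair b; lra.
Qed.

Lemma powR_superadditive (r a b : R) : 1 <= r -> 0 <= a -> 0 <= b ->
  a `^ r + b `^ r <= (a + b) `^ r.
Proof.
move=> r1 a0 b0; have r0 : 0 < r by lra.
have ab0 : 0 <= a + b by rewrite addr_ge0.
rewrite -(mulr_powRB1 a0 r0) -(mulr_powRB1 b0 r0) -(mulr_powRB1 ab0 r0) mulrDl.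
rewrite lerD// ler_wpM2l//; apply: powR_le => //.
- by rewrite subr_ge0.
- by rewrite lerDl.
- by rewrite subr_ge0.
by rewrite lerDr.
Qed.

(** Parallelogram law, with the superadditivity and the convexity of the power
    [s / 2]. *)
Lemma clarkson2 (s : R) (a b : C) : 2 <= s ->
  2 * (modulus a `^ s + modulus b `^ s) <= modulus (a + b) `^ s + modulus (a - b) `^ s.
Proof.
move=> s2; have r1 : 1 <= s / 2 by lra.
have E (z : C) : modulus z `^ s = (modulus z ^+ 2) `^ (s / 2).
  by rewrite -powR_mulrn ?md_ge0// -powRrM; congr (_ `^ _); lra.
rewrite !E; set u := modulus (a + b) ^+ 2; set v := modulus (a - b) ^+ 2.
have u0 : 0 <= u by exact: sqr_ge0.
have v0 : 0 <= v by exact: sqr_ge0.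
have h1 : (modulus a ^+ 2) `^ (s / 2) + (modulus b ^+ 2) `^ (s / 2) <=
    (modulus a ^+ 2 + modulus b ^+ 2) `^ (s / 2).
  by apply: powR_superadditive => //; exact: sqr_ge0.
have e : modulus a ^+ 2 + modulus b ^+ 2 = 2^-1 * u + (1 - 2^-1) * v.
  by have := parallelogram a b; rewrite -/u -/v => h; lra.
have l01 : 0 <= (2^-1 : R) <= 1 by apply/andP; split; lra.
have := powR_convex2 r1 u0 v0 l01; rewrite -e => h2.
lra.
Qed.

(** An inequality between finite sums becomes one between norms by passing to the
    supremum in one vector after the other. *)
Lemma norm_comb (s al be A : R) (x y : int -> C) : 1 <= s -> 0 < al -> 0 < be ->
  lpx s%:E x -> lpx s%:E y ->
  (forall J : seq int, uniq J -> al * \sum_(i <- J) modulus (x i) `^ s +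
      be * \sum_(i <- J) modulus (y i) `^ s <= A) ->
  al * nrm s%:E x `^ s + be * nrm s%:E y `^ s <= A.
Proof.
move=> s1 al0 be0 xl yl h; have s0 : 0 < s by lra.
have p1 : (1 <= s%:E)%E by rewrite lee_fin.
have main (z w : int -> C) (a b Q : R) : 0 < a -> 0 < b -> lpx s%:E w ->
    (forall J : seq int, uniq J -> a * Q +
      b * \sum_(i <- J) modulus (w i) `^ s <= A) -> a * Q + b * nrm s%:E w `^ s <= A.
  move=> a0 b0 wl hJ; have [_ wmin] := nrmP p1 wl.
  have Q0 : 0 <= (A - a * Q) / b.
    by rewrite divr_ge0 ?(ltW b0)//; have := hJ [::] isT; rewrite big_nil mulr0 addr0; lra.
  have : nrm s%:E w <= ((A - a * Q) / b) `^ s^-1.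
    apply: wmin; apply/nle_finP => //; split=> [|J uJ]; first exact: powR_ge0.
    by rewrite powRVK// ler_pdivlMr// mulrC; have := hJ J uJ; lra.
  have [wN _] := nrmP p1 wl.
  move=> /(powR_le (ltW s0) (nle_ge0 p1 wN)); rewrite powRVK// ler_pdivlMr// mulrC.
  by lra.
rewrite addrC; apply: (main y x be al) => // J uJ.
rewrite addrC; apply: (main x y al be) => // J' uJ'.
apply: le_trans (h (undup (J ++ J')) (undup_uniq _)).
have sub (z : int -> C) (J1 : seq int) : {subset J1 <= J ++ J'} -> uniq J1 ->
   \sum_(i <- J1) modulus (z i) `^ s <= \sum_(i <- undup (J ++ J')) modulus (z i) `^ s.
  move=> s12 u1; pose f i := if i \in J ++ J' then modulus (z i) `^ s else 0.
  rewrite (eq_big_seq f); last by move=> i /s12 iJ; rewrite /f iJ.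
  rewrite [leRHS](eq_big_seq f); last by move=> i; rewrite mem_undup /f => ->.
  apply: sum_sub_supp => //; last exact: undup_uniq.
    by move=> i; rewrite /f; case: ifP => // _; exact: powR_ge0.
  by move=> i; rewrite mem_undup /f => /negPf ->.
rewrite lerD// ler_pM2l//; apply: sub => // i; rewrite mem_cat => ->//.
by rewrite orbT.
Qed.

End ComplexConvexity.

(** * The norm of the resolvent has no plateau *)
Section NoPlateau.
Context {R : realType}.
Local Notation C := (Cplx R).
Implicit Types (x y g h : int -> C) (D : int -> bool) (t : @coef R) (U V W : set C).

(** The gain in [four_points], of order [tau^2 |x|] with [tau] proportional to
    [rho], outweighs the error of order [rho^3] in [plateau_vec] with [n = 4]. *)
Lemma no_plateau1 D t c r0 M : 0 < c -> bnd c t -> 0 < r0 -> 0 < M ->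
  (forall z, modulus z <= r0 -> linv 1%E D (ts z t) M) ->
  (forall M', 0 <= M' -> M' < M -> ~ LB 1%E D t M') -> False.
Proof.
move=> c0 tc r00 M0 hI hmin.
have p1 : (1 <= 1 :> \bar R)%E by [].
have [K0 K00 h] := plateau_vec p1 (n := 4) isT c0 tc r00 M0 hI hmin.
(* With this constant the term linear in [y] is at least twice the loss [4 tau^2 |x|]. *)
pose L := 48 * c; have L0 : 0 < L by rewrite mulr_gt0.
have LN : L != 0 by rewrite gt_eqF.
have L6 : 6 * c = L / 8 by rewrite /L; lra.
have L24 : 24 * c = L / 2 by rewrite /L; lra.
have cK0 : 0 < (2 * (L ^+ 2 * K0))^-1.
  by rewrite invr_gt0 mulr_gt0// mulr_gt0// exprn_gt0.
pose rho := Num.min (Num.min 1 r0) (Num.min (24 * c) (2 * (L ^+ 2 * K0))^-1).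
have rho0 : 0 < rho by rewrite !lt_min ltr01 r00 cK0 mulr_gt0.
have rho1 : rho <= 1 by rewrite !ge_min lexx.
have rhor : rho <= r0 by rewrite !ge_min lexx orbT.
have rhoc : rho <= 24 * c by rewrite !ge_min lexx !orbT.
have rhoK : rho <= (2 * (L ^+ 2 * K0))^-1 by rewrite !ge_min lexx !orbT.
have [x [y [B [[B0 xl yl] [xB By hom]]]]] := h rho rho0 rho1 rhor.
pose tau := rho / L.
have tau0 : 0 < tau by rewrite divr_gt0.
have tau1 : tau <= 2^-1 by rewrite /tau ler_pdivrMr//; lra.
pose A := B * (1 + K0 * rho ^+ 3).
have t2 : tau ^+ 2 <= 4^-1 by nra.
have al0 : 0 < 4 - 4 * tau ^+ 2 by lra.
have mi : modulus ('i%C : C) = 1 by rewrite /= expr0n expr1n add0r sqrtr1.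
have : (4 - 4 * tau ^+ 2) * nrm 1%:E x `^ 1 + tau * nrm 1%:E y `^ 1 <= 4 * A.
  apply: norm_comb => // J uJ.
  have S (om : C) : modulus om = 1 -> \sum_(i <- J) modulus (x i + om * y i) <= A.
    move=> /hom/(nle_finP _ _ (lexx _))[A0 /(_ J uJ)].
    rewrite powRr1//; congr (_ <= _); apply: eq_bigr => i _.
    by rewrite powRr1// md_ge0.
  have s1 := S 1 md1.
  have s2 := S (-1) (etrans (mdN 1) md1).
  have s3 := S 'i%C mi.
  have s4 := S (- 'i%C) (etrans (mdN _) mi).
  rewrite !mulr_sumr -big_split /=.
  apply: (@le_trans _ _ (\sum_(i <- J) modulus (x i + 1 * y i) +
    \sum_(i <- J) modulus (x i + -1 * y i) + (\sum_(i <- J) modulus (x i + 'i%C * y i) +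
    \sum_(i <- J) modulus (x i + - 'i%C * y i)))); last by lra.
  rewrite -!big_split /=; apply: ler_sum => i _; rewrite !powRr1 ?md_ge0//.
  have := four_points (x i) (y i) (ltW tau0) tau1.
  by rewrite mul1r mulN1r mulNr.
have [xN _] := nrmP p1 xl; have [yN _] := nrmP p1 yl.
rewrite !powRr1 ?(nle_ge0 p1 xN) ?(nle_ge0 p1 yN)// xB => H.
have hy : 8 * tau ^+ 2 * B <= tau * nrm 1%E y.
  have -> : 8 * tau ^+ 2 * B = tau * ((rho * B) / (6 * c)).
    by rewrite L6 /tau; field.
  by rewrite ler_pM2l// ler_pdivrMr ?mulr_gt0// [leRHS]mulrC.
have H2 : 4 * tau ^+ 2 * B <= 4 * (K0 * rho ^+ 3) * B by rewrite /A in H; lra.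
have H3 : tau ^+ 2 <= K0 * rho ^+ 3.
  by move: H2; rewrite ler_pM2r// ler_pM2l.
have H4 : rho ^+ 2 <= L ^+ 2 * K0 * rho * rho ^+ 2.
  have -> : L ^+ 2 * K0 * rho * rho ^+ 2 = L ^+ 2 * (K0 * rho ^+ 3) by ring.
  have -> : rho ^+ 2 = L ^+ 2 * tau ^+ 2 by rewrite /tau; field.
  by rewrite ler_wpM2l// exprn_ge0// ltW.
have r2 : 0 < rho ^+ 2 by rewrite exprn_gt0.
have H5 : 1 <= L ^+ 2 * K0 * rho by rewrite -(ler_pM2r r2) mul1r.
have pos : 0 < L ^+ 2 * K0 by rewrite mulr_gt0// exprn_gt0.
have : L ^+ 2 * K0 * rho <= 2^-1.
  apply: le_trans (ler_wpM2l (ltW pos) rhoK) _.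
  by rewrite le_eqVlt; apply/orP; left; apply/eqP; field; rewrite !gt_eqF.
by lra.
Qed.

(** [clarkson2] bounds [2 |y|^s] by the excess of order [rho ^ (n - 1)], whereas
    [|y|^s] is at least of order [rho ^ s]. *)
Lemma no_plateau2 s D t c r0 M : 2 <= s -> 0 < c -> bnd c t -> 0 < r0 -> 0 < M ->
  (forall z, modulus z <= r0 -> linv s%:E D (ts z t) M) ->
  (forall M', 0 <= M' -> M' < M -> ~ LB s%:E D t M') -> False.
Proof.
move=> s2 c0 tc r00 M0 hI hmin; have s1 : 1 <= s by lra.
have s0 : 0 < s by lra.
have p1 : (1 <= s%:E)%E by rewrite lee_fin.
(* Large enough for [n - 1 >= s + 1]. *)
pose n := (Num.trunc s).+4.
have [K0 K00 h] := plateau_vec p1 (n := n) isT c0 tc r00 M0 hI hmin.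
pose Q := 2 `^ s * K0 * (6 * c) `^ s.
have Q0 : 0 < Q by rewrite !mulr_gt0 ?powR_gt0 ?mulr_gt0.
have Q2 : 0 < (2 * Q)^-1 by rewrite invr_gt0 mulr_gt0.
pose rho := Num.min (Num.min 1 r0) (Num.min K0^-1 (2 * Q)^-1).
have rho0 : 0 < rho by rewrite !lt_min ltr01 r00 Q2 invr_gt0 K00.
have rho1 : rho <= 1 by rewrite !ge_min lexx.
have rhor : rho <= r0 by rewrite !ge_min lexx orbT.
have rhoc : rho <= K0^-1 by rewrite !ge_min lexx !orbT.
have rhoK : rho <= (2 * Q)^-1 by rewrite !ge_min lexx !orbT.
have [x [y [B [[B0 xl yl] [xB By hom]]]]] := h rho rho0 rho1 rhor.
pose e := K0 * rho ^+ n.-1.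
have e0 : 0 <= e by rewrite mulr_ge0 ?exprn_ge0// ltW.
have e1 : e <= 1.
  apply: (@le_trans _ _ (K0 * rho)); last first.
    by rewrite -ler_pdivlMl// mulr1.
  by rewrite ler_pM2l// /n /= exprS ler_piMr ?(ltW rho0)// exprn_ile1// ltW.
have er : rho ^+ n.-1 <= rho * rho `^ s.
  rewrite -powR_mulrn ?(ltW rho0)// -{2}(powRr1 (ltW rho0)) -powRD; last first.
    by apply/implyP => _; rewrite gt_eqF.
  rewrite ger_powR ?rho0//.
  have := truncnS_gt s; rewrite /n /= -!natr1; lra.
pose A := B * (1 + e).
have A0 : 0 <= A by rewrite mulr_ge0 ?(ltW B0)// addr_ge0.
have : 2 * nrm s%:E x `^ s + 2 * nrm s%:E y `^ s <= 2 * A `^ s.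
  apply: norm_comb => // J uJ.
  have S (om : C) : modulus om = 1 -> \sum_(i <- J) modulus (x i + om * y i) `^ s <= A `^ s.
    by move=> /hom/(nle_finP _ _ s1)[_ /(_ J uJ)].
  have h1 := S 1 md1.
  have h2 := S (-1) (etrans (mdN 1) md1).
  rewrite -mulrDr -big_split /= mulr_sumr.
  apply: (@le_trans _ _ (\sum_(i <- J) modulus (x i + 1 * y i) `^ s +
    \sum_(i <- J) modulus (x i + -1 * y i) `^ s)); last by lra.
  rewrite -!big_split /=; apply: ler_sum => i _.
  by rewrite mul1r mulN1r; exact: clarkson2.
rewrite xB => H.
have [yN _] := nrmP p1 yl; have y0 := nle_ge0 p1 yN.
have By' : rho `^ s * B `^ s <= (6 * c) `^ s * nrm s%:E y `^ s.
  rewrite -!powRM ?(ltW rho0) ?(ltW B0) ?mulr_ge0 ?(ltW c0)//.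
  apply: powR_le; rewrite ?(ltW s0) ?mulr_ge0 ?(ltW rho0) ?(ltW B0)//.
have qs : (1 + e) `^ s <= 1 + 2 `^ s * e.
  have l01 : 0 <= 1 - e <= 1 by lra.
  have := powR_convex2 s1 ler01 (ltW (ltr0n R 2)) l01.
  have -> : (1 - e) * 1 + (1 - (1 - e)) * 2 = 1 + e by ring.
  by rewrite powR1 => hh; apply: le_trans hh _; lra.
have Bs : 0 < B `^ s by exact: powR_gt0.
have As : A `^ s <= B `^ s + B `^ s * (2 `^ s * e).
  rewrite /A powRM ?(ltW B0)//; last by lra.
  by apply: le_trans (ler_wpM2l (ltW Bs) qs) _; rewrite mulrDr mulr1.
have Ys : nrm s%:E y `^ s <= B `^ s * (2 `^ s * e) by lra.
have cs : 0 < (6 * c) `^ s by rewrite powR_gt0// mulr_gt0.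
have rs : 0 < rho `^ s by exact: powR_gt0.
have H1 : rho `^ s * B `^ s <= (6 * c) `^ s * (B `^ s * (2 `^ s * e)).
  by apply: le_trans By' _; rewrite ler_pM2l.
have H2 : rho `^ s <= Q * rho ^+ n.-1.
  rewrite -(ler_pM2r Bs); apply: le_trans H1 _.
  by rewrite le_eqVlt /Q /e; apply/orP; left; apply/eqP; ring.
have H3 : rho `^ s <= Q * rho * rho `^ s.
  by apply: le_trans H2 _; rewrite -mulrA ler_pM2l.
have H4 : 1 <= Q * rho by rewrite -(ler_pM2r rs) mul1r.
have : Q * rho <= 2^-1.
  apply: le_trans (ler_wpM2l (ltW Q0) rhoK) _.
  by rewrite le_eqVlt; apply/orP; left; apply/eqP; field; rewrite !gt_eqF.
by lra.
Qed.

End NoPlateau.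

(** * Matrices as compressions *)
Section Representation.
Context {R : realType}.
Local Notation C := (Cplx R).

(** The index type [I] is identified with the set [D] of integers by [pos], with
    inverse [g]; this treats [nat], [int] and ['I_n] at once. *)
Variables (I : choiceType) (pos : I -> int) (g : int -> I) (D : int -> bool) (i0 : I).
Hypothesis gK : forall i, g (pos i) = i.
Hypothesis Kg : forall k, D k -> pos (g k) = k.
Hypothesis Dp : forall i, D (pos i).

Definition ent (t : @coef R) (i j : int) : C :=
  if i == j + 1 then lo t i else if i == j then di t i
  else if j == i + 1 then up t i else 0.

Definition rep (t : @coef R) (a : I -> I -> C) := forall i j, a i j = ent t (pos i) (pos j).

Definition emb (x : I -> C) (k : int) : C := if D k then x (g k) else 0.

Lemma pos_inj : injective pos.
Proof. by move=> i j e; rewrite -(gK i) e gK. Qed.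

Lemma emb_pos x i : emb x (pos i) = x i.
Proof. by rewrite /emb Dp gK. Qed.

Lemma emb_supp x : supp D (emb x).
Proof. by move=> k /negbTE e; rewrite /emb e. Qed.

Lemma emb_of y : supp D y -> emb (y \o pos) = y.
Proof.
move=> h; apply/funext => k; rewrite /emb /=; case: ifP => [Dk|/negbT Dk].
  by rewrite Kg.
by rewrite h.
Qed.

Lemma nle_emb p x c : (1 <= p)%E -> nle p (emb x) c <-> nle p x c.
Proof.
move=> p1; move: p p1; apply: exp_ind => [|s s1].
  split=> /nle_infP h; apply/nle_infP => i; first by rewrite -emb_pos.
  rewrite /emb; case: ifP => // _; rewrite md0; apply: le_trans (h i0); exact: md_ge0.
split=> /(nle_finP _ _ s1) [c0 h]; apply/(nle_finP _ _ s1); split=> // J uJ.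
  have := h _ (etrans (map_inj_uniq pos_inj J) uJ); rewrite big_map.
  by under eq_bigr do rewrite emb_pos.
have -> : \sum_(i <- J) modulus (emb x i) `^ s =
    \sum_(i <- [seq g k | k <- J & D k]) modulus (x i) `^ s.
  rewrite big_map big_filter [in RHS]big_mkcond /=; apply: eq_bigr => k _.
  rewrite /emb; case: ifP => // _; rewrite md0 powR0 //.
  by apply/eqP => e; move: s1; rewrite e ler10.
apply: h; rewrite map_inj_in_uniq ?filter_uniq // => k l.
by rewrite !mem_filter => /andP[Dk _] /andP[Dl _] e; rewrite -(Kg Dk) e Kg.
Qed.

Lemma lpP p (x : I -> C) : lp p x <-> exists c, nle p x c.
Proof.
rewrite /lp /nle /=; split => [|[c]]; last by move=> h; apply: le_lt_trans h (ltry _).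
by case: (lpnorm p x) => [r _|//|_]; [exists r|exists 0; rewrite leNye].
Qed.

Lemma lp_emb p x : (1 <= p)%E -> lp p x <-> lpx p (emb x).
Proof. by move=> p1; rewrite lpP; split=> -[c h]; exists c; apply/nle_emb. Qed.

Variables (t : @coef R) (a : I -> I -> C).
Hypothesis ra : rep t a.
Variable (c : R).
Hypothesis bt : bnd c t.

Lemma mxop_tri x i : mxop a x i = tri t (emb x) (pos i).
Proof.
pose r := [seq g k | k <- [:: pos i - 1; pos i; pos i + 1] & D k].
rewrite /mxop (fsbigE r) //.
- rewrite (eq_bigl xpredT) => [|j]; last by rewrite in_setT.
  rewrite big_map big_filter !big_cons big_nil /tri /emb.
  have E k : D k -> a i (g k) = ent t (pos i) k by move=> Dk; rewrite ra Kg.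
  have e1 : ent t (pos i) (pos i - 1) = lo t (pos i).
    by rewrite /ent subrK eqxx.
  have e2 : ent t (pos i) (pos i) = di t (pos i).
    have e : (pos i == pos i + 1) = false by lia.
    by rewrite /ent e eqxx.
  have e3 : ent t (pos i) (pos i + 1) = up t (pos i).
    have e : (pos i == pos i + 1 + 1) = false by lia.
    have e' : (pos i == pos i + 1) = false by lia.
    by rewrite /ent e e' eqxx.
  rewrite Dp (E _ (Dp i)) e2.
  case: ifP => d1; case: ifP => d3; rewrite ?(E _ d1) ?(E _ d3) ?e1 ?e3 /= ?mulr0 ?addr0 ?add0r ?addrA //.
- rewrite map_inj_in_uniq ?filter_uniq //.
    by rewrite /= !inE; lia.
  by move=> k l; rewrite !mem_filter => /andP[Dk _] /andP[Dl _] e; rewrite -(Kg Dk) e Kg.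
- move=> j _ nj; rewrite ra /ent.
  have : pos j \notin [:: pos i - 1; pos i; pos i + 1].
    apply: contra nj => h; apply/mapP; exists (pos j); rewrite ?gK //.
    by rewrite mem_filter Dp.
  rewrite !inE => h.
  have e : (pos i == pos j + 1) = false by lia.
  have e' : (pos i == pos j) = false by lia.
  have e'' : (pos j == pos i + 1) = false by lia.
  by rewrite e e' e'' mul0r.
Qed.

Lemma emb_mxop x : emb (mxop a x) = compr D t (emb x).
Proof.
apply/funext => k; rewrite /compr /dcut [LHS]/emb; case: ifP => // Dk.
by rewrite mxop_tri Kg.
Qed.

Lemma mxop_compr x : mxop a x = compr D t (emb x) \o pos.
Proof. by apply/funext => i /=; rewrite -emb_mxop emb_pos. Qed.

Lemma opnorm_leP p (T : (I -> C) -> I -> C) K :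
  (opnorm p T <= K%:E)%E <-> forall x, nle p x 1 -> nle p (T x) K.
Proof.
split=> [h x x1|h]; last by apply: ub_ereal_sup => _ [x x1 <-]; apply: h.
by apply: le_trans h; apply: ereal_sup_ubound; exists x.
Qed.

(** Nothing is known about the additivity of [S], but [S] inverts the operator on
    multiples of [x], so it is [x] that is scaled. *)
Lemma inverse_linv p S K : (1 <= p)%E -> 0 <= K -> is_lp_inverse p (mxop a) S ->
  (opnorm p S <= K%:E)%E -> linv p D t K.
Proof.
move=> p1 K0 [S1 S2 _] /opnorm_leP SK; split=> [x sx bx b hc|y sy yx].
  apply: nle_eps => // e e0.
  have b0 := nle_ge0 p1 hc.
  (* Positive also when [b = 0], and [K d <= K b + e]. *)
  pose d := b + e / (K + 1).
  have d0 : 0 < d by rewrite /d ltr_wpDl // divr_gt0 // ltr_wpDl.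
  apply: (@nle_trans _ _ _ (K * d)); last first.
    rewrite /d mulrDr lerD2l mulrCA ler_piMr ?(ltW e0) // ler_pdivrMr ?mul1r; first lra.
    by rewrite ltr_wpDl.
  pose x' i := ((d^-1)%:C%C : C) * x (pos i).
  have ex' : emb x' = fun i => ((d^-1)%:C%C : C) * x i.
    apply/funext => i; rewrite -[in RHS](emb_of sx) /emb /x' /=; case: ifP => //.
    by rewrite mulr0.
  have x1 : nle p (mxop a x') 1.
    apply/nle_emb => //; rewrite emb_mxop ex'.
    apply: (@nle_trans _ _ _ (d^-1 * b)); last first.
      rewrite mulrC ler_pdivrMr // mul1r /d lerDl divr_ge0 ?(ltW e0) //; lra.
    apply: nle_scale hc => // [|i]; first by rewrite invr_ge0 ltW.
    by rewrite comprZ mdM mdR ger0_norm // invr_ge0 ltW.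
  have := SK _ x1; rewrite S2; last first.
    apply/(lp_emb _ p1); rewrite ex'; exact: lpx_scale.
  move/(nle_emb _ _ p1); rewrite ex' mulrC => h.
  apply: nle_scale h => // [|i]; first exact: ltW.
  rewrite mdM mdR ger0_norm ?invr_ge0 ?(ltW d0) // mulrA divff ?mul1r //.
  by rewrite gt_eqF.
have [|u1 u2] := S1 (y \o pos).
  by apply/(lp_emb _ p1); rewrite emb_of.
exists (emb (S (y \o pos))); split; [exact: emb_supp|exact/(lp_emb _ p1)|].
by move=> i; rewrite -emb_mxop u2 emb_of.
Qed.

Lemma linv_inverse p K : (1 <= p)%E -> 0 <= K -> linv p D t K ->
  lp_invertible p (mxop a).
Proof.
move=> p1 K0 [L S].
have E y : exists x, lp p y -> lp p x /\ mxop a x = y.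
  have [ly|ny] := pselect (lp p y); last by exists y => /ny.
  have [||x [sx bx e]] := S (emb y); [exact: emb_supp|exact/(lp_emb _ p1)|].
  exists (x \o pos) => _; split; first by apply/(lp_emb _ p1); rewrite emb_of.
  rewrite mxop_compr emb_of //; apply/funext => i /=; by rewrite e emb_pos.
have B x b : lp p x -> nle p (mxop a x) b -> nle p x (K * b).
  move=> lx /(nle_emb _ _ p1) h; apply/(nle_emb _ _ p1); apply: L.
  - exact: emb_supp.
  - exact/(lp_emb _ p1).
  - by rewrite -emb_mxop.
exists (fun y => projT1 (cid (E y))); split.
- by move=> y ly; case: cid => x /= /(_ ly).
- move=> x lx; case: cid => z /= h.
  have [b xb] := (lp_emb x p1).1 lx.
  have lTx : lp p (mxop a x).
    by apply/(lp_emb _ p1); rewrite emb_mxop; exists (3 * c * b); apply: nle_compr.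
  have [lz e] := h lTx.
  have Z k : emb z k - emb x k = 0.
    have [d zd] := (lp_emb z p1).1 lz.
    apply: (LB_inj p1 L (x := fun k => emb z k - emb x k)).
    - by move=> j Dj; rewrite !emb_supp // subr0.
    - by exists (d + b); apply: nle_sub.
    - move=> j; have E' : (fun k => emb z k - emb x k) = fun k => emb z k + (-1) * emb x k.
        by apply/funext => l; rewrite mulN1r.
      by rewrite E' comprD comprZ -!emb_mxop e mulN1r subrr.
  by apply/funext => i; have := Z (pos i); rewrite !emb_pos => /subr0_eq.
- apply: (@le_lt_trans _ _ K%:E); last exact: ltry.
  apply/opnorm_leP => y y1; case: cid => x /= h.
  have [|lx e] := h; first by apply/lpP; exists 1.
  by rewrite -[K]mulr1; apply: B => //; rewrite e.
Qed.

(** Whatever inverse the norm was defined with, it agrees with the operator inverse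
    on l^p. *)
Lemma inv_norm_leP p K : (1 <= p)%E -> 0 <= K ->
  (inv_norm p (mxop a) <= K%:E)%E <-> linv p D t K.
Proof.
move=> p1 K0; rewrite /inv_norm; split=> [|h].
  case: pselect => [h|//] o; exact: inverse_linv (projT2 (cid h)) o.
case: pselect => [h'|]; last by case; apply: linv_inverse h.
apply/opnorm_leP => y y1; case: (cid h') => S /= [S1 _ _].
have ly : lp p y by apply/lpP; exists 1.
have [lSy e] := S1 _ ly.
apply/(nle_emb _ _ p1); rewrite -[K]mulr1; apply: h.1.
- exact: emb_supp.
- exact/(lp_emb _ p1).
- by rewrite -emb_mxop e; apply/(nle_emb _ _ p1).
Qed.

Lemma lp_invertibleP p : (1 <= p)%E ->
  lp_invertible p (mxop a) <-> exists2 K, 0 <= K & linv p D t K.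
Proof.
move=> p1; split=> [[S h]|[K K0 h]]; last exact: linv_inverse h.
have [_ _ o] := h.
have [K hK] : exists K : R, (opnorm p S <= K%:E)%E.
  move: o; case: (opnorm p S) => [r _|//|_]; first by exists r.
  by exists 0; rewrite leNye.
exists `|K| => //; apply: inverse_linv h _ => //.
by apply: le_trans hK _; rewrite lee_fin ler_norm.
Qed.

Lemma inv_norm_ge0 p : (1 <= p)%E -> (0 <= inv_norm p (mxop a))%E.
Proof.
move=> p1; rewrite /inv_norm; case: pselect => [h|//]; case: (cid h) => S /= hS.
have l0 : nle p (fun _ : I => 0 : C) 0.
  apply/(nle_emb _ _ p1); have -> : emb (fun=> 0) = (fun=> 0).
    by apply/funext => k; rewrite /emb; case: ifP.
  exact: nle_0.
have G (x : I -> C) b : nle p x b -> 0 <= b by move/(nle_emb _ _ p1)/(nle_ge0 p1).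
apply: (@le_trans _ _ (lpnorm p (S (fun=> 0)))).
  move: (G (S (fun=> 0))); rewrite /nle; case: (lpnorm p _) => [r| |] h'.
  - by rewrite lee_fin; apply: h'.
  - by rewrite leey.
  - by have := h' (-1) (leNye _); rewrite ler0N1.
by apply: ereal_sup_ubound; exists (fun=> 0) => //; apply: le_trans l0 _; rewrite lee_fin.
Qed.
Lemma linv_fredholm p K : (1 <= p)%E -> 0 <= K -> linv p D t K ->
  fredholm_of_index p (mxop a) 0.
Proof.
move=> p1 K0 [L S]; exists 0%N, 0%N; split; last by rewrite subrr.
- exists (fun _ _ => 0); split=> [[]//|x lx e].
  have x0 : x = (fun=> 0).
    apply/funext => i; rewrite -emb_pos; apply: (LB_inj p1 L).
    + exact: emb_supp.
    + exact/(lp_emb _ p1).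
    + by move=> k; rewrite -emb_mxop e /emb; case: ifP.
  exists [ffun=> 0]; split=> [|c' _]; last by apply/ffunP => -[].
  by rewrite x0; apply/funext => i; rewrite big_ord0.
- exists (fun _ _ => 0); split=> [[]//|y ly].
  have [||x [sx bx e]] := S (emb y); [exact: emb_supp|exact/(lp_emb _ p1)|].
  exists [ffun=> 0]; split=> [|c' _]; last by apply/ffunP => -[].
  exists (x \o pos); first by apply/(lp_emb _ p1); rewrite emb_of.
  by rewrite mxop_compr emb_of //; apply/funext => i /=; rewrite big_ord0 subr0 e emb_pos.
Qed.

(** The dimensions of kernel and cokernel are equal, so they are 0 together. *)
Lemma fredholm_pinj_Sur p : (1 <= p)%E -> fredholm_of_index p (mxop a) 0 ->
  pinj p D t <-> Sur p D t.
Proof.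
move=> p1 [n [m [[b [b1 b2]] [b' [b1' b2']] nm]]].
have {nm} nm : n = m by apply/eqP; rewrite -eqz_nat -subr_eq0 -nm.
have l0 : lp p (fun _ : I => 0 : C).
  apply/(lp_emb _ p1); have -> : emb (fun=> 0) = (fun=> 0).
    by apply/funext => k; rewrite /emb; case: ifP.
  by exists 0; apply: nle_0.
have T0 : mxop a (fun=> 0) = (fun=> 0).
  apply/funext => i; rewrite mxop_tri /tri.
  have e k : emb (fun=> 0) k = 0 by rewrite /emb; case: ifP.
  by rewrite !e !mulr0 !addr0.
split=> [inj y sy yx|sur x sx bx e k].
- case: n nm b b1 b2 => [|n] nm b b1 b2.
    case: m nm b' b1' b2' => // _ b' b1' b2'.
    have ly : lp p (y \o pos) by apply/(lp_emb _ p1); rewrite emb_of.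
    have [c' [[x lx e] _]] := b2' _ ly.
    exists (emb x); split; [exact: emb_supp|exact/(lp_emb _ p1)|] => i.
    rewrite -emb_mxop -e; have -> : (fun i => (y \o pos) i - \sum_(k < 0) c' k * b' k i) = y \o pos.
      by apply/funext => j; rewrite big_ord0 subr0.
    by rewrite emb_of.
  have b0 k i : b k i = 0.
    rewrite -emb_pos; have [lk ek] := b1 k; apply: inj.
    + exact: emb_supp.
    + exact/(lp_emb _ p1).
    + by move=> j; rewrite -emb_mxop ek /emb; case: ifP.
  (* All basis vectors vanish, so the coefficients of 0 are not unique. *)
  have [c' [_ cu]] := b2 _ l0 T0.
  have G (d : {ffun 'I_n.+1 -> C}) : c' = d.
    by apply: cu; apply/funext => i; rewrite big1 // => k _; rewrite b0 mulr0.
  have := G [ffun=> 0]; rewrite (G [ffun=> 1]) => /ffunP/(_ ord0).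
  by rewrite !ffunE => /eqP; rewrite oner_eq0.
- case: m nm b' b1' b2' => [|m] nm b' b1' b2'.
    move: nm => nm; subst n.
    have [||c' [ex _]] := b2 (x \o pos).
    + by apply/(lp_emb _ p1); rewrite emb_of.
    + by rewrite mxop_compr emb_of //; apply/funext => i /=; rewrite e.
    have := emb_of sx; rewrite ex => <-.
    by rewrite /emb; case: ifP => //; rewrite big_ord0.
  (* The range is everything, so the coefficients of [b' ord0] are not unique. *)
  have [c' [_ cu]] := b2' _ (b1' ord0).
  have E0 : c' = [ffun=> 0].
    apply: cu; have [||x' [sx' bx' e']] := sur (emb (b' ord0)).
    + exact: emb_supp.
    + exact/(lp_emb _ p1).
    exists (x' \o pos); first by apply/(lp_emb _ p1); rewrite emb_of.
    rewrite mxop_compr emb_of //; apply/funext => i /=; rewrite e' emb_pos.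
    by rewrite big1 ?subr0 // => j _; rewrite ffunE mul0r.
  have E1 : c' = [ffun j => if j == ord0 then 1 else 0].
    apply: cu; exists (fun=> 0) => //; rewrite T0; apply/funext => i.
    rewrite big_ord_recl big1 => [|j _]; last by rewrite ffunE mul0r.
    by rewrite ffunE eqxx mul1r addr0 subrr.
  have : [ffun=> 0] = [ffun j => if j == ord0 then 1 else 0] :> {ffun 'I_m.+1 -> C}.
    by rewrite -E0.
  by move/ffunP/(_ ord0); rewrite !ffunE eqxx => /esym/eqP; rewrite oner_eq0.
Qed.

Lemma rep_shift z : rep (ts z t) (mx_shift a z).
Proof.
move=> i j; rewrite /mx_shift ra /ent /ts /= -(inj_eq pos_inj).
case: eqP => [e|_]; last by case: eqP => _; rewrite ?mulr1n ?mulr0n ?subr0.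
have ne : (pos i == pos j) = false by apply/negbTE/eqP => e'; move: e; rewrite e'; ilia.
  by rewrite ne mulr0n subr0.
Qed.

End Representation.

Section Entries.
Context {R : realType}.
Local Notation C := (Cplx R).
Variables (I : choiceType) (pos : I -> int) (g : int -> I) (D : int -> bool) (i0 : I).
Hypothesis gK : forall i, g (pos i) = i.
Hypothesis Kg : forall k, D k -> pos (g k) = k.
Hypothesis Dp : forall i, D (pos i).
Implicit Types (t : @coef R) (U V W : set C).

(** The coefficients outside the matrix are filled with arbitrary elements of
    the three sets. *)
Lemma tridiag_rep U V W a : U !=set0 -> V !=set0 -> W !=set0 ->
  tridiag pos U V W a -> exists2 t, Mt U V W t & rep pos t a.
Proof.
move=> [u0 hu] [v0 hv] [w0 hw] h.
exists (Coef (fun k => if D k && D (k - 1) then a (g k) (g (k - 1)) else u0)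
             (fun k => if D k then a (g k) (g k) else v0)
             (fun k => if D k && D (k + 1) then a (g k) (g (k + 1)) else w0)).
  move=> k; split=> /=; case: ifP => //.
  - move=> /andP[d1 d2]; have [+ _ _ _] := h (g k) (g (k - 1)).
    by apply; rewrite !Kg // subrK.
  - by move=> d; have [_ + _ _] := h (g k) (g k); apply.
  - move=> /andP[d1 d2]; have [_ _ + _] := h (g k) (g (k + 1)).
    by apply; rewrite !Kg.
move=> i j; rewrite /ent /= !Dp /=; case: eqP => [e|n1].
  have -> : pos i - 1 = pos j by rewrite e addrK.
  by rewrite Dp !gK.
case: eqP => [/(pos_inj gK) ->|n2]; first by rewrite gK.
case: eqP => [e|n3]; first by rewrite -e Dp !gK.
have [_ _ _ ->] := h i j => //; lia.
Qed.

Lemma ent_tridiag U V W t : Mt U V W t -> tridiag pos U V W (fun i j => ent t (pos i) (pos j)).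
Proof.
move=> h i j; have [h1 h2 h3] := h (pos i); rewrite /ent; split.
- by move=> ->; rewrite eqxx -[X in lo _ X]/(pos j + 1); have [] := h (pos j + 1).
- move=> e; have -> : (pos i == pos j + 1) = false by lia.
  by rewrite e eqxx -e.
- move=> e; have -> : (pos i == pos j + 1) = false by lia.
  have -> : (pos i == pos j) = false by lia.
  by rewrite e eqxx.
- move=> e; have -> : (pos i == pos j + 1) = false by lia.
  have -> : (pos i == pos j) = false by lia.
  by have -> : (pos j == pos i + 1) = false by lia.
Qed.

(** An entry is a coordinate of the image of a coordinate vector. *)
Lemma entry_le p (a : I -> I -> C) i j e : (1 <= p)%E ->
  (opnorm p (mxop a) <= e%:E)%E -> modulus (a i j) <= e.
Proof.
move=> p1 /opnorm_leP h.
pose x l : C := if l == j then 1 else 0.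
have nx : nle p x 1.
  apply/(nle_emb i0 gK Kg Dp _ _ p1); apply: nle_solid (nle_delta p1 (pos j)) => // k.
  rewrite /emb /x /delta; case: ifP => [Dk|_]; last by rewrite md0 md_ge0.
  case: eqP => [<-|_]; first by rewrite Kg // eqxx.
  by rewrite md0 md_ge0.
have /(nle_emb i0 gK Kg Dp _ _ p1) hn := h _ nx; have := nle_pt p1 (pos i) hn.
rewrite (emb_pos gK Dp) /mxop (fsbigE [:: j]) //.
  by rewrite (eq_bigl xpredT) ?big_seq1 /x ?eqxx ?mulr1 // => k; rewrite in_setT.
by move=> k _; rewrite inE /x => /negbTE ->; rewrite mulr0.
Qed.

End Entries.

(** * Compact sets of complex numbers *)
Section Topology.
Context {R : realType}.
Local Notation C := (Cplx R).

Lemma posC (e : C) : 0 < e -> exists2 d : R, 0 < d & e = (d%:C)%C.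
Proof.
case: e => a b; rewrite ltcE /= => /andP[/eqP e0 a0]; exists a => //.
by rewrite e0.
Qed.

(** The balls of the topology have radii in [R[i]], whose positive elements are
    the positive real numbers. *)
Lemma nbhs_md (z : C) (A : set C) :
  nbhs z A <-> exists2 e : R, 0 < e & forall w, modulus (z - w) < e -> A w.
Proof.
split=> [/nbhs_ballP[e /posC[d d0 ->] h]|[e e0 h]].
  by exists d => // w zw; apply: h; rewrite /ball /= mdE ltcR.
apply/nbhs_ballP; exists ((e%:C)%C) => [|w]; first by rewrite /= ltcR.
by rewrite /ball /= mdE ltcR; apply: h.
Qed.

Lemma md_continuous : continuous (fun z : C => modulus z : R^o).
Proof.
move=> z A /nbhs_ballP[e e0 h]; apply/nbhs_md; exists e => // w zw.
apply: h; rewrite /ball /= ltr_distlC.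
have := md_sub z w; have := md_sub w z; rewrite mdC; lra.
Qed.

Lemma compact_bdd (U : set C) : compact U -> exists c, bddset c U.
Proof.
move=> cU.
have := continuous_compact (continuous_subspaceT md_continuous) cU.
move/compact_bounded => [M [Mr h]]; exists (`|M| + 1) => z Uz.
have : M < `|M| + 1 by rewrite (le_lt_trans (ler_norm _)) // ltrDl.
by move/h => /(_ (modulus z)); rewrite /= ger0_norm ?md_ge0 //; apply; exists z.
Qed.

Lemma compact_bdd3 (U V W : set C) : compact U -> compact V -> compact W ->
  exists c, bdd3 c U V W.
Proof.
move=> /compact_bdd[a ha] /compact_bdd[b hb] /compact_bdd[c hc].
exists (`|a| + `|b| + `|c|); split; first by rewrite !addr_ge0.
- by move=> z /ha; have := ler_norm a; have := normr_ge0 b; have := normr_ge0 c; lra.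
- by move=> z /hb; have := ler_norm b; have := normr_ge0 a; have := normr_ge0 c; lra.
- by move=> z /hc; have := ler_norm c; have := normr_ge0 b; have := normr_ge0 a; lra.
Qed.
End Topology.

(** * Pseudoergodicity and favourability in terms of coefficients *)
Section Instances.
Context {R : realType}.
Local Notation C := (Cplx R).
Implicit Types (t : @coef R) (U V W : set C).

Notation posN := (fun i : nat => i%:Z).
Notation posZ := (fun i : int => i).
Notation posF n := (fun i : 'I_n => (val i)%:Z).

Lemma gN (k : int) : DN k -> (`|k|%N)%:Z = k.
Proof. by move=> k0; rewrite gez0_abs. Qed.

Lemma posNK (i : nat) : `|i%:Z|%N = i. Proof. by []. Qed.
Lemma posFK n (i : 'I_n.+1) : inord `|(val i)%:Z|%N = i.
Proof. by rewrite /= inord_val. Qed.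
Lemma gF n (k : int) : Df n.+1 k -> (val (inord `|k|%N : 'I_n.+1))%:Z = k.
Proof. by rewrite /Df => /andP[k0 kn]; rewrite /= inordK ?gez0_abs //; lia. Qed.
Lemma DfF n (i : 'I_n.+1) : Df n.+1 (val i)%:Z.
Proof. by rewrite /Df /= ltz_nat ltn_ord. Qed.
Lemma gZ (k : int) : DZ k -> k = k. Proof. by []. Qed.

Lemma rep_section t a n : rep posN t a -> rep (posF n) t (section_mx a 0 n).
Proof. by move=> h i j; rewrite /section_mx mxE !add0n h. Qed.

Section Fix.
Variables (p : \bar R) (p1 : (1 <= p)%E).

Lemma inv_normN t a c K : rep posN t a -> bnd c t -> 0 <= K ->
  (inv_norm p (mxop a) <= K%:E)%E <-> linv p DN t K.
Proof. by move=> ra bt K0; apply: (inv_norm_leP 0%N posNK gN (fun=> isT) ra bt). Qed.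

Lemma inv_normZ t a c K : rep posZ t a -> bnd c t -> 0 <= K ->
  (inv_norm p (mxop a) <= K%:E)%E <-> linv p DZ t K.
Proof. by move=> ra bt K0; apply: (inv_norm_leP (0 : int) (fun=> erefl) gZ (fun=> isT) ra bt). Qed.

Lemma inv_normF n t a c K : (0 < n)%N -> rep (posF n) t a -> bnd c t -> 0 <= K ->
  (inv_norm p (mxop a) <= K%:E)%E <-> linv p (Df n) t K.
Proof.
case: n a => // n a _ ra bt K0; apply: (inv_norm_leP ord0 (@posFK n) (@gF n) (@DfF n) ra bt) => //.
Qed.
End Fix.

Lemma pe_of U V W a t : pseudoergodic_plus U V W a -> rep posN t a -> Mt U V W t ->
  pe U V W t.
Proof.
move=> [_ h] ra Mtt; split=> // -[|n] t' e Mt' e0; first by exists 0%N.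
pose B := (\matrix_(i < n.+1, j < n.+1) ent t' i%:Z j%:Z) : 'M[C]_n.+1.
have [|k hk] := h n.+1 isT B _ e e0.
  move=> i j; have := ent_tridiag (posF n.+1) Mt' i j.
  by rewrite /B mxE.
exists k.
have E (i j : nat) : (i < n.+1)%N -> (j < n.+1)%N ->
    modulus (ent t (k + i)%:Z (k + j)%:Z - ent t' i%:Z j%:Z) <= e.
  move=> i1 j1; rewrite mdC.
  have two1 : (1 <= 2%:E :> \bar R)%E by rewrite lee_fin ler1n.
  have := entry_le ord0 (@posFK n) (@gF n) (@DfF n) (Ordinal i1) (Ordinal j1)
    two1 (ltW hk).
  by rewrite /B /section_mx !mxE ra.
move=> i i1; split=> [|i0|i2].
- have := E i i i1 i1; rewrite /ent !eqxx; have -> : ((k + i)%:Z == (k + i)%:Z + 1) = false by ilia.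
  by have -> : (i%:Z == i%:Z + 1) = false by ilia.
- have := E i i.-1 i1 (leq_ltn_trans (leq_pred i) i1); rewrite /ent.
  have -> : (k + i)%:Z == (k + i.-1)%:Z + 1 by ilia.
  by have -> : i%:Z == i.-1%:Z + 1 by ilia.
- have := E i i.+1 i1 i2; rewrite /ent.
  have -> : ((k + i)%:Z == (k + i.+1)%:Z + 1) = false by ilia.
  have -> : ((k + i)%:Z == (k + i.+1)%:Z) = false by ilia.
  have -> : ((k + i.+1)%:Z == (k + i)%:Z + 1) by ilia.
  have -> : (i%:Z == i.+1%:Z + 1) = false by ilia.
  have -> : (i%:Z == i.+1%:Z) = false by ilia.
  by have -> : (i.+1%:Z == i%:Z + 1) by ilia.
Qed.

Definition shset V (z : C) := [set v - z | v in V].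

Lemma Mt_ts U V W z t : Mt U V W t -> Mt U (shset V z) W (ts z t).
Proof. by move=> h i; have [h1 h2 h3] := h i; split=> //=; exists (di t i). Qed.

Lemma Mt_tsV U V W z t : Mt U (shset V z) W t -> Mt U V W (ts (- z) t).
Proof.
move=> h i; have [h1 [v hv e] h3] := h i; split=> //=.
by rewrite opprK -e subrK.
Qed.

Lemma pe_ts U V W z t : pe U V W t -> pe U (shset V z) W (ts z t).
Proof.
move=> [Mtt h]; split; first exact: Mt_ts.
move=> n t' e /Mt_tsV Mt' e0; have [k hk] := h n _ e Mt' e0.
exists k => i i1; have [h1 h2 h3] := hk i i1; split=> //.
by move: h1; rewrite /= opprK opprD addrA addrAC.
Qed.

Lemma bdd3_ts c U V W z : bdd3 c U V W -> bdd3 (c + modulus z) U (shset V z) W.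
Proof.
move=> [c0 bU bV bW]; have := md_ge0 z => z0; split; first by rewrite addr_ge0.
- by move=> u /bU; lra.
- by move=> _ [v /bV hv <-]; have := mdB v z; lra.
- by move=> u /bW; lra.
Qed.

Lemma pseudoergodic_shift U V W a z : pseudoergodic_plus U V W a ->
  pseudoergodic_plus U (shset V z) W (mx_shift a z).
Proof.
move=> [Ma h]; split.
  move=> i j; have [h1 h2 h3 h4] := Ma i j; rewrite /mx_shift; split.
  - move=> e; have -> : (i == j) = false by ilia.
    by rewrite mulr0n subr0; apply: h1.
  - move=> e; exists (a i j); first exact: h2.
    by case: e => ->; rewrite eqxx mulr1n.
  - move=> e; have -> : (i == j) = false by ilia.
    by rewrite mulr0n subr0; apply: h3.
  - move=> e; have -> : (i == j) = false by ilia.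
    by rewrite mulr0n subr0; apply: h4.
move=> n n0 B hB e e0.
have [|k hk] := h n n0 (B + z%:M) _ e e0.
  move=> i j; have [h1 h2 h3 h4] := hB i j; rewrite !mxE; split.
  - move=> e'; have -> : (i == j) = false by apply/negbTE/eqP => e''; rewrite e'' in e'; ilia.
    by rewrite mulr0n addr0; apply: h1.
  - move=> e'; have -> : i == j by apply/eqP/val_inj; case: e'.
    by have [v hv <-] := h2 e'; rewrite mulr1n subrK.
  - move=> e'; have -> : (i == j) = false by apply/negbTE/eqP => e''; rewrite e'' in e'; ilia.
    by rewrite mulr0n addr0; apply: h3.
  - move=> e'; have -> : (i == j) = false by apply/negbTE/eqP => e''; rewrite e'' in e'; ilia.
    by rewrite mulr0n addr0; apply: h4.
exists k; suff -> : (B - section_mx (mx_shift a z) k n)%R = (B + z%:M - section_mx a k n)%R by [].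
apply/matrixP => i j; rewrite !mxE /mx_shift eqn_add2l.
by rewrite opprB addrA addrAC -addrA.
Qed.

Lemma shset_nonempty V z : V !=set0 -> shset V z !=set0.
Proof. by move=> [v hv]; exists (v - z); exists v. Qed.

Lemma Mplus_ent U V W t : Mt U V W t -> Mplus U V W (fun i j => ent t i%:Z j%:Z).
Proof. exact: ent_tridiag. Qed.

Lemma M_ent U V W t : Mt U V W t -> M U V W (ent t).
Proof. exact: (@ent_tridiag _ _ (fun i : int => i)). Qed.

Lemma Mplus_rep U V W a : U !=set0 -> V !=set0 -> W !=set0 -> Mplus U V W a ->
  exists2 t, Mt U V W t & rep posN t a.
Proof. by move=> hU hV hW h; apply: (tridiag_rep posNK gN _ hU hV hW h). Qed.

Lemma M_rep U V W b : U !=set0 -> V !=set0 -> W !=set0 -> M U V W b ->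
  exists2 t, Mt U V W t & rep posZ t b.
Proof.
move=> hU hV hW h.
exact: (tridiag_rep (g := fun i => i) (D := DZ) (fun=> erefl) gZ _ hU hV hW h).
Qed.

Section Favour.
Variables (p : \bar R) (p1 : (1 <= p)%E) (U V W : set C).
Hypotheses (U0 : U !=set0) (V0 : V !=set0) (W0 : W !=set0).
Variable (c : R).
Hypothesis (bd : bdd3 c U V W).

Lemma compatible_expinv : compatible p U V W <-> (forall t, Mt U V W t -> expinv DZ t).
Proof.
have c0 := bdd3_ge0 bd.
have E a t : Mt U V W t -> rep posZ t a ->
    lp_invertible p (mxop a) <-> exists2 K, 0 <= K & linv p DZ t K.
  move=> tM ra.
  exact: (lp_invertibleP (0 : int) (fun=> erefl) gZ (fun=> isT) ra (bdd3_bnd bd tM)).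
split=> [h t tM|h b /(M_rep U0 V0 W0)[t tM rb]].
  have [K K0 tK] := (E _ _ tM (fun _ _ => erefl)).1 (h _ (M_ent tM)).
  exact: linv_expinv K0 c0 (bdd3_bnd bd tM) tK.
by apply/(E _ _ tM rb); apply: expinv_linv c0 (bdd3_bnd bd tM) (h _ tM).
Qed.

(** The norm of the inverse of the pseudoergodic operator is attained by a
    bi-infinite one and dominates those of all half-line operators. *)
Lemma favourable_fav a : pseudoergodic_plus U V W a -> favourable p U V W ->
  fav p U V W.
Proof.
move=> pa h K K0 hK t tM; have [[_ h1] [[b Mb h2] _]] := h _ pa.
apply/(inv_normN p1 (fun _ _ => erefl) (bdd3_bnd bd tM) K0).
have [s sM rb] := M_rep U0 V0 W0 Mb.
have := (inv_normZ p1 rb (bdd3_bnd bd sM) K0).2 (hK _ sM); rewrite h2.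
by apply: le_trans; apply: h1; exists (fun i j : nat => ent t i j) => //; apply: Mplus_ent.
Qed.

(** A bound for the pseudoergodic operator holds on the integers by [pe_limit]
    and then on the half line, so its inverse has the largest norm; the same
    coefficients on the integers attain this norm, since [pe_limit] also
    propagates a bound from there. *)
Lemma fav_favourable : (forall t, Mt U V W t -> expinv DN t) -> fav p U V W ->
  favourable p U V W.
Proof.
move=> all hf a pa; have c0 := bdd3_ge0 bd.
have [t tM ra] := Mplus_rep U0 V0 W0 pa.1.
have pet := pe_of pa ra tM.
have bt := bdd3_bnd bd tM.
have [K0 K00 K0t] := expinv_linv p1 c0 bt (all _ tM).
have fin : exists2 N : R, 0 <= N & inv_norm p (mxop a) = N%:E.
  have := (inv_normN p1 ra bt K00).2 K0t.
  have := inv_norm_ge0 0%N posNK gN (fun=> isT) a p1.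
  by case: (inv_norm p (mxop a)) => // N N0 _; exists N.
have [N N0 eN] := fin.
have tN : linv p DN t N by apply/(inv_normN p1 ra bt N0); rewrite eN.
have ZN s : Mt U V W s -> linv p DZ s N.
  exact: (pe_limit p1 bd pet _ N0 tN).
have NN := hf _ N0 ZN.
split; split.
- by exists a => //; case: pa.
- move=> _ [a' /(Mplus_rep U0 V0 W0)[s sM ra'] <-]; rewrite eN.
  exact/(inv_normN p1 ra' (bdd3_bnd bd sM) N0)/NN.
- exists (ent t); first exact: M_ent.
  apply/eqP; rewrite eq_le eN; apply/andP; split.
    exact/(inv_normZ p1 (fun _ _ => erefl) bt N0)/ZN.
  have := (inv_normZ (t := t) p1 (fun _ _ => erefl) bt N0).2 (ZN _ tM).
  have := inv_norm_ge0 (pos := fun i => i) (g := fun i => i) (0 : int) (fun=> erefl) gZ (fun=> isT) (ent t) p1.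
  case E : (inv_norm p (mxop (ent t))) => [N'| |] // N'0 _.
  have tN' : linv p DZ t N' by apply/(inv_normZ p1 (fun _ _ => erefl) bt N'0); rewrite E.
  have ZN' s : Mt U V W s -> linv p DZ s N' by apply: (pe_limit p1 bd pet _ N'0 tN').
  rewrite -eN; apply/(inv_normN p1 ra bt N'0); exact: hf ZN' _ tM.
- move=> _ [b /(M_rep U0 V0 W0)[s sM rb] <-]; rewrite eN.
  exact/(inv_normZ p1 rb (bdd3_bnd bd sM) N0)/ZN.
Qed.

Lemma kappa0_all : compatible p U V W -> kappa_eq p U V W 0 ->
  forall t, Mt U V W t -> expinv DN t.
Proof.
move=> /compatible_expinv all k0; apply: (half_line_index p1 bd all) => t tM.
exact: (fredholm_pinj_Sur 0%N posNK gN (fun=> isT) (fun _ _ => erefl)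
  p1 (k0 _ (Mplus_ent tM))).
Qed.

Lemma all_kappa0 : (forall t, Mt U V W t -> expinv DN t) -> kappa_eq p U V W 0.
Proof.
move=> all b /(Mplus_rep U0 V0 W0)[t tM rb]; have bt := bdd3_bnd bd tM.
have [K K0 hK] := expinv_linv p1 (bdd3_ge0 bd) bt (all _ tM).
exact: (linv_fredholm 0%N posNK gN (fun=> isT) rb p1 K0 hK).
Qed.

End Favour.

End Instances.

(** * Propagation of resolvent bounds *)
Section Core.
Context {R : realType}.
Local Notation C := (Cplx R).
Implicit Types (t : @coef R) (U V W : set C) (x : int -> C).

Section One.
Variables (p : \bar R) (p1 : (1 <= p)%E).

Lemma sections_limit t K c : 0 <= K -> bnd c t ->
  (forall m : nat, exists2 n, (m < n)%N & linv p (Df n) t K) -> linv p DN t K.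
Proof.
move=> K0 bt h; apply: (limit_inv p1 K0 bt) => m; have [n mn hn] := h m.
exists (Df n), t; split=> // i im.
  by rewrite /Df /DN; case: (leP 0 i) => //= i0; have -> : (i < n%:Z) by ilia.
have m0 : 0 <= m.+1%:R^-1 :> R by rewrite invr_ge0.
by split; rewrite subrr md0.
Qed.

Lemma finite_linv n t K : LB p (Df n) t K -> linv p (Df n) t K.
Proof. by move=> h; split => //; apply: finite_sur h. Qed.

(** A Neumann series in the form of an estimate. *)
Lemma LB_perturb D t z K : 0 <= K -> K * modulus z < 1 -> LB p D t K ->
  LB p D (ts z t) (K / (1 - K * modulus z)).
Proof.
move=> K0 Kz h x sx bx b hb.
have [n1 n2] := nrmP p1 bx.
have z0 := md_ge0 z.
have e : nle p (compr D t x) (b + modulus z * nrm p x).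
  have -> : compr D t x = fun i => compr D (ts z t) x i + z * x i.
    by apply/funext => i; rewrite compr_ts // subrK.
  by apply: nle_add => //; apply: nle_scale n1 => // i; rewrite mdM.
have := n2 _ (h _ sx bx _ e); move=> le.
apply: nle_trans n1 _.
rewrite mulrAC ler_pdivlMr ?subr_gt0 //.
move: le; rewrite mulrDr mulrA; lra.
Qed.

Lemma LB_far D t z c e : 0 <= c -> bnd c t -> 0 < e -> e + 3 * c <= modulus z ->
  LB p D (ts z t) e^-1.
Proof.
move=> c0 bt e0 hz x sx bx b hb.
have [n1 n2] := nrmP p1 bx.
have n0 := nle_ge0 p1 n1.
have z0 : 0 < modulus z by apply: lt_le_trans hz; rewrite ltr_pwDl // mulr_ge0.
have h : nle p x ((modulus z)^-1 * (3 * c * nrm p x + b)).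
  have : nle p (fun i => compr D t x i - compr D (ts z t) x i) (3 * c * nrm p x + b).
    by apply: nle_sub => //; apply: nle_compr.
  apply: nle_scale => // [|i]; first by rewrite invr_ge0 ltW.
  by rewrite compr_ts // opprB addrC subrK mdM mulrA mulVf ?mul1r // gt_eqF.
have := n2 _ h; rewrite mulrC ler_pdivlMr // => le.
apply: nle_trans n1 _; rewrite mulrC ler_pdivlMr //.
nra.
Qed.

Lemma far_linv t z c e : 0 <= c -> bnd c t -> 0 < e -> e + 3 * c <= modulus z ->
  linv p DN (ts z t) e^-1.
Proof.
move=> c0 bt e0 hz; apply: (@sections_limit _ _ (c + modulus z)).
- by rewrite invr_ge0 ltW.
- move=> i; have [h1 h2 h3] := bt i; have := md_ge0 z; split=> /=; try lra.
  by have := mdB (di t i) z; lra.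
- by move=> m; exists m.+1 => //; apply: finite_linv; apply: LB_far bt e0 hz.
Qed.
End One.

Lemma tsD z w t : ts w (ts z t) = ts (z + w) t.
Proof. by case: t => l d u; rewrite /ts /=; congr Coef; apply/funext => i; rewrite opprD addrA. Qed.

Lemma tr_ts z t : tr (ts z t) = ts z (tr t).
Proof. by []. Qed.

Lemma bnd_ts c z t : bnd c t -> bnd (c + modulus z) (ts z t).
Proof.
move=> bt i; have [h1 h2 h3] := bt i; have := md_ge0 z; split=> /=; try lra.
by have := mdB (di t i) z; lra.
Qed.

Section Two.
Variables (p q : \bar R) (p1 : (1 <= p)%E) (q1 : (1 <= q)%E).
Hypothesis pq : (p^-1 + q^-1 = 1)%E.

(** For [1 < p < 2] and [p = oo] the dual exponent is at least 2 or equal to 1,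
    and the transpose has the same bounds. *)
Lemma no_plateau D t c r0 M : 0 <= c -> bnd c t -> 0 < r0 -> 0 < M ->
  (forall z, modulus z <= r0 -> linv p D (ts z t) M) ->
  exists M', [/\ 0 <= M', M' < M & linv p D t M'].
Proof.
move=> c0 bt r00 M0 hM; apply: contrapT => nM.
have M00 := ltW M0.
have cc : 0 < c + 1 by rewrite ltr_wpDl.
have bt1 : bnd (c + 1) t by move=> i; have [] := bt i; split; lra.
have t0 := ts0 t.
have hp M' : 0 <= M' -> M' < M -> ~ LB p D t M'.
  move=> M'0 M'M h; apply: nM; exists M'; split=> //; split=> //.
  by have [] := hM 0; rewrite ?md0 ?ltW // t0.
have hMq z : modulus z <= r0 -> linv q D (ts z (tr t)) M.
  move=> zr; rewrite -tr_ts; apply: (dual_linv p1 q1 pq M00 _ (bnd_ts z bt) (hM _ zr)).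
  by rewrite addr_ge0 ?md_ge0.
have hq M' : 0 <= M' -> M' < M -> ~ LB q D (tr t) M'.
  move=> M'0 M'M h; apply: nM; exists M'; split=> //.
  have qp : (q^-1 + p^-1 = 1)%E by rewrite addeC.
  rewrite -(trK t); apply: (dual_linv q1 p1 qp M'0 c0 (bnd_tr bt)); split=> //.
  by have [] := hMq 0; rewrite ?md0 ?ltW // -tr_ts t0.
have bt' := bnd_tr bt1.
move: hM hp hMq hq; apply: (conj_ind p1 q1 pq (P := fun p q =>
 (forall z : Cplx R, modulus z <= r0 -> linv p D (ts z t) M) ->
 (forall M' : R, 0 <= M' -> M' < M -> ~ LB p D t M') ->
 (forall z : Cplx R, modulus z <= r0 -> linv q D (ts z (tr t)) M) ->
 (forall M' : R, 0 <= M' -> M' < M -> ~ LB q D (tr t) M') -> False)).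
- by move=> h1 h2 _ _; exact: (no_plateau1 cc bt1 r00 M0 h1 h2).
- by move=> _ _ h1 h2; exact: (no_plateau1 cc bt' r00 M0 h1 h2).
- move=> a b a1 b1 ab h1 h2 h3 h4; case: (leP 2 a) => [a2|a2].
    exact: (no_plateau2 a2 cc bt1 r00 M0 h1 h2).
  apply: (no_plateau2 _ cc bt' r00 M0 h3 h4).
  have a0 : 0 < a by lra.
  have b0 : 0 < b by lra.
  have : b + a = a * b.
    have : (a^-1 + b^-1) * (a * b) = a * b by rewrite ab mul1r.
    rewrite mulrDl mulrA mulVf ?gt_eqF // mul1r mulrCA mulVf ?gt_eqF // mulr1 //.
  nra.
Qed.

Variables (U V W : set C) (c : R).
Hypothesis bd : bdd3 c U V W.
Variable (t0 : @coef R).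
Hypothesis pe0 : pe U V W t0.
Let favs p := forall z, (forall t, Mt U (shset V z) W t -> expinv DZ t) ->
  (forall t, Mt U (shset V z) W t -> expinv DN t) -> fav p U (shset V z) W.
Hypotheses (fp : favs p) (fq : favs q).

(** From the half line to the integers by [pe_limit], back to all half-line operators by
    favourability, to the transposed class by reflection and duality, and to the
    sections by [section_LB]. *)
Lemma pe_propagate z K : 0 <= K -> linv p DN (ts z t0) K ->
  (forall t, Mt U (shset V z) W t -> linv p DN t K) /\
  (forall n t, (0 < n)%N -> Mt U (shset V z) W t -> linv p (Df n) t K).
Proof.
move=> K0 h; have bdz := bdd3_ts z bd; have pez := pe_ts z pe0.
move: (c + modulus z) (ts z t0) h bdz pez (fp (z := z)) (fq (z := z)).
move: (shset V z) => V' c' t h bd' pe' fp' fq'.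
have c'0 := bdd3_ge0 bd'.
have ZK s : Mt U V' W s -> linv p DZ s K.
  exact: (pe_limit p1 bd' pe' _ K0 h).
have Zd s : Mt U V' W s -> expinv DZ s.
  by move=> sM; apply: linv_expinv K0 c'0 (bdd3_bnd bd' sM) (ZK _ sM).
have Nd := half_line_all p1 bd' Zd pe'.1 K0 h.
have NK := fp' Zd Nd K K0 ZK.
(* [s] is the reflection of the transpose of an operator of the same class. *)
have ZKq s : Mt U V' W s -> linv q DZ s K.
  move=> sM; have s'M : Mt U V' W (tr (rf s)) by apply: Mt_tr; apply: Mt_rf.
  have := dual_linv p1 q1 pq K0 c'0 (bdd3_bnd bd' s'M) (ZK _ s'M).
  by rewrite trK => /(linv_rf q1); rewrite rfK.
have NKq := fq' Zd Nd K K0 ZKq.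
have qp : (q^-1 + p^-1 = 1)%E by rewrite addeC.
have NK' s : Mt W V' U s -> linv p DN s K.
  move=> sM; have s'M := Mt_tr sM; rewrite -(trK s).
  exact: (dual_linv q1 p1 qp K0 c'0 (bdd3_bnd bd' s'M) (NKq _ s'M)).
split=> // n s n0 sM; apply: (finite_linv p1).
apply: (section_LB p1 bd' K0 _ _ sM n0) => s' s'M; first by have [] := NK _ s'M.
by have [] := NK' _ s'M.
Qed.

(** The finite sections are needed only for surjectivity, which the perturbed lower
    bound gives in finite dimension; [sections_limit] then returns to the half line. *)
Lemma resolvent_open z z' K : 0 <= K -> K * modulus (z' - z) < 1 ->
  linv p DN (ts z t0) K -> linv p DN (ts z' t0) (K / (1 - K * modulus (z' - z))).
Proof.
move=> K0 Kz h; have [_ fin] := pe_propagate K0 h.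
have -> : ts z' t0 = ts (z' - z) (ts z t0) by rewrite tsD addrC subrK.
have bt := bdd3_bnd bd pe0.1.
apply: (sections_limit p1 _ (bnd_ts _ (bnd_ts _ bt))).
  by rewrite divr_ge0 // subr_ge0 ltW.
move=> m; exists m.+1 => //; apply: (finite_linv p1); apply: LB_perturb => //.
by have [] := fin m.+1 _ isT (Mt_ts z pe0.1).
Qed.

End Two.
End Core.

Local Existing Instance ultra_oo_pf.

(** * Increasing sequences of sets in the plane *)
Section SetLimits.
Context {R : realType}.
Local Notation C := (Cplx R).
Variables (S : nat -> set C) (T : set C).
Hypothesis incr : increases_to S T.
Hypothesis S0 : forall n, S n !=set0.

Lemma eventually_in w : T w -> exists N, forall n, (N <= n)%N -> S n w.
Proof. by move=> /incr.2[N _ h]; exists N => n Nn; apply: h. Qed.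

(** The point is approximated by almost nearest points of the sets [S n]. *)
Lemma closure_liminf : closure T `<=` set_liminf S.
Proof.
move=> z Tz.
pose E n : set R := [set modulus (z - w) | w in S n].
have lE n : has_lbound (E n) by exists 0 => _ [w _ <-]; exact: md_ge0.
have iE n : has_inf (E n).
  by split => //; have [w hw] := S0 n; exists (modulus (z - w)), w.
have /choice[u hu] n : exists w, S n w /\ modulus (z - w) < inf (E n) + n.+1%:R^-1.
  have n1 : 0 < n.+1%:R^-1 :> R by rewrite invr_gt0.
  by have [_ [w Sw <-] h] := inf_adherent n1 (iE n); exists w.
exists u => [n|]; first by have [] := hu n.
move=> A /nbhs_md[e e0 hA].
have e2 : 0 < e / 2 by rewrite divr_gt0.
have [|w [Tw zw]] := Tz [set w | modulus (z - w) < e / 2].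
  by apply/nbhs_md; exists (e / 2).
have [N hN] := eventually_in Tw.
have [N' _ hN'] := near_infty_natSinv_lt (PosNum e2).
exists (maxn N N') => // n /=; rewrite geq_max => /andP[Nn N'n].
apply: hA; have [_ h] := hu n; apply: lt_trans h _.
have h1 : inf (E n) <= modulus (z - w) by apply: ge_inf => //; exists w => //; apply: hN.
have h2 : n.+1%:R^-1 < e / 2 := hN' n N'n.
by rewrite (splitr e); apply: ltrD h2; apply: le_lt_trans h1 zw.
Qed.

Lemma limsup_closure : set_limsup S `<=` closure T.
Proof.
move=> z [u hu [phi _ hz]] A /hz => -[N _ /(_ N (leqnn N)) An].
by exists (u (phi N)); split => //; apply: incr.1 (hu _).
Qed.

Lemma liminf_limsup : set_liminf S `<=` set_limsup S.
Proof. by move=> z [u hu hz]; exists u => //; exists id. Qed.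

Lemma set_cvg_closure : set_cvg S (closure T).
Proof.
split; apply/seteqP; split.
- exact: (subset_trans liminf_limsup limsup_closure).
- exact: closure_liminf.
- exact: limsup_closure.
- exact: (subset_trans closure_liminf liminf_limsup).
Qed.

Variable (B : R).
Hypothesis TB : forall z, T z -> modulus z <= B.

(** Otherwise points of [T] far from [S n] would accumulate; one of them close to
    the limit belongs to [S n] for large [n] and is close to the others. *)
Lemma uniform_dense e : 0 < e ->
  exists N, forall n, (N <= n)%N -> forall b, T b -> exists2 w, S n w & modulus (b - w) <= e.
Proof.
move=> e0; apply: contrapT => /forallNP h.
have /choice[f hf] N : exists nb : nat * C, [/\ (N <= nb.1)%N, T nb.2 &
    forall w, S nb.1 w -> e < modulus (nb.2 - w)].
  have /existsNP[n /not_implyP[Nn /existsNP[b /not_implyP[Tb hb]]]] := h N.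
  exists (n, b); split => // w Sw; rewrite ltNge; apply/negP => le.
  by apply: hb; exists w.
have [|z hz] := @ucv_ex _ (fun n => (f n).2) B.
  by move=> n; have [_ /TB] := hf n.
have e2 : 0 < e / 2 by rewrite divr_gt0.
have U1 := hz _ e2.
have [i hi] := filter_ex U1.
have [_ Ti _] := hf i; have [N hN] := eventually_in Ti.
have [j [hj Nj]] := filter_ex (filterI U1 (ultra_ge N)).
have [jn _ /(_ (f i).2)] := hf j.
move=> /(_ (hN _ (leq_trans Nj jn))).
have -> : (f j).2 - (f i).2 = ((f j).2 - z) - ((f i).2 - z) by rewrite opprB addrA subrK.
have := mdB ((f j).2 - z) ((f i).2 - z); move: hi hj => /=; lra.
Qed.

Lemma set_dist_ge0 (a : C) A : (0 <= set_dist a A)%E.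
Proof. by apply: le_ereal_inf_tmp => _ [b _ <-]; rewrite lee_fin md_ge0. Qed.

Lemma set_dist_le (a : C) A b : A b -> (set_dist a A <= (modulus (a - b))%:E)%E.
Proof. by move=> Ab; apply: ereal_inf_lbound; exists b. Qed.

Lemma hausdorff_increasing : hausdorff_cvg S T.
Proof.
have T0 : T !=set0 by have [w /incr.1 Tw] := S0 0%N; exists w.
split.
- by move=> n; split => //; exists B => z /incr.1; apply: TB.
- by split => //; exists B.
have ge0 n : (0 <= hausdorff_dist (S n) T)%E.
  have [w Sw] := S0 n; rewrite /hausdorff_dist le_max; apply/orP; left.
  by apply: le_trans (set_dist_ge0 w T) _; apply: ereal_sup_ubound; exists w.
have le e : 0 < e -> exists N, forall n, (N <= n)%N -> (hausdorff_dist (S n) T <= e%:E)%E.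
  move=> e0; have [N hN] := uniform_dense e0; exists N => n Nn.
  rewrite /hausdorff_dist ge_max; apply/andP; split; apply: ub_ereal_sup => _ [b Tb <-].
    apply: le_trans (set_dist_le b (incr.1 _ _ Tb)) _.
    by rewrite subrr md0 lee_fin ltW.
  have [w Sw hw] := hN n Nn b Tb.
  by apply: le_trans (set_dist_le b Sw) _; rewrite lee_fin.
have fin e N : (forall n, (N <= n)%N -> (hausdorff_dist (S n) T <= e%:E)%E) ->
    forall n, (N <= n)%N -> hausdorff_dist (S n) T \is a fin_num /\ 0 <= fine (hausdorff_dist (S n) T) <= e.
  move=> h n /h; have := ge0 n; case: (hausdorff_dist _ _) => // r.
  by rewrite !lee_fin => r0 re; split => //=; rewrite r0.
apply/fine_cvgP; split.
  have [N hN] := le 1 (@ltr01 R); exists N => // n Nn.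
  by have [] := fin _ _ hN n Nn.
apply/cvgrPdist_le => e e0; have [N hN] := le e e0; exists N => // n Nn /=.
by have [_ /andP[h0 h1]] := fin _ _ hN n Nn; rewrite sub0r normrN ger0_norm.
Qed.

End SetLimits.

(** * Pseudospectra in terms of resolvent bounds *)
Section Spectra.
Context {R : realType}.
Local Notation C := (Cplx R).
Implicit Types (t : @coef R) (U V W : set C).
Notation posN := (fun i : nat => i%:Z).
Notation posF n := (fun i : 'I_n => (val i)%:Z).

Lemma spec_ltN p t a c eps z : (1 <= p)%E -> 0 < eps -> rep posN t a -> bnd c t ->
  spec_lt p eps a z <-> ~ linv p DN (ts z t) eps^-1.
Proof.
move=> p1 e0 ra bt; have e1 : 0 <= eps^-1 by rewrite invr_ge0 ltW.
have H := inv_normN p1 (rep_shift posNK ra z) (bnd_ts z bt) e1.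
rewrite /spec_lt /= ltNge; split=> [/negP h /H//|h].
by apply/negP => /H.
Qed.

Lemma spec_ltF n p t a c eps z : (1 <= p)%E -> 0 < eps -> (0 < n)%N ->
  rep posN t a -> bnd c t ->
  spec_lt p eps (section_mx a 0 n) z <-> ~ linv p (Df n) (ts z t) eps^-1.
Proof.
move=> p1 e0 n0 ra bt; have e1 : 0 <= eps^-1 by rewrite invr_ge0 ltW.
have rs : rep (posF n) (ts z t) (mx_shift (section_mx a 0 n) z).
  case: n n0 => // n _; have rs := @rep_section _ t a n.+1 ra.
  exact: (rep_shift (g := fun k => inord `|k|%N) (@posFK n) rs z).
have H := inv_normF p1 n0 rs (bnd_ts z bt) e1.
rewrite /spec_lt /= ltNge; split=> [/negP h /H//|h].
by apply/negP => /H.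
Qed.

Lemma spec_leN p t a c eps z : (1 <= p)%E -> 0 < eps -> rep posN t a -> bnd c t ->
  spec_le p eps a z <->
  (forall K, 0 <= K -> K < eps^-1 -> ~ linv p DN (ts z t) K).
Proof.
move=> p1 e0 ra bt.
have H K := inv_normN (K := K) p1 (rep_shift posNK ra z) (bnd_ts z bt).
rewrite /spec_le /=; split=> [h K K0 Ke /(H _ K0) h'|h].
  by have := le_trans h h'; rewrite lee_fin leNgt Ke.
rewrite leNgt; apply/negP => lt.
have := inv_norm_ge0 0%N posNK gN (fun=> isT) (mx_shift a z) p1.
move: lt (H); case: (inv_norm _ _) => // N; rewrite lte_fin => Ne HN; rewrite lee_fin => N0.
by apply: (h N N0 Ne); apply/(HN _ N0).
Qed.

Lemma favourable_cases p U V W c : (1 <= p)%E -> U !=set0 -> V !=set0 -> W !=set0 ->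
  bdd3 c U V W -> p = 2%:E \/ (U `|` W) 0 \/ U = W -> favourable_shifts p U V W.
Proof.
move=> p1 U0 V0 W0 bd h z Vz cp k0.
have bdz := bdd3_ts z bd; have Vz0 := shset_nonempty z V0.
have all := kappa0_all p1 U0 Vz0 W0 bdz cp k0.
apply: (fav_favourable p1 U0 Vz0 W0 bdz all).
have bd' : exists c, bdd3 c U Vz W by eexists; exact: bdz.
case: h => [p2|[[u0|w0]|UW]].
- by rewrite p2; apply: fav_2.
- exact: fav_U0.
- exact: fav_W0.
- by subst W; apply: fav_sym.
Qed.

Lemma favourable_favs p U V W c a : (1 <= p)%E -> U !=set0 -> V !=set0 -> W !=set0 ->
  bdd3 c U V W -> pseudoergodic_plus U V W a -> favourable_shifts p U V W ->
  forall z, (forall t, Mt U (shset V z) W t -> expinv DZ t) ->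
  (forall t, Mt U (shset V z) W t -> expinv DN t) -> fav p U (shset V z) W.
Proof.
move=> p1 U0 V0 W0 bd pa hf z Zd Nd.
have bdz := bdd3_ts z bd; have Vz0 := shset_nonempty z V0.
apply: (favourable_fav p1 U0 Vz0 W0 bdz (pseudoergodic_shift z pa)).
apply: hf; first exact/(compatible_expinv p1 U0 Vz0 W0 bdz).
exact: all_kappa0 bdz Nd.
Qed.

End Spectra.

(** * Pseudospectra of a pseudoergodic operator and of its sections *)
Section Main.
Context {R : realType}.
Local Notation C := (Cplx R).
Variables (U V W : set C) (c : R).
Hypotheses (U0 : U !=set0) (V0 : V !=set0) (W0 : W !=set0) (bd : bdd3 c U V W).
Variables (A : nat -> nat -> C) (hA : pseudoergodic_plus U V W A).
Variables (r : nat -> nat).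
Hypotheses (r_gt0 : forall n, (0 < r n)%N) (r_oo : r @ \oo --> \oo).
Variables (p q : \bar R) (p1 : (1 <= p)%E) (q1 : (1 <= q)%E).
Hypotheses (pq : (p^-1 + q^-1 = 1)%E) (fp : favourable_shifts p U V W)
  (fq : favourable_shifts q U V W).
Variables (eps : R) (eps0 : 0 < eps).
Variable (t : @coef R).
Hypotheses (tM : Mt U V W t) (rt : rep (fun i : nat => i%:Z) t A).

Let An n := section_mx A 0 (r n).
Let bt : bnd c t := bdd3_bnd bd tM.
Let K0 : 0 <= eps^-1. Proof. by rewrite invr_ge0 ltW. Qed.
Let pet : pe U V W t := pe_of hA rt tM.
Let favp := favourable_favs p1 U0 V0 W0 bd hA fp.
Let favq := favourable_favs q1 U0 V0 W0 bd hA fq.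
Let propagate z K := pe_propagate p1 q1 pq bd pet favp favq (z := z) (K := K).

Lemma sections_increase :
  increases_to (fun n => spec_lt p eps (An n)) (spec_lt p eps A).
Proof.
split=> [n z /(spec_ltF _ p1 eps0 (r_gt0 n) rt bt) h|z /(spec_ltN _ p1 eps0 rt bt) h].
  apply/(spec_ltN _ p1 eps0 rt bt) => h'; apply: h.
  exact: (propagate K0 h').2 _ _ (r_gt0 n) (Mt_ts z tM).
apply: contrapT => nn; apply: h; apply: (sections_limit p1 K0 (bnd_ts z bt)) => m.
apply: contrapT => h; apply: nn.
have := @cvgnyPgt _ _ _ r; move=> /(_ \oo _) [+ _] => /(_ r_oo m).
apply: filterS => n mn; apply/(spec_ltF _ p1 eps0 (r_gt0 n) rt bt) => h'.
by apply: h; exists (r n).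
Qed.

Lemma spec_Sigma : spec_lt p eps A = Sigma_plus p eps U V W.
Proof.
apply/seteqP; split=> z; first by exists A => //; case: hA.
move=> [B /(Mplus_rep U0 V0 W0)[s sM rs] /(spec_ltN _ p1 eps0 rs (bdd3_bnd bd sM)) h].
apply/(spec_ltN _ p1 eps0 rt bt) => h'; apply: h.
exact: (propagate K0 h').1 _ (Mt_ts z sM).
Qed.

(** One inclusion is the openness of strict bounds, the other one the absence of
    plateaus. *)
Lemma closure_spec : closure (spec_lt p eps A) = spec_le p eps A.
Proof.
apply/seteqP; split=> z hz.
  apply/(spec_leN _ p1 eps0 rt bt) => K K1 Ke hK.
  have Ke1 : K * eps < 1 by rewrite -ltr_pdivlMr // mul1r.
  (* Within this distance the perturbed bound [K / (1 - K d)] is below [1 / eps]. *)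
  pose d := (1 - K * eps) / (K + 1).
  have d0 : 0 < d by rewrite /d divr_gt0 // ?subr_gt0 // ltr_wpDl.
  have dK : d * (K + 1) = 1 - K * eps by rewrite /d divfK // gt_eqF // ltr_wpDl.
  have [|w [Tw zw]] := hz [set w | modulus (z - w) < d].
    by apply/nbhs_md; exists d.
  move: Tw => /(spec_ltN _ p1 eps0 rt bt); apply.
  have w1 : modulus (w - z) < d by rewrite mdC.
  have w0 := md_ge0 (w - z).
  have Kd : K * modulus (w - z) <= K * d by apply: ler_wpM2l => //; exact: ltW.
  have Ke0 : 0 <= K * eps by rewrite mulr_ge0 // ltW.
  have Kd2 : K * modulus (w - z) < 1 - K * eps by move: dK; rewrite mulrDr; lra.
  have Kd1 : K * modulus (w - z) < 1 by lra.
  have := resolvent_open p1 q1 pq bd pet favp favq K1 Kd1 hK.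
  move=> [h1 h2]; split => // x sx bx b hb.
  apply: (nle_trans (h1 x sx bx b hb)); apply: ler_wpM2r; first exact: (nle_ge0 p1 hb).
  by rewrite ler_pdivrMr ?subr_gt0 // mulrC ler_pdivlMr //; lra.
move=> B /nbhs_md[e e0 hB]; apply: contrapT => nB.
have e2 : 0 < e / 2 by rewrite divr_gt0.
have M0 : 0 < eps^-1 by rewrite invr_gt0.
have [||M' [M'0 M'1 hM]] := no_plateau p1 q1 pq (D := DN) _ (bnd_ts z bt) e2 M0.
- by rewrite addr_ge0 ?md_ge0 // (bdd3_ge0 bd).
- move=> w we; rewrite tsD; apply: contrapT => nl; apply: nB.
  exists (z + w); split; first exact/(spec_ltN _ p1 eps0 rt bt).
  by apply: hB; rewrite opprD addNKr mdN; lra.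
exact: (spec_leN _ p1 eps0 rt bt).1 hz _ M'0 M'1 hM.
Qed.

(** The operator has norm at most [3 c]. *)
Lemma spec_bounded z : spec_lt p eps A z -> modulus z <= eps + 3 * c.
Proof.
move=> /(spec_ltN _ p1 eps0 rt bt) h; rewrite leNgt; apply/negP => lt; apply: h.
by apply: (far_linv p1 (bdd3_ge0 bd) bt eps0); exact: ltW.
Qed.

Lemma section_nonempty n : spec_lt p eps (An n) !=set0.
Proof.
have [z [x [sx bx e [i xi]]]] := section_eigenvector p1 t (r_gt0 n).
exists z; apply/(spec_ltF _ p1 eps0 (r_gt0 n) rt bt) => -[h _].
by move/eqP: xi; apply; apply: LB_inj h sx bx e i.
Qed.

End Main.

Theorem proposition4p16 (R : realType) (U V W : set (Cplx R))
    (U0 : U !=set0) (V0 : V !=set0) (W0 : W !=set0)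
    (Uc : compact U) (Vc : compact V) (Wc : compact W)
    (A : nat -> nat -> Cplx R) (hA : pseudoergodic_plus U V W A)
    (r : nat -> nat) (r_gt0 : forall n, (0 < r n)%N) (r_oo : r @ \oo --> \oo)
    (p q : \bar R) (p1 : (1 <= p)%E) (q1 : (1 <= q)%E)
    (pq : (p^-1 + q^-1 = 1)%E) :
  let An n := section_mx A 0 (r n) in
  ((p = 2%:E /\ q = 2%:E) \/ (U `|` W) 0 \/ U = W ->
     favourable_shifts p U V W /\ favourable_shifts q U V W) /\
  (favourable_shifts p U V W -> favourable_shifts q U V W ->
   forall eps : R, 0 < eps ->
     [/\ increases_to (fun n => spec_lt p eps (An n)) (spec_lt p eps A),
         spec_lt p eps A = Sigma_plus p eps U V W,
         set_cvg (fun n => spec_lt p eps (An n)) (closure (spec_lt p eps A)),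
         closure (spec_lt p eps A) = spec_le p eps A
       & hausdorff_cvg (fun n => spec_lt p eps (An n)) (spec_lt p eps A)]).
Proof.
move=> An; have [c bd] := compact_bdd3 Uc Vc Wc.
split=> [h|fp fq eps eps0].
  by split; apply: (favourable_cases _ U0 V0 W0 bd) => //; case: h => [[? ?]|h];
    [left|right|left|right].
have [t tM rt] := Mplus_rep U0 V0 W0 hA.1.
have incr := sections_increase U0 V0 W0 bd hA r_gt0 r_oo p1 q1 pq fp fq eps0 tM rt.
have ne n := section_nonempty bd r_gt0 p1 eps0 tM rt n.
have le z := spec_bounded bd p1 eps0 tM rt (z := z).
split=> //.
- exact: (spec_Sigma U0 V0 W0 bd hA p1 q1 pq fp fq eps0 tM rt).
- exact: (set_cvg_closure incr ne).
- exact: (closure_spec U0 V0 W0 bd hA p1 q1 pq fp fq eps0 tM rt).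
- exact: (hausdorff_increasing incr ne le).
Qed.
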